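(* Let $M$ be a compact, orientable, irreducible 3-manifold with boundary a single torus $\partial M=T$. For all but finitely many primes $p$, the boundary curve of an essential surface in $M$ is strongly detected by $A_0$ if and only if it is strongly detected by $A_p$.
   Context: Fix a basis $\{\mathcal{M},\mathcal{L}\}$ of $\pi_1(T)$, identified with its image in $\pi_1(M)$. For an algebraically closed field $\mathbb{F}$ let $R_U(M,\mathbb{F})$ be the algebraic set of representations $\rho\colon\pi_1(M)\to\mathrm{SL}_2(\mathbb{F})$ such that $\rho(\mathcal{M})$ and $\rho(\mathcal{L})$ are upper triangular, with upper-left entries $m$ and $l$ respectively, and let $e\colon R_U(M,\mathbb{F})\to(\mathbb{F}\setminus\{0\})^2$, $\rho\mapsto(m,l)$. The eigenvalue variety is the Zariski closure of $e(R_U(M,\mathbb{F}))$; it has dimension at most one. Let $V_1$ be the union of its 1-dimensional components; it is defined by a principal ideal, and a generator of the radical of this ideal is the $A$-polynomial $A_{\mathbb{F}}(m,l)$, well defined up to units of $\mathbb{F}[m^{\pm1},l^{\pm1}]$. It depends only on the characteristic $p\geq 0$ of $\mathbb{F}$ and can be chosen with coefficients in the prime ring ($\mathbb{Z}$ if $p=0$, $\mathbb{Z}/p\mathbb{Z}$ if $p>0$); it is denoted $A_p$ ($A_0$ in characteristic $0$, e.g. $\mathbb{F}=\mathbb{C}$). The Newton polygon of a polynomial $f(m,l)$ is the convex hull of the exponents $(s,t)$ of monomials $m^sl^t$ appearing in $f$ with non-zero coefficient. A slope on $T$ (an unoriented isotopy class of essential simple closed curves, equivalently a primitive element $\mathcal{M}^r\mathcal{L}^s$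 up to inversion) is strongly detected by $A_p$ if it is a boundary slope of the Newton polygon of $A_p$, i.e. if some edge of the Newton polygon is parallel to the vector $(r,s)$ (by the boundary slopes theorem this is equivalent to being strongly detected by an ideal point of a curve in the variety of $\mathrm{SL}_2(\mathbb{F})$-characters of $M$, $\mathrm{char}\,\mathbb{F}=p$). An essential surface in $M$ is a non-empty properly embedded bicollared surface, each component of which is $\pi_1$-injective, not a 2-sphere and not boundary parallel. *)

(* Defs.v *)
From HB Require Import structures.
From mathcomp Require Import all_boot all_order all_algebra.
From mathcomp Require Import generic_quotient monoid.
From mathcomp Require Import all_classical all_reals all_analysis.
From mathcomp Require Import polyXY lra.

Set Implicit Arguments.
Unset Strict Implicit.
Unset Printing Implicit Defensive.

Import Order.TTheory GRing.Theory Num.Theory.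
Import numFieldNormedType.Exports.

Local Open Scope classical_set_scope.
Local Open Scope ring_scope.
Local Open Scope quotient_scope.

Section WithinContinuity.

Lemma within_comp (T U V : topologicalType) (A : set T) (B : set U)
    (f : T -> U) (g : U -> V) :
  {within A, continuous f} -> {within B, continuous g} ->
  (forall x, A x -> B (f x)) -> {within A, continuous (g \o f)}.
Proof.
move=> /subspace_continuousP cf /subspace_continuousP cg AB.
apply/subspace_continuousP => x Ax W /= nW.
have := cg _ (AB _ Ax) _ nW; rewrite /= !nbhs_simpl /within /= => H.
have := cf _ Ax _ H; rewrite /= !nbhs_simpl /within /=.
by apply: filterS => y /= Hy Ay; apply: Hy => //; apply: AB.
Qed.

Lemma within_paste (T U : topologicalType) (A B C : set T) (f g h : T -> U) :
  closed A -> closed B -> C = A `|` B ->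
  {within A, continuous f} -> {within B, continuous g} ->
  (forall x, A x -> f x = h x) -> (forall x, B x -> g x = h x) ->
  {within C, continuous h}.
Proof.
move=> cA cB -> cf cg fh gh; apply: withinU_continuous => //.
- by apply: subspace_eq_continuous cf => x /set_mem /fh.
- by apply: subspace_eq_continuous cg => x /set_mem /gh.
Qed.

End WithinContinuity.

Section FundamentalGroup.
Variables (R : realType) (X : topologicalType).

Definition unit_itv : set R := [set t | 0 <= t <= 1].
Definition unit_square : set (R * R) := unit_itv `*` unit_itv.

(* A loop in the subset A of X, based at x; only its values on [0,1] matter. *)
Record loop (A : set X) (x : X) := Loop {
  loop_fun :> R -> X;
  loop_cont : {within unit_itv, continuous loop_fun};
  loop_sub : forall t, unit_itv t -> A (loop_fun t);
  loop0 : loop_fun 0 = x;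
  loop1 : loop_fun 1 = x }.
Arguments loop_cont {A x} l : rename.
Arguments loop_sub {A x} l t _ : rename.

HB.instance Definition _ A x := gen_eqMixin (loop A x).
HB.instance Definition _ A x := gen_choiceMixin (loop A x).

Definition homotopic A x (f g : loop A x) : Prop :=
  exists H : R * R -> X,
    [/\ {within unit_square, continuous H},
        forall z, unit_square z -> A (H z),
        forall t, unit_itv t -> H (0, t) = f t /\ H (1, t) = g t &
        forall s, unit_itv s -> H (s, 0) = x /\ H (s, 1) = x].

Lemma unit_itv0 : unit_itv 0. Proof. by rewrite /unit_itv /= lexx ler01. Qed.
Lemma unit_itv1 : unit_itv 1. Proof. by rewrite /unit_itv /= lexx ler01. Qed.
Hint Resolve unit_itv0 unit_itv1 : core.

Lemma closed_le_fun (T : topologicalType) (f g : T -> R) :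
  continuous f -> continuous g -> closed [set z | f z <= g z].
Proof.
move=> cf cg.
have -> : [set z | f z <= g z] = (fun z => g z - f z) @^-1` [set y | 0 <= y].
  by apply/seteqP; split => z /=; rewrite subr_ge0.
apply: preimage_closed; last exact: closed_ge.
by move=> z _; apply: (@cvgB _ R^o); [exact: cg | exact: cf].
Qed.

Lemma cont_fst : continuous (fst : R * R -> R).
Proof. by case=> a b; exact: cvg_fst. Qed.
Lemma cont_snd : continuous (snd : R * R -> R).
Proof. by case=> a b; exact: cvg_snd. Qed.
Lemma cont_affine (T : topologicalType) (f : T -> R) (a b : R) :
  continuous f -> continuous (fun t => a * f t + b).
Proof.
move=> cf t; apply: (@continuousD _ R^o _ (fun t => a * f t)); last exact: cvg_cst.
by apply: (@continuousM R _ (fun=> a) f); [exact: cvg_cst | exact: cf].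
Qed.
Lemma cont_id : continuous (fun t : R => t). Proof. by move=> t; exact: cvg_id. Qed.

Lemma cont_pair (T : topologicalType) (f g : T -> R) :
  continuous f -> continuous g -> continuous (fun t => (f t, g t)).
Proof. by move=> cf cg t; apply: (@cvg_pair _ _ _ (nbhs t) (nbhs (f t)) (nbhs (g t))); [exact: cf | exact: cg]. Qed.

Lemma closed_unit_square : closed unit_square.
Proof.
have -> : unit_square = [set z | 0 <= z.1] `&` [set z | z.1 <= 1] `&`
    ([set z | 0 <= z.2] `&` [set z | z.2 <= 1]).
  apply/seteqP; split=> -[s t]; rewrite /unit_square /unit_itv /=.
    by case=> /= /andP[-> ->] /andP[-> ->].
  by case=> -[-> ->] [-> ->].
by do 2?apply: closedI; apply: closed_le_fun;
   (exact: cont_fst || exact: cont_snd || (move=> ?; exact: cvg_cst)).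
Qed.

Lemma closed_unit_itv : closed unit_itv.
Proof.
have -> : unit_itv = [set z | 0 <= z] `&` [set z | z <= 1].
  by apply/seteqP; split => t; rewrite /unit_itv /=; [move=> /andP | move=> /andP].
by apply: closedI; [exact: closed_ge | exact: closed_le].
Qed.

Section Homotopy.
Variables (A : set X) (x : X).

Lemma homotopic_reparam (f : R -> X) (phi psi : R -> R) (g h : loop A x) :
  {within unit_itv, continuous f} -> (forall t, unit_itv t -> A (f t)) ->
  continuous phi -> continuous psi ->
  (forall t, unit_itv t -> unit_itv (phi t)) ->
  (forall t, unit_itv t -> unit_itv (psi t)) ->
  phi 0 = psi 0 -> phi 1 = psi 1 ->
  (forall t, unit_itv t -> g t = f (phi t)) ->
  (forall t, unit_itv t -> h t = f (psi t)) -> homotopic g h.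
Proof.
move=> cf Af cphi cpsi Iphi Ipsi e0 e1 gE hE.
pose F (z : R * R) := phi z.2 + z.1 * (psi z.2 - phi z.2).
have IF z : unit_square z -> unit_itv (F z).
  case: z => s t [/= /andP[s0 s1] It]; have := Iphi _ It; have := Ipsi _ It.
  by rewrite /F /unit_itv /= => /andP[? ?] /andP[? ?]; apply/andP; split; nra.
have cF : continuous F.
  have c1 : continuous (fun z : R * R => phi z.2).
    by move=> z; apply: continuous_comp; [exact: cont_snd | exact: cphi].
  have c2 : continuous (fun z : R * R => psi z.2).
    by move=> z; apply: continuous_comp; [exact: cont_snd | exact: cpsi].
  move=> z; apply: (@cvgD _ R^o); first exact: c1.
  apply: cvgM; first exact: cont_fst.
  by apply: (@cvgB _ R^o); [exact: c2 | exact: c1].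
exists (f \o F); split.
- by apply: within_comp cf IF; apply: continuous_subspaceT.
- by move=> z /IF /Af.
- move=> t It /=; rewrite gE // hE //; split; congr f; rewrite /F /=.
    by rewrite mul0r addr0.
  by rewrite mul1r addrC subrK.
- move=> s Is /=; rewrite /F /= e0 e1 !subrr !mulr0 !addr0.
  by rewrite -e0 -e1 -!gE // loop0 loop1.
Qed.

Lemma homotopic_refl (f : loop A x) : homotopic f f.
Proof.
by apply: (homotopic_reparam (loop_cont f) (loop_sub f) (phi := id)
  (psi := id)) => //; exact: cont_id.
Qed.

Lemma homotopic_sym (f g : loop A x) : homotopic f g -> homotopic g f.
Proof.
case=> H [cH AH H01 Hx].
pose F (z : R * R) := (1 - z.1, z.2).
have I1 s : unit_itv s -> unit_itv (1 - s).
  by rewrite /unit_itv /= => /andP[? ?]; apply/andP; split; lra.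
have SF z : unit_square z -> unit_square (F z).
  by case: z => s t [/= Is It]; split => //=; apply: I1.
have cF : continuous F.
  apply: cont_pair cont_snd => z.
  by apply: (@cvgB _ R^o); [exact: cvg_cst | exact: cont_fst].
exists (H \o F); split.
- by apply: within_comp cH SF; apply: continuous_subspaceT.
- by move=> z /SF /AH.
- by move=> t It; rewrite /F /= subr0 subrr; case: (H01 t It).
- by move=> s Is; rewrite /F /=; apply: Hx; apply: I1.
Qed.

Lemma homotopic_trans (f g h : loop A x) :
  homotopic f g -> homotopic g h -> homotopic f h.
Proof.
case=> H [cH AH H01 Hx] [K [cK AK K01 Kx]].
pose P (z : R * R) := (2 * z.1 + 0, z.2).
pose Q (z : R * R) := (2 * z.1 + -1, z.2).
pose L (z : R * R) := if z.1 <= 2^-1 then H (P z) else K (Q z).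
pose SA := unit_square `&` [set z | z.1 <= 2^-1].
pose SB := unit_square `&` [set z | 2^-1 <= z.1].
have csq := closed_unit_square.
have SP z : SA z -> unit_square (P z).
  rewrite /SA /P /unit_square /unit_itv; case: z => s t /= [[/andP[? ?] It] ?].
  by split => //=; apply/andP; split; lra.
have SQ z : SB z -> unit_square (Q z).
  rewrite /SB /Q /unit_square /unit_itv; case: z => s t /= [[/andP[? ?] It] ?].
  by split => //=; apply/andP; split; lra.
exists L; split.
- apply: (@within_paste _ _ SA SB _ (H \o P) (K \o Q)).
  + apply: closedI => //; apply: closed_le_fun; first exact: cont_fst.
    by move=> ?; exact: cvg_cst.
  + apply: closedI => //; apply: closed_le_fun; last exact: cont_fst.
    by move=> ?; exact: cvg_cst.
  + rewrite /SA /SB -setIUr; apply/seteqP; split => z; last by case.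
    move=> Sz; split => //=; case: (lerP z.1 2^-1) => h1; first by left.
    by right; apply: ltW.
  + apply: within_comp cH SP; apply: continuous_subspaceT.
    by apply: cont_pair cont_snd; apply: cont_affine cont_fst.
  + apply: within_comp cK SQ; apply: continuous_subspaceT.
    by apply: cont_pair cont_snd; apply: cont_affine cont_fst.
  + by move=> z [_ /= h1]; rewrite /L h1.
  + move=> -[s t] [[/= Is It] h1]; rewrite /L /=; case: ifP => // h2.
    have -> : s = 2^-1 by apply/eqP; rewrite eq_le h1 h2.
    rewrite /P /Q /= divff ?pnatr_eq0 // addr0 subrr.
    by case: (K01 t It) => -> _; case: (H01 t It) => _ ->.
- move=> z Sz; rewrite /L; case: ifP => h1; first by apply: AH; apply: SP.
  by apply: AK; apply: SQ; split => //=; rewrite ltW // ltNge h1.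
- move=> t It; rewrite /L /= /P /Q /= invr_ge0 ler0n mulr0 addr0 mulr1.
  have -> : (1 <= 2^-1 :> R) = false by apply/negbTE; rewrite -ltNge; lra.
  have -> : 2 + -1 = 1 :> R by lra.
  by split; [case: (H01 t It) | case: (K01 t It)].
- move=> s Is; rewrite /L /=; case: ifP => h1.
    suff /Hx : unit_itv (2 * s + 0) by [].
    by have [] := SP (s, 0) (conj (conj Is unit_itv0) h1).
  suff /Kx : unit_itv (2 * s + -1) by [].
  have h2 : 2^-1 <= s by rewrite ltW // ltNge h1.
  by have [] := SQ (s, 0) (conj (conj Is unit_itv0) h2).
Qed.

Definition homotopicb (f g : loop A x) : bool := `[< homotopic f g >].

Lemma homotopicb_refl : reflexive homotopicb.
Proof. by move=> f; apply/asboolP; exact: homotopic_refl. Qed.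
Lemma homotopicb_sym : symmetric homotopicb.
Proof.
by move=> f g; apply/asboolP/asboolP; exact: homotopic_sym.
Qed.
Lemma homotopicb_trans : transitive homotopicb.
Proof.
move=> g f h /asboolP fg /asboolP gh; apply/asboolP.
exact: homotopic_trans fg gh.
Qed.

Canonical homotopy_equiv :=
  EquivRel homotopicb homotopicb_refl homotopicb_sym homotopicb_trans.

Definition concat_fun (f g : R -> X) (t : R) : X :=
  if t <= 2^-1 then f (2 * t + 0) else g (2 * t + -1).

Lemma concat_cont (f g : loop A x) :
  {within unit_itv, continuous (concat_fun f g)}.
Proof.
pose SA := unit_itv `&` [set z | z <= 2^-1].
pose SB := unit_itv `&` [set z | 2^-1 <= z].
apply: (@within_paste _ _ SA SB _ (f \o (fun t => 2 * t + 0))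
                                 (g \o (fun t => 2 * t + -1))).
- by apply: closedI; [exact: closed_unit_itv | exact: closed_le].
- by apply: closedI; [exact: closed_unit_itv | exact: closed_ge].
- rewrite /SA /SB -setIUr; apply/seteqP; split => z; last by case.
  move=> Sz; split => //=; case: (lerP z 2^-1) => h1; first by left.
  by right; apply: ltW.
- apply: (within_comp _ (loop_cont f)).
    by apply: continuous_subspaceT; apply: cont_affine cont_id.
  rewrite /SA /unit_itv => t /= [/andP[? ?] ?]; apply/andP; split; lra.
- apply: (within_comp _ (loop_cont g)).
    by apply: continuous_subspaceT; apply: cont_affine cont_id.
  rewrite /SB /unit_itv => t /= [/andP[? ?] ?]; apply/andP; split; lra.
- by move=> t [_ /= h1]; rewrite /concat_fun h1.
- move=> t [It /= h1]; rewrite /concat_fun; case: ifP => // h2.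
  have -> : t = 2^-1 by apply/eqP; rewrite eq_le h1 h2.
  by rewrite divff ?pnatr_eq0 // addr0 subrr loop0 loop1.
Qed.

Lemma concat_sub (f g : loop A x) t : unit_itv t -> A (concat_fun f g t).
Proof.
rewrite /concat_fun /unit_itv /= => /andP[? ?].
case: (lerP t 2^-1) => h1; apply: loop_sub; rewrite /unit_itv /=;
  by apply/andP; split; lra.
Qed.

Lemma concat0 (f g : loop A x) : concat_fun f g 0 = x.
Proof.
by rewrite /concat_fun invr_ge0 ler0n mulr0 addr0 loop0.
Qed.

Lemma concat1 (f g : loop A x) : concat_fun f g 1 = x.
Proof.
rewrite /concat_fun.
have -> : (1 <= 2^-1 :> R) = false by apply/negbTE; rewrite -ltNge; lra.
have -> : 2 * 1 + -1 = 1 :> R by lra.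
exact: loop1.
Qed.

Definition concat (f g : loop A x) : loop A x :=
  Loop (@concat_cont f g) (@concat_sub f g) (concat0 f g) (concat1 f g).

Lemma unit_itv_rev t : unit_itv t -> unit_itv (-1 * t + 1).
Proof. by rewrite /unit_itv /= => /andP[? ?]; apply/andP; split; lra. Qed.

Lemma loop_rev_cont (f : loop A x) :
  {within unit_itv, continuous (fun t => f (-1 * t + 1))}.
Proof.
apply: (@within_comp _ _ _ unit_itv unit_itv (fun t => -1 * t + 1) f).
- by apply: continuous_subspaceT; apply: cont_affine cont_id.
- exact: loop_cont.
- exact: unit_itv_rev.
Qed.

Lemma loop_rev_sub (f : loop A x) t : unit_itv t -> A (f (-1 * t + 1)).
Proof. by move=> /unit_itv_rev; apply: loop_sub. Qed.

Lemma loop_rev0 (f : loop A x) : f (-1 * 0 + 1) = x.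
Proof. by rewrite mulr0 add0r loop1. Qed.

Lemma loop_rev1 (f : loop A x) : f (-1 * 1 + 1) = x.
Proof. by rewrite mulr1 addNr loop0. Qed.

Definition loop_rev (f : loop A x) : loop A x :=
  Loop (@loop_rev_cont f) (@loop_rev_sub f) (loop_rev0 f) (loop_rev1 f).

Lemma cst_loop_cont : {within unit_itv, continuous (fun _ : R => x)}.
Proof. by apply: continuous_subspaceT => t; exact: cvg_cst. Qed.

Definition cst_loop (Ax : A x) : loop A x :=
  Loop (@cst_loop_cont) (fun _ _ => Ax) erefl erefl.

Lemma cont_min (f g : R -> R) : continuous f -> continuous g ->
  continuous (fun t => Num.min (f t) (g t)).
Proof. by move=> cf cg t; apply: (@continuous_min R); [exact: cf|exact: cg]. Qed.

Lemma cont_max (f g : R -> R) : continuous f -> continuous g ->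
  continuous (fun t => Num.max (f t) (g t)).
Proof. by move=> cf cg t; apply: (@continuous_max R); [exact: cf|exact: cg]. Qed.

Lemma concat_assoc (f g h : loop A x) :
  homotopic (concat f (concat g h)) (concat (concat f g) h).
Proof.
pose phi (t : R) := Num.min (2 * t + 0) (Num.min (1 * t + 4^-1) (2^-1 * t + 2^-1)).
apply: (homotopic_reparam (loop_cont (concat f (concat g h)))
  (loop_sub (concat f (concat g h))) (phi := id) (psi := phi)) => //.
- exact: cont_id.
- by apply: cont_min; [|apply: cont_min]; apply: cont_affine cont_id.
- rewrite /unit_itv /phi /= => t /andP[? ?]; rewrite !le_min !ge_min.
  apply/andP; split; [apply/and3P; split; lra|].
  by apply/orP; right; apply/orP; right; lra.
- rewrite /phi; case: (lerP (1 * 0 + 4^-1) (2^-1 * 0 + 2^-1)) => ?;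
  case: lerP => ?; lra.
- rewrite /phi; case: (lerP (1 * 1 + 4^-1) (2^-1 * 1 + 2^-1)) => ?;
  case: lerP => ?; lra.
move=> t; rewrite /unit_itv /= => /andP[t0 t1].
have E : [\/ (t <= 4^-1) /\ phi t = 2 * t,
   (4^-1 < t <= 2^-1) /\ phi t = t + 4^-1 |
   (2^-1 < t) /\ phi t = 2^-1 * t + 2^-1].
  rewrite /phi; case: (lerP t 4^-1) => h4.
    apply: Or31; split => //.
    by case: (lerP (1 * t + 4^-1) (2^-1 * t + 2^-1)) => ?; case: lerP => ?; lra.
  case: (lerP t 2^-1) => h2.
    apply: Or32; split => //.
    by case: (lerP (1 * t + 4^-1) (2^-1 * t + 2^-1)) => ?; case: lerP => ?; lra.
  apply: Or33; split => //.
  by case: (lerP (1 * t + 4^-1) (2^-1 * t + 2^-1)) => ?; case: lerP => ?; lra.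
rewrite /concat_fun; case: E => -[ht ->].
- have -> : t <= 2^-1 by lra.
  have -> : 2 * t + 0 <= 2^-1 by lra.
  have -> : 2 * t <= 2^-1 by lra.
  by congr (f _); lra.
- have /andP[h1 h2] := ht; rewrite h2.
  have -> : (2 * t + 0 <= 2^-1) = false by apply/negbTE; rewrite -ltNge; lra.
  have -> : (t + 4^-1 <= 2^-1) = false by apply/negbTE; rewrite -ltNge; lra.
  have -> : 2 * (t + 4^-1) + -1 <= 2^-1 by lra.
  by congr (g _); lra.
- have -> : (t <= 2^-1) = false by apply/negbTE; rewrite -ltNge; lra.
  have -> : (2^-1 * t + 2^-1 <= 2^-1) = false by apply/negbTE; rewrite -ltNge; lra.
  have -> : (2 * (2^-1 * t + 2^-1) + -1 <= 2^-1) = false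
    by apply/negbTE; rewrite -ltNge; lra.
  by congr (h _); lra.
Qed.

Lemma concat_cstl (Ax : A x) (f : loop A x) :
  homotopic (concat (cst_loop Ax) f) f.
Proof.
pose phi (t : R) := Num.max (0 * t + 0) (2 * t + -1).
apply: (homotopic_reparam (loop_cont f) (loop_sub f) (phi := phi) (psi := id)) => //.
- by apply: cont_max; apply: cont_affine cont_id.
- exact: cont_id.
- rewrite /unit_itv /phi /= => t /andP[? ?]; rewrite le_max ge_max.
  by apply/andP; split; [apply/orP; left; lra | apply/andP; split; lra].
- by rewrite /phi; case: lerP => ?; lra.
- by rewrite /phi; case: lerP => ?; lra.
move=> t; rewrite /unit_itv /= => /andP[t0 t1]; rewrite /concat_fun /phi.
case: (lerP t 2^-1) => h; case: lerP => h' /=; try by exfalso; lra.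
- have -> : 2 * t + -1 = 0 by lra.
  by rewrite loop0.
- by rewrite mul0r addr0 loop0.
- by [].
Qed.

Lemma concat_cstr (Ax : A x) (f : loop A x) :
  homotopic (concat f (cst_loop Ax)) f.
Proof.
pose phi (t : R) := Num.min (0 * t + 1) (2 * t + 0).
apply: (homotopic_reparam (loop_cont f) (loop_sub f) (phi := phi) (psi := id)) => //.
- by apply: cont_min; apply: cont_affine cont_id.
- exact: cont_id.
- rewrite /unit_itv /phi /= => t /andP[? ?]; rewrite le_min ge_min.
  by apply/andP; split; [apply/andP; split; lra | apply/orP; left; lra].
- by rewrite /phi; case: lerP => ?; lra.
- by rewrite /phi; case: lerP => ?; lra.
move=> t; rewrite /unit_itv /= => /andP[t0 t1]; rewrite /concat_fun /phi.
case: (lerP t 2^-1) => h; case: lerP => h' /=; try by exfalso; lra.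
- by congr (f _); lra.
- by [].
- by rewrite mul0r add0r loop1.
Qed.

Lemma concat_revr (Ax : A x) (f : loop A x) :
  homotopic (concat f (loop_rev f)) (cst_loop Ax).
Proof.
pose phi (t : R) := Num.min (2 * t + 0) (- 2 * t + 2).
apply: (homotopic_reparam (loop_cont f) (loop_sub f)
  (phi := phi) (psi := fun=> 0)) => //.
- by apply: cont_min; apply: cont_affine cont_id.
- by move=> t; exact: cvg_cst.
- rewrite /unit_itv /phi /= => t /andP[? ?]; rewrite le_min ge_min.
  apply/andP; split; first by apply/andP; split; lra.
  by apply/orP; case: (lerP t 2^-1) => ?; [left | right]; lra.
- by rewrite /phi; case: lerP => ?; lra.
- by rewrite /phi; case: lerP => ?; lra.
- move=> t; rewrite /unit_itv /= => /andP[t0 t1]; rewrite /concat_fun /phi.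
  by case: (lerP t 2^-1) => h; case: lerP => h'; congr (f _); lra.
- by move=> t _; rewrite loop0.
Qed.

Lemma concat_revl (Ax : A x) (f : loop A x) :
  homotopic (concat (loop_rev f) f) (cst_loop Ax).
Proof.
pose phi (t : R) := Num.max (- 2 * t + 1) (2 * t + -1).
apply: (homotopic_reparam (loop_cont f) (loop_sub f)
  (phi := phi) (psi := fun=> 1)) => //.
- by apply: cont_max; apply: cont_affine cont_id.
- by move=> t; exact: cvg_cst.
- rewrite /unit_itv /phi /= => t /andP[? ?]; rewrite le_max ge_max.
  apply/andP; split; last by apply/andP; split; lra.
  by apply/orP; case: (lerP t 2^-1) => ?; [left | right]; lra.
- by rewrite /phi; case: lerP => ?; lra.
- by rewrite /phi; case: lerP => ?; lra.
- move=> t; rewrite /unit_itv /= => /andP[t0 t1]; rewrite /concat_fun /phi.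
  by case: (lerP t 2^-1) => h; case: lerP => h'; congr (f _); lra.
- by move=> t _; rewrite loop1.
Qed.

Lemma concat_homotopic (f f' g g' : loop A x) :
  homotopic f f' -> homotopic g g' -> homotopic (concat f g) (concat f' g').
Proof.
case=> H [cH AH H01 Hx] [K [cK AK K01 Kx]].
pose P (z : R * R) := (z.1, 2 * z.2 + 0).
pose Q (z : R * R) := (z.1, 2 * z.2 + -1).
pose L (z : R * R) := if z.2 <= 2^-1 then H (P z) else K (Q z).
pose SA := unit_square `&` [set z | z.2 <= 2^-1].
pose SB := unit_square `&` [set z | 2^-1 <= z.2].
have csq := closed_unit_square.
have SP z : SA z -> unit_square (P z).
  rewrite /SA /P /unit_square /unit_itv; case: z => s t /= [[Is /andP[? ?]] ?].
  by split => //=; apply/andP; split; lra.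
have SQ z : SB z -> unit_square (Q z).
  rewrite /SB /Q /unit_square /unit_itv; case: z => s t /= [[Is /andP[? ?]] ?].
  by split => //=; apply/andP; split; lra.
exists L; split.
- apply: (@within_paste _ _ SA SB _ (H \o P) (K \o Q)).
  + apply: closedI => //; apply: closed_le_fun; first exact: cont_snd.
    by move=> ?; exact: cvg_cst.
  + apply: closedI => //; apply: closed_le_fun; last exact: cont_snd.
    by move=> ?; exact: cvg_cst.
  + rewrite /SA /SB -setIUr; apply/seteqP; split => z; last by case.
    move=> Sz; split => //=; case: (lerP z.2 2^-1) => h1; first by left.
    by right; apply: ltW.
  + apply: within_comp cH SP; apply: continuous_subspaceT.
    by apply: (cont_pair cont_fst); apply: cont_affine cont_snd.
  + apply: within_comp cK SQ; apply: continuous_subspaceT.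
    by apply: (cont_pair cont_fst); apply: cont_affine cont_snd.
  + by move=> z [_ /= h1]; rewrite /L h1.
  + move=> -[s t] [[/= Is It] h1]; rewrite /L /=; case: ifP => // h2.
    have -> : t = 2^-1 by apply/eqP; rewrite eq_le h1 h2.
    rewrite /P /Q /= divff ?pnatr_eq0 // addr0 subrr.
    by case: (Kx s Is) => -> _; case: (Hx s Is) => _ ->.
- move=> z Sz; rewrite /L; case: ifP => h1; first by apply: AH; apply: SP.
  by apply: AK; apply: SQ; split => //=; rewrite ltW // ltNge h1.
- move=> t It; rewrite /L /= /concat_fun /P /Q /=; case: ifP => h1.
    suff /H01 [-> ->] : unit_itv (2 * t + 0) by [].
    by have [] := SP (0, t) (conj (conj unit_itv0 It) h1).
  suff /K01 [-> ->] : unit_itv (2 * t + -1) by [].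
  have h2 : 2^-1 <= t by rewrite ltW // ltNge h1.
  by have [] := SQ (0, t) (conj (conj unit_itv0 It) h2).
- move=> s Is; rewrite /L /= /P /Q /= invr_ge0 ler0n mulr0 addr0 mulr1.
  have -> : (1 <= 2^-1 :> R) = false by apply/negbTE; rewrite -ltNge; lra.
  have -> : 2 + -1 = 1 :> R by lra.
  by split; [case: (Hx s Is) | case: (Kx s Is)].
Qed.

End Homotopy.

(* The proof Ax that the base point lies in A only serves to give the trivial
   class, hence the group structure. *)
Definition pi1 (A : set X) (x : X) (Ax : A x) : Type :=
  {eq_quot (homotopy_equiv A x)}.

HB.instance Definition _ (A : set X) (x : X) (Ax : A x) := Choice.on (pi1 Ax).
HB.instance Definition _ (A : set X) (x : X) (Ax : A x) := EqQuotient.on (pi1 Ax).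

Section Pi1Group.
Variables (A : set X) (x : X) (Ax : A x).
Local Notation G := (pi1 Ax).

Lemma pi1_eqP (f g : loop A x) :
  reflect (homotopic f g) (\pi_G f == \pi_G g).
Proof. by rewrite eqmodE; apply: asboolP. Qed.

Lemma pi1_eq (f g : loop A x) : homotopic f g -> \pi_G f = \pi_G g.
Proof. by move=> h; apply/eqP/pi1_eqP. Qed.

Lemma pi1_repr (f : loop A x) : homotopic (repr (\pi_G f)) f.
Proof. by apply/pi1_eqP; rewrite reprK. Qed.

Lemma pi1_surj (a : G) : exists f : loop A x, a = \pi_G f.
Proof. by exists (repr a); rewrite reprK. Qed.

Definition pi1_one : G := \pi_G (cst_loop Ax).
Definition pi1_mul (a b : G) : G := \pi_G (concat (repr a) (repr b)).
Definition pi1_inv (a : G) : G := \pi_G (loop_rev (repr a)).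

Lemma pi1_mulE (f g : loop A x) : pi1_mul (\pi_G f) (\pi_G g) = \pi_G (concat f g).
Proof. by apply: pi1_eq; apply: concat_homotopic; exact: pi1_repr. Qed.

Lemma pi1_mulA : associative pi1_mul.
Proof.
move=> a b c; have [f ->] := pi1_surj a; have [g ->] := pi1_surj b.
have [h ->] := pi1_surj c; rewrite !pi1_mulE.
by apply: pi1_eq; exact: concat_assoc.
Qed.

Lemma pi1_mul1 : left_id pi1_one pi1_mul.
Proof. by move=> a; have [f ->] := pi1_surj a; rewrite pi1_mulE; apply: pi1_eq; exact: concat_cstl. Qed.

Lemma pi1_mulr1 : right_id pi1_one pi1_mul.
Proof. by move=> a; have [f ->] := pi1_surj a; rewrite pi1_mulE; apply: pi1_eq; exact: concat_cstr. Qed.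

Lemma pi1_mulV : left_inverse pi1_one pi1_inv pi1_mul.
Proof.
move=> a; rewrite -[X in pi1_mul _ X = _]reprK pi1_mulE.
by apply: pi1_eq; exact: concat_revl.
Qed.

Lemma pi1_mulrV : right_inverse pi1_one pi1_inv pi1_mul.
Proof.
move=> a; rewrite -[X in pi1_mul X _ = _]reprK pi1_mulE.
by apply: pi1_eq; exact: concat_revr.
Qed.

HB.instance Definition _ :=
  isGroup.Build G pi1_mulA pi1_mul1 pi1_mulr1 pi1_mulV pi1_mulrV.

End Pi1Group.

Section Inclusion.
Variables (A B : set X) (x : X) (Ax : A x) (Bx : B x) (AB : A `<=` B).

Definition loop_incl (f : loop A x) : loop B x :=
  Loop (loop_cont f) (fun t It => AB (loop_sub f t It)) (loop0 f) (loop1 f).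

Definition pi1_incl (a : pi1 Ax) : pi1 Bx := \pi_(pi1 Bx) (loop_incl (repr a)).

Lemma loop_incl_homotopic (f g : loop A x) :
  homotopic f g -> homotopic (loop_incl f) (loop_incl g).
Proof. by case=> H [cH AH H01 Hx]; exists H; split => // z /AH /AB. Qed.

Lemma pi1_inclE (f : loop A x) :
  pi1_incl (\pi_(pi1 Ax) f) = \pi_(pi1 Bx) (loop_incl f).
Proof. by apply: pi1_eq; apply: loop_incl_homotopic; exact: pi1_repr. Qed.

Lemma pi1_inclM : {morph pi1_incl : a b / (a * b)%g}.
Proof.
move=> a b; have [f ->] := pi1_surj a; have [g ->] := pi1_surj b.
rewrite [X in pi1_incl X](pi1_mulE Ax) !pi1_inclE [RHS](pi1_mulE Bx).
apply: pi1_eq.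
have -> : loop_incl (concat f g) = concat (loop_incl f) (loop_incl g); last first.
  exact: homotopic_refl.
by rewrite /loop_incl /concat; congr Loop; exact: Prop_irrelevance.
Qed.

End Inclusion.

End FundamentalGroup.

Definition expgz (G : groupType) (g : G) (n : int) : G :=
  match n with Posz k => (g ^+ k)%g | Negz k => (g ^- k.+1)%g end.

Definition is_Z2_basis (G : groupType) (a b : G) : Prop :=
  forall g : G, exists! n : int * int, g = (expgz a n.1 * expgz b n.2)%g.

Section Manifolds.
Variable R : realType.

(* The library norm on row vectors is the sup norm, so the round sphere and
   ball are given by the sum of squares. *)
Definition unit_sphere (n : nat) : set 'rV[R]_n :=
  [set v | \sum_(i < n) v 0 i ^+ 2 = 1].
Definition unit_ball (n : nat) : set 'rV[R]_n :=
  [set v | \sum_(i < n) v 0 i ^+ 2 <= 1].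

Definition half_space (n : nat) : set 'rV[R]_n :=
  [set v | forall i : 'I_n, i = 0%N :> nat -> 0 <= v 0 i].
Definition half_space_bd (n : nat) : set 'rV[R]_n :=
  [set v | exists2 i : 'I_n, i = 0%N :> nat & v 0 i = 0].

Arguments unit_sphere n : clear implicits.
Arguments unit_ball n : clear implicits.
Arguments half_space n : clear implicits.

Definition homeo (Y Z : topologicalType) (A : set Y) (B : set Z)
    (f : Y -> Z) (g : Z -> Y) : Prop :=
  [/\ {within A, continuous f}, {within B, continuous g},
      forall y, A y -> B (f y) /\ g (f y) = y &
      forall z, B z -> A (g z) /\ f (g z) = z].

Definition homeomorphic (Y Z : topologicalType) (A : set Y) (B : set Z) : Prop :=
  exists f g, homeo A B f g.

(* Used for compact A and Hausdorff Z only, where a continuous injection is a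
   homeomorphism onto its image. *)
Definition compact_embedding (Y Z : topologicalType) (A : set Y) (f : Y -> Z) :
  Prop := {within A, continuous f} /\ set_inj A f.

Section Ambient.
Variable X : topologicalType.

Definition chart (n : nat) (S U : set X) (f : X -> 'rV[R]_n) : Prop :=
  open U /\ exists (V : set 'rV[R]_n) (g : 'rV[R]_n -> X),
    open V /\ homeo (S `&` U) (half_space n `&` V) f g.

(* S is a manifold with boundary in the subspace topology, up to the separation
   and countability axioms, which it inherits from X. *)
Definition locally_half_euclidean (n : nat) (S : set X) : Prop :=
  forall x, S x -> exists U f, U x /\ @chart n S U f.

Definition mfd_boundary (n : nat) (S : set X) : set X :=
  [set x | S x /\ exists U f, [/\ U x, @chart n S U f & half_space_bd (f x)]].

Definition is_manifold (n : nat) : Prop :=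
  [/\ hausdorff_space X, @second_countable X & locally_half_euclidean n setT].

Record interior_chart (n : nat) := InteriorChart {
  ic_dom : set X;
  ic_cod : set 'rV[R]_n;
  ic_map : X -> 'rV[R]_n;
  ic_inv : 'rV[R]_n -> X;
  ic_dom_open : open ic_dom;
  ic_cod_open : open ic_cod;
  ic_homeo : homeo ic_dom ic_cod ic_map ic_inv }.

(* h, an embedding of the open set W in R^n, has local degree +1 at y: the map
   v |-> h (y + eps v) - h y from the unit sphere to R^n \ {0} is homotopic to
   the inclusion. *)
Definition local_degree_one (n : nat) (W : set 'rV[R]_n)
    (h : 'rV[R]_n -> 'rV[R]_n) (y : 'rV[R]_n) : Prop :=
  exists eps : R, [/\ 0 < eps,
    forall v, unit_ball n v -> W (y + eps *: v) &
    exists H : R * 'rV[R]_n -> 'rV[R]_n,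
      [/\ {within @unit_itv R `*` unit_sphere n, continuous H},
          forall z, (@unit_itv R `*` unit_sphere n) z -> H z != 0 &
          forall v, unit_sphere n v ->
            H (0, v) = h (y + eps *: v) - h y /\ H (1, v) = v]].

(* An atlas of the interior with orientation preserving transition maps. *)
Definition orientable (n : nat) : Prop :=
  exists Phi : set (interior_chart n),
    (forall x, ~ mfd_boundary n setT x -> exists2 c, Phi c & ic_dom c x) /\
    (forall c d x, Phi c -> Phi d -> ic_dom c x -> ic_dom d x ->
      local_degree_one (ic_map c @` (ic_dom c `&` ic_dom d))
        (ic_map d \o ic_inv c) (ic_map c x)).

Definition interval_pm1 : set R := [set t | -1 <= t <= 1].

(* Spheres are taken bicollared in the interior, which rules out wild ones. *)
Definition irreducible_3manifold : Prop :=
  forall h : 'rV[R]_3 * R -> X,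
    compact_embedding (unit_sphere 3 `*` interval_pm1) h ->
    (forall z, (unit_sphere 3 `*` interval_pm1) z -> ~ mfd_boundary 3 setT (h z)) ->
    exists b : 'rV[R]_3 -> X, compact_embedding (unit_ball 3) b /\
      b @` unit_sphere 3 = (fun v => h (v, 0)) @` unit_sphere 3.

Local Notation bdX := (mfd_boundary 3 [set: X]).

Definition properly_embedded_surface (S : set X) : Prop :=
  [/\ closed S, locally_half_euclidean 2 S & mfd_boundary 2 S = S `&` bdX].

Definition bicollared (S : set X) : Prop :=
  exists h : X * R -> X,
    [/\ compact_embedding (S `*` interval_pm1) h,
        forall x, S x -> h (x, 0) = x,
        open (h @` (S `*` [set t | -1 < t < 1])) &
        forall x t, S x -> interval_pm1 t -> (bdX (h (x, t)) <-> bdX x)].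

Definition pi1_injective (F : set X) : Prop :=
  forall x (Fx : F x), injective (@pi1_incl R X F setT x Fx I (@subsetT _ F)).

(* F cuts off a product F x [0,1], with F x {0} = F, whose frontier is F. *)
Definition boundary_parallel (F : set X) : Prop :=
  exists h : X * R -> X,
    [/\ compact_embedding (F `*` @unit_itv R) h,
        forall x, F x -> h (x, 0) = x,
        forall x, F x -> bdX (h (x, 1)) &
        forall x t, mfd_boundary 2 F x -> unit_itv t -> bdX (h (x, t))].

Definition essential_surface (S : set X) : Prop :=
  [/\ S !=set0, properly_embedded_surface S, bicollared S &
      forall x, S x -> let F := connected_component S x in
        [/\ pi1_injective F, ~ homeomorphic F (unit_sphere 3) &
            ~ boundary_parallel F]].

Definition simple_closed_curve (gamma : R -> X) (C : set X) : Prop :=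
  [/\ {within @unit_itv R, continuous gamma}, gamma 0 = gamma 1,
      set_inj [set t | 0 <= t < 1] gamma & gamma @` @unit_itv R = C].

Definition freely_homotopic (A : set X) (gamma delta : R -> X) : Prop :=
  exists H : R * R -> X,
    [/\ {within @unit_square R, continuous H},
        forall z, unit_square z -> A (H z),
        forall t, unit_itv t -> H (0, t) = gamma t /\ H (1, t) = delta t &
        forall s, unit_itv s -> H (s, 0) = H (s, 1)].

(* Some component of the boundary of S has slope mu^r la^s; the orientation of
   the parametrisation is free, which accounts for inversion. *)
Definition boundary_slope (x : X) (Tx : bdX x) (mu la : pi1 R Tx)
    (S : set X) (r s : int) : Prop :=
  coprimez r s /\
  exists (y : X) (gamma : R -> X) (delta : loop R bdX x),
    [/\ mfd_boundary 2 S y,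
        simple_closed_curve gamma (connected_component (mfd_boundary 2 S) y),
        \pi_(pi1 R Tx) delta = (expgz mu r * expgz la s)%g &
        freely_homotopic bdX gamma delta].

End Ambient.
End Manifolds.

Arguments unit_sphere R n : clear implicits.
Arguments mfd_boundary R {X} n S.
Arguments is_manifold R X n : clear implicits.
Arguments orientable R X n : clear implicits.
Arguments irreducible_3manifold R X : clear implicits.
Arguments essential_surface R {X} S.

Section APolynomial.
Variable F : closedFieldType.

(* {poly {poly F}} stands for F[m,l] with m the outer variable: f`_i`_j is the
   coefficient of m^i l^j and f.[m, l] the value of f. *)

Definition torus2 : set (F * F) := [set z | z.1 != 0 /\ z.2 != 0].

(* Zariski closure in the torus of nonzero pairs; clearing denominators,
   polynomials cut out the same sets as Laurent polynomials. *)
Definition zariski_closure (E : set (F * F)) : set (F * F) :=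
  [set z | torus2 z /\ forall f : {poly {poly F}},
     (forall w, E w -> f.[w.1, w.2] = 0) -> f.[z.1, z.2] = 0].

Definition zariski_closed (Z : set (F * F)) : Prop := zariski_closure Z = Z.

Definition zariski_irreducible (Z : set (F * F)) : Prop :=
  [/\ zariski_closed Z, Z !=set0 & forall Z1 Z2, zariski_closed Z1 ->
      zariski_closed Z2 -> Z `<=` Z1 `|` Z2 -> Z `<=` Z1 \/ Z `<=` Z2].

Definition irreducible_component (Z C : set (F * F)) : Prop :=
  [/\ zariski_irreducible C, C `<=` Z &
      forall D, zariski_irreducible D -> C `<=` D -> D `<=` Z -> D = C].

Definition irreducible_chain (Z : set (F * F)) (n : nat) : Prop :=
  exists c : nat -> set (F * F),
    (forall i, (i <= n)%N -> zariski_irreducible (c i) /\ c i `<=` Z) /\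
    (forall i, (i < n)%N -> c i `<` c i.+1).

Definition krull_dim (Z : set (F * F)) (n : nat) : Prop :=
  irreducible_chain Z n /\ ~ irreducible_chain Z n.+1.

Definition upper_triangular (A : 'M[F]_2) : Prop := A 1 0 = 0.

Definition sl2_rep (G : groupType) (rho : G -> 'M[F]_2) : Prop :=
  (forall g, \det (rho g) = 1) /\
  (forall g h, rho (g * h)%g = rho g *m rho h).

Definition R_U (G : groupType) (mu la : G) : set (G -> 'M[F]_2) :=
  [set rho | [/\ sl2_rep rho, upper_triangular (rho mu) & upper_triangular (rho la)]].

Definition eigenvalue_map (G : groupType) (mu la : G) (rho : G -> 'M[F]_2) :
  F * F := (rho mu 0 0, rho la 0 0).

Definition eigenvalue_variety (G : groupType) (mu la : G) : set (F * F) :=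
  zariski_closure (eigenvalue_map mu la @` R_U mu la).

Definition one_dim_part (Z : set (F * F)) : set (F * F) :=
  \bigcup_(C in [set C | irreducible_component Z C /\ krull_dim C 1]) C.

(* f lies in the ideal of the Laurent polynomial ring generated by g. *)
Definition laurent_ideal (g : {poly {poly F}}) : set {poly {poly F}} :=
  [set f | exists (i j : nat) (q : {poly {poly F}}),
     'X^i * ('X^j)%:P * f = q * g].

(* g generates an ideal defining V1, and A generates its radical. *)
Definition is_A_polynomial (G : groupType) (mu la : G) (A : {poly {poly F}}) :
    Prop :=
  exists g : {poly {poly F}},
    one_dim_part (eigenvalue_variety mu la) =
      [set z | torus2 z /\ g.[z.1, z.2] = 0] /\
    forall f : {poly {poly F}},
      laurent_ideal A f <-> exists n : nat, laurent_ideal g (f ^+ n).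

End APolynomial.

Section NewtonPolygon.
Variable R : realType.
Local Notation R2 := (R^o * R^o)%type.

Definition convex_hull (E : set R2) : set R2 :=
  \bigcap_(C in [set C : set R2 | convex_set C /\ E `<=` C]) C.

Definition newton_polygon (F : fieldType) (f : {poly {poly F}}) : set R2 :=
  convex_hull [set z | exists i j : nat,
    f`_i`_j != 0 /\ z = (i%:R : R^o, j%:R : R^o)].

Definition segment (a b : R2) : set R2 :=
  [set z | exists2 t : R, 0 <= t <= 1 & z = a + t *: (b - a)].

(* The nondegenerate segment [a, b] is the face of P where the linear form u is
   maximal; a polygon that is itself a segment is its own edge. *)
Definition is_edge (P : set R2) (a b : R2) : Prop :=
  a != b /\ exists u : R2,
    segment a b = [set z | P z /\ forall w, P w ->
      u.1 * w.1 + u.2 * w.2 <= u.1 * z.1 + u.2 * z.2].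

Definition strongly_detected (F : fieldType) (A : {poly {poly F}}) (r s : int) :
    Prop :=
  exists a b : R2, is_edge (newton_polygon A) a b /\
    exists c : R, b - a = c *: (r%:~R : R^o, s%:~R : R^o).

End NewtonPolygon.

(* Main.v *)
Require Import Defs.
From HB Require Import structures.
From mathcomp Require Import all_boot all_order all_algebra all_field monoid.
From mathcomp Require Import generic_quotient finmap polyXY.
From mathcomp Require Import all_classical all_reals all_analysis.
From mathcomp Require Import zify ring lra.

(* Both A-polynomials are compared with one curve that is defined in the same
   way over all algebraically closed fields. Since the fundamental group of M is
   finitely generated, R_U is cut out by finitely many polynomial equations over
   Z (Hilbert's basis theorem), so its image under the eigenvalue map is
   first-order definable, and elimination of quantifiers makes the truth of a
   first-order sentence in an algebraically closed field depend only on which of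
   finitely many integers vanish in it. Over the algebraic numbers the image
   either contains a nonempty Zariski open subset of the torus, or agrees up to
   finitely many points with the zero locus of a squarefree polynomial A. Either
   alternative, with the exponents of A, is a first-order sentence; hence it
   holds in characteristic 0 and in all but finitely many positive
   characteristics. In the first case V_1 is empty; in the second it is the
   zero locus of A, and the A-polynomial is A up to a monomial and a constant.
   So for these p the Newton polygons of A_0 and A_p are translates of each
   other, and a slope is detected by both or by neither. *)

Set Implicit Arguments.
Unset Strict Implicit.
Unset Printing Implicit Defensive.

Import Order.TTheory GRing.Theory Num.Theory.
Import numFieldNormedType.Exports.

Local Open Scope classical_set_scope.
Local Open Scope ring_scope.

(** * Uniform quantifier elimination *)

(** The A-polynomial is defined through irreducible components, dimension and a radical, none of
    which is visibly first-order. Hence the transferred sentences speak of points and coefficients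
    only: the image of the eigenvalue map is a zero locus outside [k] points, with [k] fixed, and
    squarefreeness is tested on factorisations whose degrees are bounded by a fixed [d]. The
    geometry is then redone inside each single field: the exceptional points do not affect the
    one-dimensional part, and a polynomial that is squarefree on the torus generates, in the Laurent
    ring, the ideal of its zeros. The exponents are recorded rather than the Newton polygon, because
    the vanishing of a coefficient is first-order and the exponents determine the polygon.

    One formula with integer constants has to serve all fields at once. Therefore the elimination
    never divides by a coefficient, and the passage from infinitely many equations to finitely many
    takes place over the integers. No presentation of the group enters: every coincidence between
    two words contributes equations, and the basis theorem makes them finite in number. *)

Section Terms.
Variable I : Type.

Inductive term : Type :=
  | Var of I | Cst of int | Add of term & term | Mul of term & term.

Fixpoint teval (A : comNzRingType) (e : I -> A) (t : term) : A :=
  match t with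
  | Var i => e i
  | Cst n => n%:~R
  | Add s t => teval e s + teval e t
  | Mul s t => teval e s * teval e t
  end.

Lemma teval_rmorph (A B : comNzRingType) (phi : {rmorphism A -> B}) (e : I -> A) t :
  phi (teval e t) = teval (phi \o e) t.
Proof.
by elim: t => //= [n|s Hs t Ht|s Hs t Ht]; rewrite ?rmorph_int // ?rmorphD ?rmorphM Hs Ht.
Qed.

Inductive qf : Type := Eq0 of term | And of qf & qf | Not of qf.

Fixpoint qeval (A : comNzRingType) (e : I -> A) (q : qf) : bool :=
  match q with
  | Eq0 t => teval e t == 0
  | And p q => qeval e p && qeval e q
  | Not q => ~~ qeval e q
  end.

(* The formula q is the same for all algebraically closed fields, whatever their
   characteristic. *)
Definition definable (D : forall F : closedFieldType, (I -> F) -> Prop) : Prop :=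
  exists q, forall (F : closedFieldType) (e : I -> F), D F e <-> qeval e q.

Definition polyfun (t : forall F : closedFieldType, (I -> F) -> F) : Prop :=
  exists tm, forall (F : closedFieldType) (e : I -> F), t F e = teval e tm.

Lemma def_ext (D D' : forall F : closedFieldType, (I -> F) -> Prop) :
  definable D -> (forall F e, D' F e <-> D F e) -> definable D'.
Proof. by case=> q Hq DD'; exists q => F e; rewrite DD'. Qed.

Lemma def_eq0 t : polyfun t -> definable (fun F e => t F e = 0).
Proof. by case=> tm H; exists (Eq0 tm) => F e; rewrite H /=; split=> /eqP. Qed.

Lemma def_and (D D' : forall F : closedFieldType, (I -> F) -> Prop) :
  definable D -> definable D' -> definable (fun F e => D F e /\ D' F e).
Proof.
case=> q Hq [q' Hq']; exists (And q q') => F e /=.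
by rewrite Hq Hq'; split => /andP.
Qed.

Lemma def_not (D : forall F : closedFieldType, (I -> F) -> Prop) :
  definable D -> definable (fun F e => ~ D F e).
Proof. by case=> q Hq; exists (Not q) => F e /=; rewrite Hq; split=> /negP. Qed.

Lemma def_or (D D' : forall F : closedFieldType, (I -> F) -> Prop) :
  definable D -> definable D' -> definable (fun F e => D F e \/ D' F e).
Proof.
move=> d d'; apply: def_ext (def_not (def_and (def_not d) (def_not d'))) _.
by move=> F e; split=> [[h|h] []//|/not_andP[]/contrapT]; [left|right].
Qed.

Lemma def_imp (D D' : forall F : closedFieldType, (I -> F) -> Prop) :
  definable D -> definable D' -> definable (fun F e => D F e -> D' F e).
Proof.
move=> d d'; apply: def_ext (def_or (def_not d) d') _ => F e; split.
  by move=> h; case: (pselect (D F e)) => [/h|]; [right|left].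
by case.
Qed.

Lemma def_iff (D D' : forall F : closedFieldType, (I -> F) -> Prop) :
  definable D -> definable D' -> definable (fun F e => D F e <-> D' F e).
Proof. by move=> d d'; exact: def_and (def_imp d d') (def_imp d' d). Qed.

(** [b] is the same proposition for all fields, so one formula can be chosen by excluded middle once
    and for all. *)
Lemma def_const (b : Prop) : definable (fun _ _ => b).
Proof.
exists (if `[< b >] then Eq0 (Cst 0) else Not (Eq0 (Cst 0))) => F e.
by case: asboolP => h /=; rewrite eqxx.
Qed.

Lemma def_all (J : finType) (D : J -> forall F : closedFieldType, (I -> F) -> Prop) :
  (forall j, definable (D j)) -> definable (fun F e => forall j, D j F e).
Proof.
move=> dD; suff: forall s : seq J,
  definable (fun F e => forall j, j \in s -> D j F e).
  move/(_ (enum J)) => d; apply: def_ext d _ => F e.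
  by split=> [h j _|h j]; apply: h; rewrite ?mem_enum.
elim=> [|i s IH]; first by apply: def_ext (def_const True) _.
apply: def_ext (def_and (dD i) IH) _ => F e; split=> [h|[h1 h2] j].
  by split=> [|j js]; apply: h; rewrite inE ?eqxx // js orbT.
by rewrite inE => /predU1P[->|/h2].
Qed.

Lemma def_exfin (J : finType) (D : J -> forall F : closedFieldType, (I -> F) -> Prop) :
  (forall j, definable (D j)) -> definable (fun F e => exists j, D j F e).
Proof.
move=> dD; apply: def_ext (def_not (def_all (fun j => def_not (dD j)))) _ => F e.
by split=> [[j Dj] /(_ j)//|/existsNP[j /contrapT Dj]]; exists j.
Qed.

Lemma pf_var i : polyfun (fun F e => e i).
Proof. by exists (Var i). Qed.
Lemma pf_int n : polyfun (fun F e => n%:~R).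
Proof. by exists (Cst n). Qed.
Lemma pf_add s t : polyfun s -> polyfun t -> polyfun (fun F e => s F e + t F e).
Proof. by case=> a ha [b hb]; exists (Add a b) => F e /=; rewrite ha hb. Qed.
Lemma pf_mul s t : polyfun s -> polyfun t -> polyfun (fun F e => s F e * t F e).
Proof. by case=> a ha [b hb]; exists (Mul a b) => F e /=; rewrite ha hb. Qed.
Lemma pf_opp s : polyfun s -> polyfun (fun F e => - s F e).
Proof. by case=> a ha; exists (Mul (Cst (-1)) a) => F e /=; rewrite ha rmorphN mulN1r. Qed.
Lemma pf_exp s n : polyfun s -> polyfun (fun F e => s F e ^+ n).
Proof.
move=> ps; elim: n => [|n]; first exact: (pf_int 1).
by move/(pf_mul ps) => [tm H]; exists tm => F e; rewrite exprS H.
Qed.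
Lemma pf_sum (J : finType) (t : J -> forall F : closedFieldType, (I -> F) -> F) :
  (forall j, polyfun (t j)) -> polyfun (fun F e => \sum_j t j F e).
Proof.
move=> pt; suff: forall s : seq J, polyfun (fun F e => \sum_(j <- s) t j F e).
  exact.
elim=> [|i s IH].
  by have [tm H] := pf_int 0; exists tm => F e; rewrite big_nil -H.
by have [tm H] := pf_add (pt i) IH; exists tm => F e; rewrite big_cons H.
Qed.

Lemma def_eq s t : polyfun s -> polyfun t -> definable (fun F e => s F e = t F e).
Proof.
move=> ps pt; apply: def_ext (def_eq0 (pf_add ps (pf_opp pt))) _ => F e.
by split=> [->|/eqP]; rewrite ?subrr // subr_eq0 => /eqP.
Qed.

End Terms.
Arguments Cst {I}.

Section Reindex.
Variables I K : Type.
Variable h : I -> K.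

Fixpoint tmap (t : term I) : term K :=
  match t with
  | Var i => Var (h i) | Cst n => Cst n
  | Add s t => Add (tmap s) (tmap t) | Mul s t => Mul (tmap s) (tmap t)
  end.
Lemma tmapE (A : comNzRingType) (e : K -> A) t : teval e (tmap t) = teval (e \o h) t.
Proof. by elim: t => //= [s -> t ->|s -> t ->]. Qed.

Fixpoint qmap (q : qf I) : qf K :=
  match q with
  | Eq0 t => Eq0 (tmap t) | And p q => And (qmap p) (qmap q) | Not q => Not (qmap q)
  end.
Lemma qmapE (A : comNzRingType) (e : K -> A) q : qeval e (qmap q) = qeval (e \o h) q.
Proof. by elim: q => //= [t|p -> q ->|q ->]; rewrite ?tmapE. Qed.

Lemma def_reindex (D : forall F : closedFieldType, (I -> F) -> Prop) :
  definable D -> definable (fun F e => D F (e \o h)).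
Proof. by case=> q H; exists (qmap q) => F e; rewrite H qmapE. Qed.

End Reindex.

Section FormalPolynomials.
Variable I : Type.
Local Notation term := (term I).
Local Notation T0 := (@Cst I 0).

(* A sequence of terms is a polynomial with formal coefficients; its formal
   leading coefficient may vanish once evaluated. *)
Definition fpoly (A : comNzRingType) (e : I -> A) (s : seq term) : {poly A} :=
  Poly (map (teval e) s).

Lemma coef_fpoly (A : comNzRingType) (e : I -> A) s i :
  (fpoly e s)`_i = teval e (nth T0 s i).
Proof.
rewrite coef_Poly; have [h|h] := ltnP i (size s); first by rewrite (nth_map T0).
by rewrite !nth_default // ?size_map.
Qed.

Definition padd (s t : seq term) : seq term :=
  mkseq (fun i => Add (nth T0 s i) (nth T0 t i)) (maxn (size s) (size t)).

Lemma fpoly_add (A : comNzRingType) (e : I -> A) s t :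
  fpoly e (padd s t) = fpoly e s + fpoly e t.
Proof.
apply/polyP => i; rewrite coefD !coef_fpoly.
have [h|] := ltnP i (maxn (size s) (size t)); first by rewrite nth_mkseq.
rewrite geq_max => /andP[h1 h2]; rewrite !nth_default //= ?addr0 //.
by rewrite size_mkseq geq_max h1.
Qed.

Fixpoint pmul (s t : seq term) : seq term :=
  if s is a :: s then padd (map (Mul a) t) (T0 :: pmul s t) else [::].

Lemma fpoly_cons (A : comNzRingType) (e : I -> A) a s :
  fpoly e (a :: s) = (teval e a)%:P + fpoly e s * 'X.
Proof. by rewrite /fpoly /= cons_poly_def addrC. Qed.

Lemma fpoly_mul (A : comNzRingType) (e : I -> A) s t :
  fpoly e (pmul s t) = fpoly e s * fpoly e t.
Proof.
elim: s => [|a s IH] /=; first by rewrite /fpoly /= mul0r.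
rewrite fpoly_add !fpoly_cons IH /= polyC0 add0r mulrDl mulrAC; congr (_ + _).
apply/polyP => i; rewrite coefCM !coef_fpoly.
have [h|h] := ltnP i (size t); first by rewrite (nth_map T0).
by rewrite !nth_default ?size_map //= mulr0.
Qed.

Definition ppow (s : seq term) n := iter n (pmul s) [:: Cst 1].
Lemma fpoly_pow (A : comNzRingType) (e : I -> A) s n :
  fpoly e (ppow s n) = fpoly e s ^+ n.
Proof.
elim: n => [|n IH] /=.
  by rewrite /ppow /= fpoly_cons /fpoly /= mul0r addr0.
by rewrite /ppow /= fpoly_mul -/(ppow s n) IH exprS.
Qed.

Definition formal_lead (s : seq term) := nth T0 s (size s).-1.

Lemma fpoly_take (A : comNzRingType) (e : I -> A) s :
  fpoly e s = (teval e (formal_lead s))%:P * 'X^((size s).-1) + fpoly e (take (size s).-1 s).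
Proof.
have st : size (take (size s).-1 s) = (size s).-1 by rewrite size_takel ?leq_pred.
apply/polyP => i; rewrite coefD coefCM coefXn !coef_fpoly.
have [h|h|->] := ltngtP i (size s).-1.
- by rewrite nth_take //= mulr0 add0r.
- by rewrite mulr0 add0r !nth_default // ?st; lia.
- by rewrite mulr1 [nth _ (take _ _) _]nth_default ?addr0 // st.
Qed.

(** One step of pseudo-division. The top coefficients cancel formally, so the result is shorter than
    [g] whatever the values of the coefficients are, and nothing is inverted. *)
Definition cancel_lead (f g : seq term) : seq term :=
  let k := (size g - size f)%N in
  mkseq (fun i => Add (Mul (formal_lead f) (nth T0 g i))
     (Mul (Cst (-1)) (Mul (formal_lead g) (if (i < k)%N then T0 else nth T0 f (i - k)))))
    (size g).-1.

Lemma fpoly_cancel_lead (A : comNzRingType) (e : I -> A) f g :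
  (0 < size f <= size g)%N ->
  fpoly e (cancel_lead f g) = (teval e (formal_lead f))%:P * fpoly e g
    - (teval e (formal_lead g))%:P * fpoly e f * 'X^(size g - size f).
Proof.
move=> /andP[f0 fg]; apply/polyP => i.
rewrite coefB coefMXn !coefCM !coef_fpoly.
have [h|h] := ltnP i (size g).-1.
  rewrite nth_mkseq //=; case: ifP => h' /=; rewrite ?mulrN1z ?mulN1r ?mulr0 //.
rewrite [nth _ (cancel_lead _ _) _]nth_default ?size_mkseq //=.
rewrite ifF; last by apply/negbTE; lia.
have [->|ne] := eqVneq i (size g).-1.
  have -> : ((size g).-1 - (size g - size f) = (size f).-1)%N by lia.
  by rewrite -!/(formal_lead _) mulrC subrr.
by rewrite !nth_default /=; try lia; rewrite !mulr0 subrr.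
Qed.

(** The order of the quantifiers is the point: [r] and [k] are fixed before the ring and the values
    of the variables. The exponent [k] counts the cancellation steps. *)
Lemma pseudo_rem (f g : seq term) : (0 < size f)%N -> exists (r : seq term) (k : nat),
  forall (A : comNzRingType) (e : I -> A),
    (exists q, (teval e (formal_lead f) ^+ k)%:P * fpoly e g = q * fpoly e f + fpoly e r) /\
    (size r < size f)%N.
Proof.
move=> f0; elim: {g}(size g) {-2}g (leqnn (size g)) => [|n IH] g gn.
  exists g, 0%N => A e; split; last by lia.
  by exists 0; rewrite expr0 mul1r mul0r add0r.
have [h|h] := ltnP (size g) (size f).
  exists g, 0%N => A e; split; last by lia.
  by exists 0; rewrite expr0 mul1r mul0r add0r.
have [|r [k H]] := IH (cancel_lead f g); first by rewrite size_mkseq; lia.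
exists r, k.+1 => A e; have [[q E] lt] := H A e; split => //.
move: E; rewrite fpoly_cancel_lead ?f0 // mulrBr => /eqP; rewrite subr_eq => /eqP E.
exists (q + (teval e (formal_lead f) ^+ k)%:P * ((teval e (formal_lead g))%:P * 'X^(size g - size f))).
rewrite exprSr polyCM -mulrA E mulrDl -!addrA; congr (_ + _).
by rewrite addrC; congr (_ + _); rewrite -!mulrA; congr (_ * (_ * _)); rewrite mulrC.
Qed.

End FormalPolynomials.

(** If [g] vanishes at all roots of [f], each of the linear factors of [f], of which there are at
    most [n] with multiplicity, divides its own copy of [g] in [g ^+ n]. This trades a statement
    about a point for a divisibility. *)
Lemma root_avoiding (F : closedFieldType) (f g : {poly F}) n :
  f != 0 -> (size f <= n)%N ->
  (exists y, root f y && ~~ root g y) <-> ~~ (f %| g ^+ n).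
Proof.
move=> f0 sf; split=> [[y /andP[fy gy]]|].
  apply: contra gy => dv; have := root_dvdp dv fy.
  by rewrite !rootE horner_exp expf_eq0 => /andP[].
apply: contraNP => H; have [rs E] := closed_field_poly_normal f.
rewrite E dvdpZl ?lead_coef_eq0 //.
have : all (root g) rs.
  apply/allP => y yrs; apply/negP => /negP gy; apply: H; exists y.
  by rewrite gy andbT E rootZ ?lead_coef_eq0 // root_prod_XsubC.
have sz : (size rs <= n)%N.
  apply: leq_trans sf; rewrite E size_scale ?lead_coef_eq0 // size_prod_XsubC.
  by [].
elim: rs n sz {E sf} => [|y rs IH] n sz; first by rewrite big_nil dvd1p.
case: n sz => // n sz /= /andP[gy gs]; rewrite big_cons exprS dvdp_mul //.
  by rewrite dvdp_XsubCl.
exact: IH.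
Qed.

Lemma nonroot_closed (F : closedFieldType) (g : {poly F}) :
  (exists y, ~~ root g y) <-> g != 0.
Proof.
split=> [[y]|]; first by apply: contraNneq => ->; rewrite root0.
by move/closed_nonrootP.
Qed.

(** * Elimination of one existential quantifier *)

Section Elimination.
Variable I : Type.
Local Notation term := (term I).

Lemma def_fpoly0 (s : seq term) : definable (fun F e => fpoly e s = 0).
Proof.
have d : definable (fun F e => forall i : 'I_(size s), teval e (nth (Cst 0) s i) = 0 :> F).
  by apply: def_all => i; apply: def_eq0; exists (nth (Cst 0) s i).
apply: def_ext d _ => F e; split=> [h i|h].
  by rewrite -coef_fpoly h coef0.
apply/polyP => i; rewrite coef0 coef_fpoly.
have [lt|ge] := ltnP i (size s); first exact: (h (Ordinal lt)).
by rewrite nth_default.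
Qed.

Definition common_root (fs : seq (seq term)) (g : seq term)
    (F : closedFieldType) (e : I -> F) : Prop :=
  exists y : F, all (fun f => root (fpoly e f) y) fs && ~~ root (fpoly e g) y.

(** Euclid's algorithm with a case distinction on each formal leading coefficient: if it vanishes,
    it is dropped; otherwise it serves to shorten the longer of two polynomials without changing the
    common roots. The measure adds the number of polynomials to their lengths, so that discarding an
    empty one also counts as progress. *)
Lemma def_common_root fs g : definable (@common_root fs g).
Proof.
have rnil (F : closedFieldType) (e : I -> F) y : root (fpoly e [::]) y = true.
  by rewrite /fpoly /= root0.
have [n] := ubnP (sumn (map size fs) + size fs)%N.
elim: n fs => [//|n IH] [|f1 fs] /= lt.
- apply: def_ext (def_not (def_fpoly0 g)) _ => F e; rewrite /common_root /=.
  by rewrite nonroot_closed; split=> /eqP.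
have [/size0nil f10|f1p] := posnP (size f1).
  apply: def_ext (IH fs _) _; first by move: lt; rewrite f10 /=; lia.
  by move=> F e; rewrite f10; split=> -[y]; rewrite /= ?rnil => h; exists y; rewrite /= ?rnil.
have d1 : definable (fun F e => teval e (formal_lead f1) = 0 :> F).
  by apply: def_eq0; exists (formal_lead f1).
case: fs lt => [|f2 fs] /= lt.
  (* With a single [f1] of nonzero leading coefficient, a root of [f1] avoiding [g] exists exactly
     if [f1] does not divide this power of [g], that is, if the pseudo-remainder is nonzero. *)
  have [r [k H]] := pseudo_rem (ppow g (size f1)) f1p.
  apply: def_ext (def_or (def_and d1 (IH [:: take (size f1).-1 f1] _))
                         (def_and (def_not d1) (def_not (def_fpoly0 r)))) _.
    by rewrite /= size_takel ?leq_pred //; lia.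
  move=> F e; rewrite /common_root /=.
  case: (eqVneq (teval e (formal_lead f1)) 0) => [c0|c0].
    have -> : fpoly e f1 = fpoly e (take (size f1).-1 f1).
      by rewrite fpoly_take c0 polyC0 mul0r add0r.
    split; first by left.
    by case=> [[]|[]//].
  have szf : size (fpoly e f1) = size f1.
    apply/eqP; rewrite eqn_leq; apply/andP; split.
      by rewrite /fpoly (leq_trans (size_Poly _)) // size_map.
    have := leq_sizeP (fpoly e f1) (size f1).-1; case: leqP => [h /(_ isT)|]; last lia.
    by move/(_ _ (leqnn _))/eqP; rewrite coef_fpoly -/(formal_lead f1) (negbTE c0).
  have f0 : fpoly e f1 != 0 by rewrite -size_poly_gt0 szf.
  have [[q E] sr] := H F e.
  have := root_avoiding (fpoly e g) (n := size f1) f0; rewrite szf => /(_ (leqnn _)).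
  have -> : (fpoly e f1 %| fpoly e g ^+ size f1) = (fpoly e r == 0).
    rewrite -fpoly_pow -(@dvdpZr _ (teval e (formal_lead f1) ^+ k)) ?expf_neq0 //.
    rewrite -mul_polyC E dvdp_addr ?dvdp_mull //.
    apply/idP/idP => [|/eqP->]; last by rewrite dvdp0.
    apply: contraTT => r0; rewrite gtNdvdp // szf.
    by apply: leq_ltn_trans sr; rewrite /fpoly (leq_trans (size_Poly _)) // size_map.
  move=> Hr; split=> [[y]|[[/eqP]|[_ r0]]].
  - rewrite andbT => /(ex_intro _ y)/Hr r0; right; split; first exact/eqP.
    exact/eqP.
  - by rewrite (negbTE c0).
  - by move/eqP: r0 => /Hr [y]; exists y; rewrite andbT.
have [/size0nil f20|f2p] := posnP (size f2).
  apply: def_ext (IH (f1 :: fs) _) _; first by move: lt; rewrite f20 /=; lia.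
  by move=> F e; rewrite f20; split=> -[y]; rewrite /= ?rnil => h; exists y; rewrite /= ?rnil.
have rootred (F : closedFieldType) (e : I -> F) f g' y :
  (0 < size f <= size g')%N -> teval e (formal_lead f) != 0 -> root (fpoly e f) y ->
  root (fpoly e (cancel_lead f g')) y = root (fpoly e g') y.
  move=> sz c0 fy; rewrite fpoly_cancel_lead // !rootE !(hornerE, hornerM).
  by move: fy; rewrite rootE => /eqP ->; rewrite mulr0 mul0r subr0 mulf_eq0 (negbTE c0).
have drop (F : closedFieldType) (e : I -> F) f : teval e (formal_lead f) = 0 ->
    fpoly e (take (size f).-1 f) = fpoly e f.
  by move=> c0; rewrite [RHS]fpoly_take c0 polyC0 mul0r add0r.
have d2 : definable (fun F e => teval e (formal_lead f2) = 0 :> F).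
  by apply: def_eq0; exists (formal_lead f2).
have [f12|f21] := leqP (size f1) (size f2).
  apply: def_ext (def_or (def_and d1 (IH (take (size f1).-1 f1 :: f2 :: fs) _))
                 (def_and (def_not d1) (IH (f1 :: cancel_lead f1 f2 :: fs) _))) _.
  - by rewrite /= size_takel ?leq_pred //; lia.
  - by rewrite /= size_mkseq; lia.
  move=> F e; case: (eqVneq (teval e (formal_lead f1)) 0) => [c0|c0].
    rewrite {2}/common_root /= drop //.
    by split; [left|case=> [[]|[]//]].
  split=> [[y h]|[[/eqP]|[_]]]; last 2 first.
  - by rewrite (negbTE c0).
  - case=> y /= /andP[/and3P[h1 h2 h3] h4]; exists y.
    by rewrite /= h1 h3 h4 -(rootred _ _ f1) ?h2 ?f1p.
  right; split; first exact/eqP; exists y => /=.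
  move: h => /= /andP[/and3P[h1 h2 h3] h4].
  by rewrite rootred ?f1p // h1 h2 h3 h4.
apply: def_ext (def_or (def_and d2 (IH (f1 :: take (size f2).-1 f2 :: fs) _))
               (def_and (def_not d2) (IH (cancel_lead f2 f1 :: f2 :: fs) _))) _.
- by rewrite /= size_takel ?leq_pred //; lia.
- by rewrite /= size_mkseq; lia.
move=> F e; case: (eqVneq (teval e (formal_lead f2)) 0) => [c0|c0].
  rewrite {2}/common_root /= drop //.
  by split; [left|case=> [[]|[]//]].
split=> [[y h]|[[/eqP]|[_]]]; last 2 first.
- by rewrite (negbTE c0).
- case=> y /= /andP[/and3P[h1 h2 h3] h4]; exists y.
  by rewrite /= h2 h3 h4 -(rootred _ _ f2 f1) ?h1 ?f2p ?(ltnW f21).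
right; split; first exact/eqP; exists y => /=.
move: h => /= /andP[/and3P[h1 h2 h3] h4].
by rewrite rootred ?f2p ?(ltnW f21) // h1 h2 h3 h4.
Qed.

End Elimination.

Section DNF.
Variable I : Type.
Definition clause := (seq (term I) * term I)%type.
Definition ceval (A : comNzRingType) (e : I -> A) (c : clause) :=
  all (fun t => teval e t == 0) c.1 && (teval e c.2 != 0).

(** A clause needs only one inequation, because in a field several of them multiply into one. The
    normal form of the negation is built alongside, so that [Not] merely swaps the two lists. *)
Lemma dnf (q : qf I) : exists L L' : seq clause, forall (F : fieldType) (e : I -> F),
  qeval e q = has (ceval e) L /\ ~~ qeval e q = has (ceval e) L'.
Proof.
elim: q => [t|p [L1 [L1' H1]] q [L2 [L2' H2]]|q [L [L' H]]] /=.
- exists [:: ([:: t], Cst 1)], [:: ([::], t)] => F e /=.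
  by rewrite /ceval /= !orbF andbT oner_eq0 andbT.
- exists [seq (c.1 ++ d.1, Mul c.2 d.2) | c <- L1, d <- L2], (L1' ++ L2') => F e.
  have [E1 E1'] := H1 F e; have [E2 E2'] := H2 F e.
  split; last by rewrite negb_and E1' E2' has_cat.
  rewrite E1 E2; elim: (L1) => //= c L IH.
  rewrite has_cat -IH andb_orl; congr (_ || _).
  rewrite has_map; elim: (L2) => [|d L2'' IH2] /=; first by rewrite andbF.
  rewrite -IH2 andb_orr; congr (_ || _).
  by rewrite /ceval /= all_cat mulf_eq0 negb_or !andbA; congr (_ && _); rewrite andbAC.
- exists L', L => F e; have [E E'] := H F e; split=> //; by rewrite negbK.
Qed.
End DNF.

Definition ocons (I A : Type) (y : A) (e : I -> A) (o : option I) : A :=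
  if o is Some i then e i else y.

Fixpoint topoly (I : Type) (t : term (option I)) : seq (term I) :=
  match t with
  | Var None => [:: Cst 0; Cst 1]
  | Var (Some i) => [:: Var i]
  | Cst n => [:: Cst n]
  | Add s t => padd (topoly s) (topoly t)
  | Mul s t => pmul (topoly s) (topoly t)
  end.

Lemma horner_topoly (I : Type) (A : comNzRingType) (e : I -> A) y t :
  (fpoly e (topoly t)).[y] = teval (ocons y e) t.
Proof.
elim: t => [[i|]|n|s IHs t IHt|s IHs t IHt] /=.
- by rewrite fpoly_cons /fpoly /= !hornerE.
- by rewrite !fpoly_cons /fpoly /= !hornerE.
- by rewrite fpoly_cons /fpoly /= !hornerE.
- by rewrite fpoly_add hornerD IHs IHt.
- by rewrite fpoly_mul hornerM IHs IHt.
Qed.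

(** The quantifier commutes with the disjunction of clauses, and for one clause, read as polynomials
    in the variable [None], it is an instance of [common_root]. *)
Lemma def_ex1 (I : Type) (D : forall F : closedFieldType, (option I -> F) -> Prop) :
  definable D -> definable (fun F e => exists y, D F (ocons y e)).
Proof.
case=> q Hq; have [L [L' HL]] := dnf q.
pose d (c : clause (option I)) :=
  def_common_root (map (@topoly I) c.1) (topoly c.2).
have dL : definable (fun F e => exists j : 'I_(size L),
   common_root (map (@topoly I) (tnth (in_tuple L) j).1)
      (topoly (tnth (in_tuple L) j).2) e : Prop).
  by apply: def_exfin => j; apply: d.
have cE (F : closedFieldType) (e : I -> F) (c : clause (option I)) y :
   all (fun f => root (fpoly e f) y) (map (@topoly I) c.1) &&
     ~~ root (fpoly e (topoly c.2)) y = ceval (ocons y e) c.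
  rewrite /ceval all_map rootE horner_topoly; congr (_ && _).
  by apply: eq_all => t /=; rewrite rootE horner_topoly.
apply: def_ext dL _ => F e; split=> [[y /Hq]|[j [y]]].
  rewrite (HL F _).1 => /(has_nthP ([::], Cst 0))[i ilt ci].
  exists (Ordinal ilt), y; rewrite cE.
  by rewrite (tnth_nth ([::], Cst 0)).
rewrite cE => cj; exists y; apply/Hq; rewrite (HL F _).1.
apply/(has_nthP ([::], Cst 0)); exists j => //.
by move: cj; rewrite (tnth_nth ([::], Cst 0)).
Qed.

Definition sumf (I J A : Type) (e : I -> A) (f : J -> A) (u : I + J) : A :=
  match u with inl i => e i | inr j => f j end.

Lemma def_exI (I : Type) n (D : forall F : closedFieldType, (I + 'I_n -> F) -> Prop) :
  definable D -> definable (fun F e => exists f : 'I_n -> F, D F (sumf e f)).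
Proof.
elim: n D => [|n IH] D dD.
  have [q Hq] := dD.
  pose h (u : I + 'I_0) : I :=
    match u with inl i => i | inr j => False_rect _ (notF (ltn_ord j)) end.
  apply: def_ext (def_reindex h dD) _ => F e.
  have E (f : 'I_0 -> F) : sumf e f = e \o h.
    by apply/funext => -[i|[]].
  by split=> [[f]|H]; [rewrite E|exists (fun=> 0); rewrite E].
pose h (u : I + 'I_n.+1) : option (I + 'I_n) :=
  match u with
  | inl i => Some (inl i)
  | inr j => if unlift ord0 j is Some k then Some (inr k) else None
  end.
have d1 : definable (fun F (e : option (I + 'I_n) -> F) => D F (e \o h)).
  exact: def_reindex.
have d2 := IH _ (def_ex1 d1).
apply: def_ext d2 _ => F e; split=> [[f Df]|[f [y Dy]]].
  exists (fun j => f (lift ord0 j)), (f ord0).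
  suff -> : ocons (f ord0) (sumf e (fun j => f (lift ord0 j))) \o h = sumf e f by [].
  by apply/funext => -[i|j] //=; case: unliftP => [k ->|->].
exists (fun j => if unlift ord0 j is Some k then f k else y).
suff <- : ocons y (sumf e f) \o h = 
  sumf e (fun j => if unlift ord0 j is Some k then f k else y) by [].
by apply/funext => -[i|j] //=; case: unliftP.
Qed.

Lemma def_ex (I : Type) (J : finType)
    (D : forall F : closedFieldType, (I -> F) -> (J -> F) -> Prop) :
  definable (fun F (u : I + J -> F) => D F (u \o inl) (u \o inr)) ->
  definable (fun F e => exists f : J -> F, D F e f).
Proof.
move=> dD; pose h (u : I + J) : I + 'I_#|J| :=
  match u with inl i => inl i | inr j => inr (enum_rank j) end.
apply: def_ext (def_exI (def_reindex h dD)) _ => F e; split=> [[f Df]|[f Df]].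
  exists (f \o enum_val).
  suff -> : (sumf e (f \o enum_val) \o h) \o inr = f by [].
  by apply/funext => j /=; rewrite enum_rankK.
by exists (f \o enum_rank).
Qed.

Lemma def_forall (I : Type) (J : finType)
    (D : forall F : closedFieldType, (I -> F) -> (J -> F) -> Prop) :
  definable (fun F (u : I + J -> F) => D F (u \o inl) (u \o inr)) ->
  definable (fun F e => forall f : J -> F, D F e f).
Proof.
move=> dD; apply: def_ext (def_not (def_ex (D := fun F e f => ~ D F e f) (def_not dD))) _.
move=> F e; split=> [h [f]|h f]; first exact.
by apply: contrapT => nD; apply: h; exists f.
Qed.

(** Without variables and quantifiers, every atom says that some integer [z] vanishes in the field.
    [N] is the product of the absolute values of the nonzero [z]; where [N] is nonzero, all atoms
    have the truth value that they have over the integers. *)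
Lemma sentence_transfer (D : forall F : closedFieldType, (void -> F) -> Prop) :
  definable D -> exists2 N : nat, (0 < N)%N &
  forall (F F' : closedFieldType) (e : void -> F) (e' : void -> F'),
    N%:R != 0 :> F -> N%:R != 0 :> F' -> D F e -> D F' e'.
Proof.
case=> q Hq; suff [N N0 HN] : exists2 N : nat, (0 < N)%N &
  forall (F F' : closedFieldType) (e : void -> F) (e' : void -> F'),
    N%:R != 0 :> F -> N%:R != 0 :> F' -> qeval e q = qeval e' q.
  by exists N => // F F' e e' N1 N2; rewrite !Hq (HN _ _ e e').
elim: q {D Hq} => [t|p [M M0 HM] q [N N0 HN]|q [N N0 HN]] /=.
- pose z := teval (of_void int) t.
  have E (F : closedFieldType) (e : void -> F) : teval e t = z%:~R.
    rewrite /z (teval_rmorph (intr : {rmorphism int -> F})).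
    by have -> : e = intr \o of_void int by apply: funext; case.
  have [z0|z0] := eqVneq z 0.
    exists 1%N => [//|F F' e e' _ _]; rewrite !E.
    by rewrite z0 !eqxx.
  exists `|z|%N; first by rewrite absz_gt0.
  have nz (F : closedFieldType) : `|z|%N%:R != 0 :> F -> z%:~R != 0 :> F.
    by case: (z) => n //; rewrite NegzE abszN mulrNz oppr_eq0.
  by move=> F F' e e' /nz n1 /nz n2; rewrite !E (negbTE n1) (negbTE n2).
- exists (M * N)%N; first by rewrite muln_gt0 M0.
  move=> F F' e e'; rewrite !natrM !mulf_eq0 !negb_or => /andP[m1 n1] /andP[m2 n2].
  by rewrite (HM _ _ e e') // (HN _ _ e e').
- by exists N => // F F' e e' n1 n2; rewrite (HN _ _ e e').
Qed.

(** * Plane curves in the torus *)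

Section Bivariate.
Variable F : closedFieldType.
Local Notation P := {poly {poly F}}.
Implicit Types (f g h q a b A : P) (z : F * F) (S : set (F * F)).

Definition ev f z : F := f.[z.1, z.2].
Lemma evM f g z : ev (f * g) z = ev f z * ev g z. Proof. by rewrite /ev !hornerM. Qed.
Lemma evC c z : ev c%:P%:P z = c. Proof. by rewrite /ev !hornerC. Qed.
Lemma evX z : ev 'X z = z.1. Proof. by rewrite /ev hornerX hornerC. Qed.
Lemma evY z : ev 'X%:P z = z.2. Proof. by rewrite /ev hornerC hornerX. Qed.

(** The sum of the degrees in the two variables. On nonzero polynomials it is additive under
    products and vanishes exactly on constants, which makes it the measure for the inductions over
    factorisations. *)
Definition degree_sum f := ((size f).-1 + (sizeY f).-1)%N.

Lemma degree_sumM f g : f != 0 -> g != 0 -> degree_sum (f * g) = (degree_sum f + degree_sum g)%N.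
Proof.
move=> f0 g0; rewrite /degree_sum !sizeYE rmorphM /= !size_mul ?swapXY_eq0 //.
have : (0 < size f)%N by rewrite size_poly_gt0.
have : (0 < size g)%N by rewrite size_poly_gt0.
have : (0 < size (swapXY f))%N by rewrite size_poly_gt0 swapXY_eq0.
have : (0 < size (swapXY g))%N by rewrite size_poly_gt0 swapXY_eq0.
move: (size (swapXY g)) (size (swapXY f)) (size g) (size f) => a b c d.
lia.
Qed.

Lemma degree_sum_eq0 f : f != 0 -> degree_sum f = 0%N -> exists2 c, c != 0 & f = c%:P%:P.
Proof.
move=> f0 m0.
have s1 : size f == 1%N.
  by move: m0 f0; rewrite /degree_sum -size_poly_gt0; case: (size f) => [|[|k]].
have [c c0 fE] := size_poly1P _ s1.
have s2 : size c == 1%N.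
  have := m0; rewrite /degree_sum fE sizeYE swapXY_polyC size_map_polyC.
  by move: c0; rewrite -size_poly_gt0; case: (size c) => [|[|k]] //; rewrite addnS.
have [d d0 cE] := size_poly1P _ s2.
by exists d => //; rewrite fE cE.
Qed.

Lemma degree_sum_const c : degree_sum c%:P%:P = 0%N.
Proof.
by rewrite /degree_sum sizeYE swapXY_polyC map_polyC !size_polyC !polyC_eq0; case: eqP.
Qed.

Definition dvd f g := exists h, g = h * f.

Definition irreducible2 q := [/\ q != 0, (0 < degree_sum q)%N &
  forall a b, q = a * b -> degree_sum a = 0%N \/ degree_sum b = 0%N].

Lemma constV_mul (c : F) : c != 0 -> c^-1%:P%:P * c%:P%:P = 1 :> P.
Proof. by move=> c0; rewrite -!polyCM mulVf. Qed.

Lemma irreducible2_factor f : f != 0 -> (0 < degree_sum f)%N -> exists q h, irreducible2 q /\ f = q * h.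
Proof.
have [n] := ubnP (degree_sum f); elim: n f => // n IH f lt f0 m0.
case: (pselect (irreducible2 f)) => [irrf|nirr]; first by exists f, 1; rewrite mulr1.
have [a [b [fE ma mb]]] : exists a b, [/\ f = a * b, degree_sum a <> 0%N & degree_sum b <> 0%N].
  apply: contrapT => H; apply: nirr; split=> // a b fE.
  apply: contrapT => /not_orP[ma mb]; apply: H; by exists a, b.
have a0 : a != 0 by apply: contraNneq f0 => a0; rewrite fE a0 mul0r.
have b0 : b != 0 by apply: contraNneq f0 => b0; rewrite fE b0 mulr0.
have mE : degree_sum f = (degree_sum a + degree_sum b)%N by rewrite fE degree_sumM.
have [||q [h [qirr aE]]] := IH a _ a0; [lia|lia|].
by exists q, (h * b); split => //; rewrite fE aE mulrA.
Qed.

Lemma finite_roots (p : {poly F}) : p != 0 -> finite_set [set x | p.[x] = 0].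
Proof.
move=> p0; have [rs E] := closed_field_poly_normal p.
apply: (@sub_finite_set _ _ [set` rs]); last exact: finite_seq.
move=> x /= /eqP; rewrite -rootE E rootZ ?lead_coef_eq0 //.
by rewrite root_prod_XsubC.
Qed.

Lemma avoid_finite (B : set F) : finite_set B -> exists x, ~ B x.
Proof.
move/finite_seqP => [s ->].
have /closed_nonrootP[x] : \prod_(y <- s) ('X - y%:P) != 0.
  by apply: monic_neq0; apply: monic_prod_XsubC.
by rewrite root_prod_XsubC => /negP; exists x.
Qed.

Definition at_l (l : F) f : {poly F} := map_poly (horner_eval l) f.

Lemma at_lE l f m : (at_l l f).[m] = ev f (m, l).
Proof.
by have := horner_map (horner_eval l) f m%:P; rewrite /= {2}/horner_eval hornerC.
Qed.

Lemma at_lM l f g : at_l l (f * g) = at_l l f * at_l l g.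
Proof. exact: rmorphM. Qed.

Lemma at_l_eq0 l f : at_l l f = 0 -> exists h, f = ('X - l%:P)%:P * h.
Proof.
move=> H; exists (map_poly (fun c => c %/ ('X - l%:P)) f).
apply/polyP => i; rewrite coefCM coef_map_id0 ?div0p //.
have : root f`_i l by rewrite rootE -horner_evalE -coef_map -/(at_l l f) H coef0.
by rewrite -dvdp_XsubCl dvdp_eq => /eqP {1}->; rewrite mulrC.
Qed.

Lemma degree_sum_line l : degree_sum ('X - l%:P)%:P = 1%N.
Proof. by rewrite /degree_sum sizeYE swapXY_polyC size_map_polyC size_XsubC size_polyC polyXsubC_eq0. Qed.

Lemma size_lineM l h : size (('X - l%:P)%:P * h) = size h.
Proof. by rewrite size_Cmul // polyXsubC_eq0. Qed.

Lemma line_mulI l : injective ( *%R (('X - l%:P)%:P : P)).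
Proof. by apply: mulfI; rewrite polyC_eq0 polyXsubC_eq0. Qed.

Lemma irreducible2_at_l q l : irreducible2 q -> (1 < size q)%N -> at_l l q != 0.
Proof.
case=> q0 mq qirr sq; apply/eqP => /at_l_eq0[h qE].
have [|m0] := qirr _ _ qE; first by rewrite degree_sum_line.
have h0 : h != 0 by apply: contraNneq q0 => h0; rewrite qE h0 mulr0.
have [c _ hE] := degree_sum_eq0 h0 m0.
by move: sq; rewrite qE size_lineM hE size_polyC; case: eqP.
Qed.

Lemma const_ind (Q : {poly F} -> Prop) :
  (forall c, c != 0 -> Q c%:P) ->
  (forall l c, c != 0 -> Q c -> Q (('X - l%:P) * c)) ->
  forall c, c != 0 -> Q c.
Proof.
move=> Qc Qx c c0; have [rs E] := closed_field_poly_normal c.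
have lc0 : lead_coef c != 0 by rewrite lead_coef_eq0.
rewrite E; elim: rs {E} => [|l rs IH].
  by rewrite big_nil alg_polyC; apply: Qc.
rewrite big_cons scalerAr; apply: Qx => //.
by rewrite scaler_eq0 negb_or lc0 monic_neq0 // monic_prod_XsubC.
Qed.

(* Gauss' lemma; over an algebraically closed field it suffices to cancel the
   linear factors of c one at a time. *)
Lemma gauss_dvd q : irreducible2 q -> (1 < size q)%N -> forall c : {poly F}, c != 0 ->
  forall f e, c%:P * f = q * e -> dvd q f.
Proof.
move=> qirr sq; apply: const_ind => [c c0|l c c0 IH] f e.
  move=> E; exists (c^-1%:P%:P * e); rewrite -mulrA [e * q]mulrC -E mulrA.
  by rewrite -!polyCM mulVf // mul1r.
move=> E; have /eqP := congr1 (at_l l) E.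
rewrite !at_lM {1}/at_l map_polyC /=.
rewrite horner_evalE hornerM hornerXsubC subrr mul0r polyC0 mul0r eq_sym mulf_eq0.
rewrite (negbTE (irreducible2_at_l _ _ _)) //= => /eqP/at_l_eq0[e' eE].
apply: (IH f e'); apply: (@line_mulI l).
by rewrite mulrA -polyCM E eE mulrCA.
Qed.

(** Clears the denominator [c] of a factorisation over the field of fractions: each linear factor of
    [c] divides [d] or [e] and is cancelled there. What leaves [d] lies in the inner variable only,
    so its outer degree is kept. *)
Lemma gauss_split (c : {poly F}) : c != 0 -> forall f d e, c%:P * f = d * e ->
  exists d' e' (al : {poly F}), [/\ f = d' * e', size d' = size d & d = al%:P * d'].
Proof.
move: c; apply: const_ind => [c c0|l c c0 IH] f d e.
  move=> E; exists d, (c^-1%:P%:P * e), 1; split=> //; last by rewrite mul1r.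
  by rewrite mulrCA -E mulrA -!polyCM mulVf // mul1r.
move=> E; have /eqP := congr1 (at_l l) E.
rewrite !at_lM {1}/at_l map_polyC /=.
rewrite horner_evalE hornerM hornerXsubC subrr mul0r polyC0 mul0r eq_sym mulf_eq0.
case/orP=> /eqP/at_l_eq0[x xE].
  have [|d' [e' [al [fE sd dE]]]] := IH f x e.
    by apply: (@line_mulI l); rewrite mulrA -polyCM E xE -!mulrA.
  exists d', e', (('X - l%:P) * al); split => //; first by rewrite xE size_lineM.
  by rewrite xE dE polyCM mulrA.
have [|d' [e' [al [fE sd dE]]]] := IH f d x.
  by apply: (@line_mulI l); rewrite mulrA -polyCM E xE mulrCA.
by exists d', e', al.
Qed.

Lemma finite_fibres (B : set F) S : finite_set B ->
  (forall z, S z -> B z.2) ->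
  (forall l, finite_set [set m | S (m, l)]) -> finite_set S.
Proof.
move=> fB SB fS.
apply: (@sub_finite_set _ _ (\bigcup_(l in B) ((fun m => (m, l)) @` [set m | S (m, l)]))).
  by move=> [m l] Sz; exists l; [exact: SB Sz | exists m].
by apply: bigcup_finite => // l _; apply: finite_image.
Qed.

(** The weak form of Bezout's theorem. If [q] is free of the outer variable, it is a line up to a
    constant, and [g] does not vanish identically on it. Otherwise [q] and [g] are compared over the
    rational functions in the inner variable: if they are coprime, finitely many values of that
    variable remain; a common factor would by Gauss' lemma be [q] itself up to units, and so [q]
    would divide [g]. *)
Lemma irreducible2_inter_finite q g : irreducible2 q -> ~ dvd q g ->
  finite_set [set z | ev q z = 0 /\ ev g z = 0].
Proof.
move=> qirr ndv; have [q0 mq qsplit] := qirr.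
have [sq|sq] := leqP (size q) 1.
  have /size_poly1P[c c0 qE] : size q == 1%N by rewrite eqn_leq sq size_poly_gt0.
  have [l cl] : exists l, root c l.
    apply/closed_rootP; apply: contraTneq mq => /eqP/size_poly1P[d _ cE].
    by rewrite qE cE degree_sum_const.
  have {cl}/at_l_eq0[h qh] : at_l l q = 0.
    by rewrite qE /at_l map_polyC /= horner_evalE (eqP cl).
  have [|mh] := qsplit _ _ qh; first by rewrite degree_sum_line.
  have h0 : h != 0 by apply: contraNneq q0 => h0; rewrite qh h0 mulr0.
  have [u u0 hE] := degree_sum_eq0 h0 mh.
  have gl : at_l l g != 0.
    apply/eqP => /at_l_eq0[g' gE]; apply: ndv; exists (u^-1%:P%:P * g').
    rewrite gE qh hE.
    transitivity (u^-1%:P%:P * u%:P%:P * (('X - l%:P)%:P * g')); last by ring.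
    by rewrite constV_mul // mul1r.
  have qz z : ev q z = 0 -> z.2 = l.
    rewrite qh hE evM evC {1}/ev hornerC hornerXsubC => /eqP.
    by rewrite mulf_eq0 (negbTE u0) orbF subr_eq0 => /eqP.
  apply: (@finite_fibres [set l]) => [|z [/qz]//|l']; first exact: finite_set1.
  apply: sub_finite_set (finite_roots gl) => m [/= /qz /= -> ].
  by rewrite at_lE.
have [cop|ncop] := boolP (coprimep q g).
  (* The Bezout relation with denominators cleared. Its right-hand side [c2] involves the inner
     variable only and vanishes at the second coordinate of every common zero. *)
  have [[u v] /= /Pdiv.Idomain.eqpP [[c1 c2] /= /andP[c10 c20] E]] :=
    Pdiv.Idomain.Bezout_coprimepP _ _ cop.
  apply: (@finite_fibres [set l | c2.[l] = 0]) => [|z [qz gz]|l].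
  - exact: finite_roots.
  - have := congr1 (ev^~ z) E.
    rewrite /ev !hornerZ !(hornerD, hornerM).
    move: qz gz; rewrite /ev => -> ->; rewrite !mulr0 addr0 mulr0 !hornerC.
    by rewrite mulr1 => /esym.
  apply: sub_finite_set (finite_roots (irreducible2_at_l l qirr sq)) => m [/= + _].
  by rewrite at_lE.
exfalso; apply: ndv; move: ncop; rewrite /coprimep; set d := gcdp q g => sd1.
have d0 : d != 0 by rewrite gcdp_eq0 negb_and q0.
have sd : (1 < size d)%N by rewrite ltn_neqAle eq_sym sd1 size_poly_gt0.
have /Pdiv.Idomain.dvdpP[[c x] /= c0 Eq] := dvdp_gcdl q g.
have /Pdiv.Idomain.dvdpP[[c2 y] /= c20 Eg] := dvdp_gcdr q g.
rewrite /= -/d -!mul_polyC in Eq Eg.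
have [|d' [e' [al [qE sd' dE]]]] := gauss_split c0 (f := q) (d := d) (e := x).
  by rewrite Eq mulrC.
have [m0|m0] := qsplit _ _ qE.
  have d'0 : d' != 0 by apply: contraNneq q0 => z; rewrite qE z mul0r.
  have [u _ d'E] := degree_sum_eq0 d'0 m0.
  by move: sd; rewrite -sd' d'E size_polyC; case: eqP.
have e'0 : e' != 0 by apply: contraNneq q0 => z; rewrite qE z mulr0.
have [u u0 e'E] := degree_sum_eq0 e'0 m0.
apply: (gauss_dvd qirr sq (c := c2 * u%:P) _ (e := y * al%:P)).
  by rewrite mulf_neq0 // polyC_eq0.
by rewrite polyCM mulrAC Eg dE qE e'E; ring.
Qed.

Definition torus_zeros f : set (F * F) := [set z | torus2 z /\ ev f z = 0].

(** The coordinate functions are the only irreducible polynomials without zeros on the torus, and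
    they are units there. For any other [q] that involves the outer variable, almost every nonzero
    [l] gives a polynomial in [m] of positive degree with nonzero constant term, hence a nonzero
    root. *)
Lemma irreducible2_infinite_or_monomial q : irreducible2 q ->
  infinite_set (torus_zeros q) \/
  exists2 u, u != 0 & q = u%:P%:P * 'X \/ q = u%:P%:P * 'X%:P.
Proof.
move=> qirr; have [q0 mq qsplit] := qirr.
have mono x y : q = x * y -> degree_sum x != 0%N -> exists2 u, u != 0 & q = u%:P%:P * x.
  move=> qE mx; have [mx0|my] := qsplit _ _ qE; first by rewrite mx0 in mx.
  have y0 : y != 0 by apply: contraNneq q0 => z; rewrite qE z mulr0.
  by have [u u0 yE] := degree_sum_eq0 y0 my; exists u => //; rewrite qE yE mulrC.
have [sq|sq] := leqP (size q) 1.
  have /size_poly1P[c c0 qE] : size q == 1%N by rewrite eqn_leq sq size_poly_gt0.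
  have [l cl] : exists l, root c l.
    apply/closed_rootP; apply: contraTneq mq => /eqP/size_poly1P[d _ cE].
    by rewrite qE cE degree_sum_const.
  have /at_l_eq0[h qh] : at_l l q = 0.
    by rewrite qE /at_l map_polyC /= horner_evalE (eqP cl).
  have [l0|l0] := eqVneq l 0.
    right; have [|u u0 qu] := mono _ _ qh; first by rewrite degree_sum_line.
    by exists u => //; right; rewrite qu l0 subr0.
  left=> fin.
  have /avoid_finite[m] : finite_set ([set 0] `|` (fst @` torus_zeros q)).
    by rewrite finite_setU; split; [exact: finite_set1|exact: finite_image].
  move=> /not_orP[m0]; apply; exists (m, l) => //; split; first by split=> //=; apply/eqP.
  by rewrite qE /ev hornerC (eqP cl).
have [c0|c0] := eqVneq q`_0 0.
  have qX : q = 'X * \poly_(i < size q) q`_i.+1.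
    apply/polyP => i; rewrite coefXM coef_poly; case: i => [|i] //=.
    by case: ltnP => // h; rewrite nth_default // ltnW.
  right; have [|u u0 qu] := mono _ _ qX.
    by rewrite /degree_sum size_polyX addSn.
  by exists u => //; left.
left=> fin.
have lq0 : lead_coef q != 0 by rewrite lead_coef_eq0.
(* The value [l] is chosen nonzero, different from the second coordinates of the supposedly finite
   zero set, and such that neither the degree in [m] nor the constant term drops. *)
have /avoid_finite[l] : finite_set ([set l | (lead_coef q * q`_0 * 'X).[l] = 0]
      `|` (snd @` torus_zeros q)).
  rewrite finite_setU; split; last exact: finite_image.
  by apply: finite_roots; rewrite !mulf_neq0 // polyX_eq0.
move=> /not_orP[/eqP]; rewrite !hornerM hornerX !mulf_eq0 !negb_or -andbA.
case/and3P=> ll cl l0; apply.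
have szl : size (at_l l q) = size q.
  by rewrite /at_l size_map_poly_id0 // horner_evalE.
have [m /eqP ml] : exists m, root (at_l l q) m.
  by apply/closed_rootP; rewrite szl; apply: contraTneq sq => ->.
have m0 : m != 0.
  apply: contraNneq cl => m0; move: ml; rewrite m0 horner_coef0 /at_l.
  by rewrite coef_map /= horner_evalE => ->.
by exists (m, l) => //; split=> //; rewrite -at_lE.
Qed.

Lemma torus_nonzero f : f != 0 -> exists2 z, torus2 z & ev f z != 0.
Proof.
move=> f0.
have lf0 : lead_coef f != 0 by rewrite lead_coef_eq0.
have /avoid_finite[l /=] : finite_set [set l | (lead_coef f * 'X).[l] = 0].
  by apply: finite_roots; rewrite mulf_neq0 // polyX_eq0.
move/eqP; rewrite hornerM hornerX mulf_eq0 negb_or => /andP[ll l0].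
have fl0 : at_l l f != 0.
  apply: contraNneq ll => H.
  by rewrite lead_coefE -horner_evalE -coef_map -/(at_l l f) H coef0.
have /avoid_finite[m /=] : finite_set [set m | (at_l l f * 'X).[m] = 0].
  by apply: finite_roots; rewrite mulf_neq0 // polyX_eq0.
move/eqP; rewrite hornerM hornerX mulf_eq0 negb_or => /andP[fm m0].
by exists (m, l) => //; rewrite -at_lE.
Qed.

Lemma dvd_of_vanish q f S : irreducible2 q -> infinite_set (torus_zeros q) ->
  finite_set S -> (forall z, torus_zeros q z -> ~ S z -> ev f z = 0) -> dvd q f.
Proof.
move=> qirr qinf fS H; apply: contrapT => nd; apply: qinf.
apply: (@sub_finite_set _ _ (S `|` [set z | ev q z = 0 /\ ev f z = 0])).
  move=> z [tz qz]; case: (pselect (S z)) => Sz; [by left|right; split => //].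
  exact: H.
by rewrite finite_setU; split => //; exact: irreducible2_inter_finite.
Qed.

Lemma laurent_ideal_monomial A f q u : u != 0 ->
  q = u%:P%:P * 'X \/ q = u%:P%:P * 'X%:P -> laurent_ideal A f -> laurent_ideal (q * A) f.
Proof.
move=> u0 qE [i [j [s E]]]; case: qE => ->.
  exists i.+1, j, (u^-1%:P%:P * s).
  transitivity ('X * ('X^i * ('X^j)%:P * f)); first by rewrite exprS; ring.
  rewrite E; transitivity (u^-1%:P%:P * u%:P%:P * (s * 'X * A)); last by ring.
  by rewrite constV_mul // mul1r; ring.
exists i, j.+1, (u^-1%:P%:P * s).
transitivity ('X%:P * ('X^i * ('X^j)%:P * f)); first by rewrite exprS polyCM; ring.
rewrite E; transitivity (u^-1%:P%:P * u%:P%:P * (s * 'X%:P * A)); last by ring.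
by rewrite constV_mul // mul1r; ring.
Qed.

(* Repeated monomial factors are allowed: they are units on the torus. *)
Definition sqfree A := forall a b, A = a ^+ 2 * b -> forall z, torus2 z -> ev a z != 0.

(** An irreducible factor [q] of [A] divides [f], or is a monomial and hence a unit. After division
    by [q], the vanishing is lost at the points where [q] meets the cofactor [A1]; these are
    finitely many since [q] does not divide [A1], and they are absorbed in [S]. The tolerance [S] is
    thus forced by the induction. *)
Lemma sqfree_laurent_ideal A f S : A != 0 -> sqfree A -> finite_set S ->
  (forall z, torus_zeros A z -> ~ S z -> ev f z = 0) -> laurent_ideal A f.
Proof.
have [n] := ubnP (degree_sum A); elim: n A f S => // n IH A f S lt A0 sqA fS fA.
have [mA|mA] := posnP (degree_sum A).
  have [u u0 AE] := degree_sum_eq0 A0 mA.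
  exists 0%N, 0%N, (u^-1%:P%:P * f); rewrite AE !expr0 !mul1r mulrAC.
  by rewrite -!polyCM mulVf // mul1r.
have [q [A1 [qirr AE]]] := irreducible2_factor A0 mA.
have [q0 mq _] := qirr.
have A10 : A1 != 0 by apply: contraNneq A0 => z; rewrite AE z mulr0.
have lt1 : (degree_sum A1 < n)%N by move: lt; rewrite AE degree_sumM //; lia.
have sqA1 : sqfree A1.
  by move=> a b A1E; apply: (sqA a (q * b)); rewrite AE A1E mulrCA.
have VA1 z : torus_zeros A1 z -> torus_zeros A z.
  by case=> tz z1; split => //; rewrite AE evM z1 mulr0.
have [qinf|[u u0 qE]] := irreducible2_infinite_or_monomial qirr.
  have [|f1 fE] := dvd_of_vanish (f := f) qirr qinf fS.
    move=> z [tz qz]; apply: fA; split => //; by rewrite AE evM qz mul0r.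
  have nd : ~ dvd q A1.
    move=> [b A1E]; apply: qinf; rewrite (_ : torus_zeros q = set0) //.
    rewrite -subset0 => z [tz]; apply/eqP; apply: (sqA q b) => //.
    by rewrite AE A1E mulrCA expr2 mulrC.
  have [||i [j [s E]]] := IH A1 f1 (S `|` [set z | ev q z = 0 /\ ev A1 z = 0]) lt1 A10 sqA1.
  - by rewrite finite_setU; split => //; exact: irreducible2_inter_finite.
  - move=> z Az /not_orP[Sz /not_andP nz]; have := fA z (VA1 _ Az) Sz.
    rewrite fE evM => /eqP; rewrite mulf_eq0 => /orP[/eqP//|/eqP qz].
    by case: Az => _ Az; case: nz.
  by exists i, j, s; rewrite fE mulrA E AE -!mulrA; congr (_ * _); rewrite mulrC.
rewrite AE; apply: (laurent_ideal_monomial u0 qE); apply: (IH A1 f S) => //.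
by move=> z /VA1; exact: fA.
Qed.

(** For a principal ideal the Nullstellensatz follows from factorisation: each irreducible factor of
    [g] with infinitely many zeros divides [f], and so costs one more power of [f]. *)
Lemma principal_nullstellensatz g f : g != 0 ->
  (forall z, torus_zeros g z -> ev f z = 0) -> exists n, laurent_ideal g (f ^+ n).
Proof.
have [n] := ubnP (degree_sum g); elim: n g f => // n IH A f lt A0 fA.
have [mA|mA] := posnP (degree_sum A).
  have [u u0 AE] := degree_sum_eq0 A0 mA.
  exists 0%N, 0%N, 0%N, (u^-1%:P%:P); rewrite AE !expr0 !mul1r.
  by rewrite -!polyCM mulVf.
have [q [A1 [qirr AE]]] := irreducible2_factor A0 mA.
have [q0 mq _] := qirr.
have A10 : A1 != 0 by apply: contraNneq A0 => z; rewrite AE z mulr0.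
have lt1 : (degree_sum A1 < n)%N by move: lt; rewrite AE degree_sumM //; lia.
have [|k [i [j [s E]]]] := IH A1 f lt1 A10.
  by move=> z [tz z1]; apply: fA; split => //; rewrite AE evM z1 mulr0.
have [qinf|[u u0 qE]] := irreducible2_infinite_or_monomial qirr.
  have [|f1 fE] := dvd_of_vanish (f := f) qirr qinf (@finite_set0 _).
    move=> z [tz qz] _; apply: fA; split => //; by rewrite AE evM qz mul0r.
  exists k.+1, i, j, (s * f1); rewrite exprSr mulrA E AE [f in LHS]fE; ring.
by exists k; rewrite AE; apply: (laurent_ideal_monomial u0 qE); exists i, j, s.
Qed.

(** As long as [h = a ^+ 2 * b] with a zero of [a] on the torus, [a * b] has the same zeros and
    smaller degree, because [a] is not constant. *)
Lemma sqfree_part h : h != 0 -> exists A, [/\ A != 0, sqfree A &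
  forall z, torus_zeros A z <-> torus_zeros h z].
Proof.
have [n] := ubnP (degree_sum h); elim: n h => // n IH h lt h0.
case: (pselect (sqfree h)) => [|nsq]; first by exists h; split.
have [a [b [hE [z tz az]]]] : exists a b, h = a ^+ 2 * b /\ exists2 z, torus2 z & ev a z = 0.
  apply: contrapT => H; apply: nsq => a b hE z tz; apply/eqP => az; apply: H.
  by exists a, b; split => //; exists z.
have a0 : a != 0 by apply: contraNneq h0 => z0; rewrite hE z0 expr0n mul0r.
have b0 : b != 0 by apply: contraNneq h0 => z0; rewrite hE z0 mulr0.
have ma : (0 < degree_sum a)%N.
  rewrite lt0n; apply/eqP => ma; have [u u0 aE] := degree_sum_eq0 a0 ma.
  by move: u0; rewrite -(evC u z) -aE az eqxx.
have [||A [A0 sA AE]] := IH (a * b); first by move: lt; rewrite hE expr2 !degree_sumM ?mulf_neq0 //; lia.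
  by rewrite mulf_neq0.
exists A; split=> // w; rewrite AE /torus_zeros /= hE expr2 !evM.
split=> -[tw /eqP]; rewrite !mulf_eq0 => H; split=> //; apply/eqP; rewrite !mulf_eq0.
  by case/orP: H => ->; rewrite ?orbT.
by case/orP: H => [/orP[]|] ->; rewrite ?orbT.
Qed.

(* The class of subsets S of the torus that are finite or cofinite on every
   irreducible curve and contained, they or their complement, in a curve is
   closed under boolean operations. *)
Definition tame S :=
  (forall q, irreducible2 q -> finite_set (torus_zeros q `&` S) \/
                      finite_set (torus_zeros q `&` ~` S)) /\
  exists2 h, h != 0 & (forall z, torus2 z -> S z -> ev h z = 0) \/
                      (forall z, torus2 z -> ~ S z -> ev h z = 0).

Lemma tame_eq0 f : tame [set z | ev f z = 0].
Proof.
split=> [q qirr|].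
  case: (pselect (dvd q f)) => [[k fE]|nd].
    right; rewrite (_ : _ `&` _ = set0) // -subset0 => z [[tz qz]] /=.
    by rewrite fE evM qz mulr0.
  left; apply: sub_finite_set (irreducible2_inter_finite qirr nd).
  by move=> z [[_ ?] ?].
have [->|f0] := eqVneq f 0.
  by exists 1; [exact: oner_neq0|right => z _ []; rewrite /= /ev !hornerC].
by exists f => //; left.
Qed.

Lemma tameC S : tame S -> tame (~` S).
Proof.
case=> H1 [h h0 H2]; split=> [q /H1|].
  by rewrite setCK; case; [right|left].
exists h => //; case: H2 => H2; [right|left] => z tz /= nS; last exact: H2.
by apply: H2 => //; apply: contrapT.
Qed.

Lemma tameI S S' : tame S -> tame S' -> tame (S `&` S').
Proof.
move=> [H1 [h h0 H2]] [H1' [h' h0' H2']]; split=> [q qirr|].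
  case: (H1 q qirr) => [fin|cof].
    by left; apply: sub_finite_set fin => z [? []].
  case: (H1' q qirr) => [fin|cof'].
    by left; apply: sub_finite_set fin => z [? []].
  right; apply: (@sub_finite_set _ _ ((torus_zeros q `&` ~` S) `|` (torus_zeros q `&` ~` S'))).
    by move=> z [qz /not_andP[]]; [left|right].
  by rewrite finite_setU.
case: H2 => H2; first by exists h => //; left => z tz [Sz _]; exact: H2.
case: H2' => H2'; first by exists h' => //; left => z tz [_ Sz]; exact: H2'.
exists (h * h'); first by rewrite mulf_neq0.
right=> z tz /not_andP[nS|nS]; rewrite evM; first by rewrite H2 ?mul0r.
by rewrite H2' ?mulr0.
Qed.

Definition pt z (b : bool) : F := if b then z.1 else z.2.

Lemma tame_definable (D : forall F : closedFieldType, (bool -> F) -> Prop) :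
  definable D -> tame [set z | D F (pt z)].
Proof.
case=> q Hq; suff tq : tame [set z | qeval (pt z) q].
  by rewrite (_ : [set z | _] = [set z | qeval (pt z) q]) //; apply/seteqP; split=> z /Hq.
elim: q {D Hq} => [t|p Hp q Hq|q Hq].
- pose f : P := teval (fun b : bool => if b then 'X else 'X%:P) t.
  suff E z : ev f z = teval (pt z) t.
    rewrite (_ : [set z | _] = [set z | ev f z = 0]); first exact: tame_eq0.
    by apply/seteqP; split=> z /=; rewrite E => /eqP.
  have -> : ev f z = (horner_eval z.2 \o horner_eval z.1%:P) f by [].
  rewrite teval_rmorph; congr teval; apply/funext => -[] /=.
    by rewrite /horner_eval hornerX hornerC.
  by rewrite /horner_eval hornerC hornerX.
- rewrite (_ : [set z | _] = [set z | qeval (pt z) p] `&` [set z | qeval (pt z) q]).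
    exact: tameI.
  by apply/seteqP; split=> z /= /andP.
- rewrite (_ : [set z | _] = ~` [set z | qeval (pt z) q]); first exact: tameC.
  by apply/seteqP; split=> z /= /negP.
Qed.

(** If the complement of [S] lies on a curve, [S] is dense. If [S] lies on the curve [h = 0], the
    irreducible factors of [h] on which [S] is cofinite are kept and those on which [S] is finite
    are dropped; either choice costs finitely many points. *)
Lemma tame_dense_or_curve S : tame S ->
  (exists2 h, h != 0 & forall z, torus2 z -> ev h z != 0 -> S z) \/
  (exists2 h, h != 0 & finite_set [set z | torus2 z /\ ~ (S z <-> ev h z = 0)]).
Proof.
case=> H1 [h h0 H2]; case: H2 => H2; last first.
  left; exists h => // z tz /eqP hz; apply: contrapT => nS; exact/hz/H2.
right; suff [h' [h'0 h'h fin]] : exists h', [/\ h' != 0,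
    forall z, ev h' z = 0 -> ev h z = 0 &
    finite_set [set z | [/\ torus2 z, ev h z = 0 & ~ (S z <-> ev h' z = 0)]]].
  exists h' => //; apply: sub_finite_set fin => z [tz nz]; split => //.
  apply: contrapT => hz; apply: nz; split=> [/(H2 z tz)|/h'h] //.
elim/(@Wf_nat.induction_ltof1 _ degree_sum): h h0 {H2}; rewrite /Wf_nat.ltof => h IH h0.
have [mh|mh] := posnP (degree_sum h).
  have [u u0 hE] := degree_sum_eq0 h0 mh.
  exists h; split => //; rewrite (_ : [set z | _] = set0) // -subset0 => z [_].
  by rewrite hE evC => /eqP; rewrite (negbTE u0).
have [q [h1 [qirr hE]]] := irreducible2_factor h0 mh.
have [q0 mq _] := qirr.
have h10 : h1 != 0 by apply: contraNneq h0 => z; rewrite hE z mulr0.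
have [|k [k0 kh fin]] := IH h1 _ h10; first by rewrite hE degree_sumM //; lia.
have hz z : ev h z = 0 <-> ev q z = 0 \/ ev h1 z = 0.
  rewrite hE evM; split=> [/eqP|[->|->]]; rewrite ?mul0r ?mulr0 // mulf_eq0.
  by case/orP=> /eqP; [left|right].
have [fq|cq] := H1 q qirr.
  exists k; split => //; first by move=> z /kh hz1; apply/hz; right.
  apply: (@sub_finite_set _ _ ([set z | [/\ torus2 z, ev h1 z = 0 & ~ (S z <-> ev k z = 0)]]
    `|` (torus_zeros q `&` S))); last by rewrite finite_setU.
  move=> z [tz /hz hhz nz]; case: (pselect (ev h1 z = 0)) => h1z; [by left|right].
  split; first by case: hhz.
  by apply: contrapT => nS; apply: nz; split=> // /kh.
exists (q * k); split; first by rewrite mulf_neq0.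
  move=> z; rewrite evM => /eqP; rewrite mulf_eq0 => /orP[]/eqP.
    by move=> qz; apply/hz; left.
  by move/kh => h1z; apply/hz; right.
apply: (@sub_finite_set _ _ ([set z | [/\ torus2 z, ev h1 z = 0 & ~ (S z <-> ev k z = 0)]]
    `|` (torus_zeros q `&` ~` S))); last by rewrite finite_setU.
move=> z [tz /hz hhz nz]; have := nz; rewrite evM.
case: (pselect (ev q z = 0)) => qz.
  by rewrite qz mul0r => nz'; right; split => // Sz; apply: nz'.
left; split => //; first by case: hhz.
move=> E; apply: nz; rewrite E evM; split=> [->|/eqP]; first by rewrite mulr0.
by rewrite mulf_eq0 => /orP[]/eqP.
Qed.

End Bivariate.

(** * One-dimensional part of a Zariski closure *)

Section Zariski.
Variable F : closedFieldType.
Local Notation P := {poly {poly F}}.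
Implicit Types (f g h q : P) (z : F * F) (Z C D E : set (F * F)).

Lemma zclosedP Z : zariski_closed Z <-> (Z `<=` @torus2 F /\
  forall z, torus2 z -> ~ Z z -> exists2 f, (forall w, Z w -> ev f w = 0) & ev f z != 0).
Proof.
split=> [Zc|[ZT H]].
  split=> [z|z tz nZ]; first by rewrite -Zc; case.
  apply: contrapT => H; apply: nZ; rewrite -Zc; split=> // f fZ.
  by apply: contrapT => /eqP fz; apply: H; exists f.
apply/seteqP; split=> z.
  case=> tz fz; apply: contrapT => nZ; have [f fZ] := H z tz nZ.
  by rewrite /ev fz ?eqxx.
by move=> Zz; split; [exact: ZT|move=> f; exact].
Qed.

Lemma zclosure_min E Z : E `<=` Z -> zariski_closed Z -> zariski_closure E `<=` Z.
Proof. by move=> EZ <- z [tz H]; split => // f fZ; apply: H => w /EZ; exact: fZ. Qed.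

Lemma zclosed_zeros f : zariski_closed (torus_zeros f).
Proof.
apply/zclosedP; split=> [z []//|z tz nz]; exists f; first by move=> w [].
by apply/eqP => fz; apply: nz.
Qed.

Lemma zclosed_torus : zariski_closed (@torus2 F).
Proof. by apply/zclosedP; split=> // z tz /(_ tz). Qed.

Lemma zclosedU Z D : zariski_closed Z -> zariski_closed D -> zariski_closed (Z `|` D).
Proof.
move=> /zclosedP[ZT HZ] /zclosedP[DT HD]; apply/zclosedP; split.
  by move=> z []; [exact: ZT|exact: DT].
move=> z tz /not_orP[/(HZ z tz)[f fZ fz] /(HD z tz)[g gD gz]].
exists (f * g); last by rewrite evM mulf_neq0.
by move=> w [/fZ|/gD] H; rewrite evM H ?mul0r ?mulr0.
Qed.

Lemma zclosed1 z : torus2 z -> zariski_closed [set z].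
Proof.
move=> tz; apply/zclosedP; split=> [w ->//|w tw nw].
have vX c : ev ('X - c%:P%:P) w = w.1 - c by rewrite /ev !hornerE.
have vY c : ev ('X%:P - c%:P%:P) w = w.2 - c by rewrite /ev !hornerE.
case: (eqVneq w.1 z.1) => e1; last first.
  exists ('X - z.1%:P%:P); last by rewrite vX subr_eq0.
  by move=> _ ->; rewrite /ev !hornerE subrr.
exists ('X%:P - z.2%:P%:P); first by move=> _ ->; rewrite /ev !hornerE subrr.
rewrite vY subr_eq0; apply: contra_notN nw => /eqP e2.
by move: e1 e2; case: (w) (z) => [? ?] [? ?] /= -> ->.
Qed.

Lemma zclosed_finite C : finite_set C -> C `<=` @torus2 F -> zariski_closed C.
Proof.
move=> /finite_seqP[s ->]; elim: s => [|z s IH] sT.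
  apply/zclosedP; split=> // z _ _; exists 1 => //.
  by rewrite /ev !hornerC oner_eq0.
rewrite (_ : [set` z :: s] = [set z] `|` [set` s]).
  apply: zclosedU; first by apply/zclosed1/sT; rewrite /= inE eqxx.
  by apply: IH => w /= ws; apply: sT; rewrite /= inE ws orbT.
apply/seteqP; split=> w /=; rewrite inE; first by case/predU1P; [left|right].
by case=> [->|->]; rewrite ?eqxx ?orbT.
Qed.

Lemma irreducible_finite C : finite_set C -> zariski_irreducible C ->
  exists2 z, torus2 z & C = [set z].
Proof.
move=> fC [/zclosedP[CT _] [z Cz] irrC]; exists z; first exact: CT.
have [||w Cw|H|H] := irrC [set z] (C `\ z).
- exact/zclosed1/CT.
- apply: zclosed_finite; first exact: finite_setD.
  by move=> w [/CT].
- by case: (pselect (w = z)) => wz; [left|right].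
- by apply/seteqP; split=> // w ->.
- by case: (H z Cz) => _ [].
Qed.

Lemma irreducible1 z : torus2 z -> zariski_irreducible [set z].
Proof.
move=> tz; split; [exact: zclosed1|by exists z|].
move=> Z1 Z2 _ _ /(_ z erefl)[Zz|Zz]; [left|right] => w ->//.
Qed.

Lemma finite_no_chain C : finite_set C -> ~ irreducible_chain C 1.
Proof.
move=> fC [c [ci cl]].
have fin i : (i <= 1)%N -> exists2 z, torus2 z & c i = [set z].
  move=> /ci [irrc cC]; apply: irreducible_finite => //.
  exact: sub_finite_set fC.
have [z _ E0] := fin 0%N isT; have [w _ E1] := fin 1%N isT.
have [|H1 H2] := cl 0%N _; first by [].
by apply: H2; rewrite E0 E1 in H1 *; move=> v ->; rewrite (H1 z erefl).
Qed.

Section Curve.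
Variable q : P.
Hypotheses (qirr : irreducible2 q) (qinf : infinite_set (torus_zeros q)).

Lemma zclosed_in_curve D : zariski_closed D -> D `<=` torus_zeros q ->
  ~ torus_zeros q `<=` D -> finite_set D.
Proof.
move=> /zclosedP[DT HD] Dq /existsNP[z /not_implyP[qz nDz]].
have [|f fD fz] := HD z _ nDz; first by case: qz.
apply: (@sub_finite_set _ _ [set w | ev q w = 0 /\ ev f w = 0]).
  by move=> w Dw; split; [have [] := Dq w Dw|exact: fD].
apply: irreducible2_inter_finite => // -[k fE].
by move: fz; rewrite fE evM; case: qz => _ ->; rewrite mulr0 eqxx.
Qed.

(** A polynomial that vanishes on [D] vanishes at almost all points of the curve, hence is divisible
    by [q]. *)
Lemma curve_sub_closed D S : zariski_closed D -> finite_set S ->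
  torus_zeros q `<=` D `|` S -> torus_zeros q `<=` D.
Proof.
move=> /zclosedP[DT HD] fS qDS z qz; apply: contrapT => nDz.
have [|f fD fz] := HD z _ nDz; first by case: qz.
have [|k fE] := dvd_of_vanish (f := f) qirr qinf fS.
  by move=> w /qDS[/fD|].
by move: fz; rewrite fE evM; case: qz => _ ->; rewrite mulr0 eqxx.
Qed.

Lemma curve_irreducible : zariski_irreducible (torus_zeros q).
Proof.
split; [exact: zclosed_zeros| |].
  apply: contrapT => /set0P/negP; rewrite negbK => /eqP q0.
  by apply: qinf; rewrite q0.
move=> Z1 Z2 c1 c2 sub; case: (pselect (torus_zeros q `<=` Z1)) => H; [by left|right].
apply: (@curve_sub_closed _ (torus_zeros q `&` Z1)) => //; last first.
  by move=> z qz; case: (sub z qz); [right|left].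
have [T1 H1] := (zclosedP Z1).1 c1.
move/existsNP: H => [z /not_implyP[qz nz]].
have [|f fD fz] := H1 z _ nz; first by case: qz.
apply: (@sub_finite_set _ _ [set w | ev q w = 0 /\ ev f w = 0]).
  by move=> w [[_ qw] Dw]; split => //; exact: fD.
apply: irreducible2_inter_finite => // -[k fE].
by move: fz; rewrite fE evM; case: qz => _ ->; rewrite mulr0 eqxx.
Qed.

(** Proper closed subsets of the curve are finite, and irreducible finite sets are points. *)
Lemma curve_dim1 : krull_dim (torus_zeros q) 1.
Proof.
have irrC := curve_irreducible; have [qc [z qz] _] := irrC.
split.
  exists (fun i => if i is 0%N then [set z] else torus_zeros q); split=> i.
    case: i => [|i] _; split => //; last by move=> w ->.
    by apply: irreducible1; case: qz.
  case: i => // _; split; first by move=> w ->.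
  by move=> H; apply: qinf; apply: sub_finite_set H _; exact: finite_set1.
case=> c [ci cl].
have [irr1 c1q] := ci 1%N isT.
have fin1 : finite_set (c 1%N).
  apply: zclosed_in_curve => //; first by case: irr1.
  have [_ H] := cl 1%N isT; move=> qc1; apply: H.
  by apply: subset_trans qc1; have [] := ci 2%N isT.
apply: (finite_no_chain fin1); exists c; split=> [i i1|i i1]; last first.
  by apply: cl; apply: leq_trans i1 _.
split; first by have [] := ci i (leq_trans i1 _).
case: i i1 => [|[|//]] _ //.
by have [] := cl 0%N isT.
Qed.

End Curve.

Lemma torus_irreducible : zariski_irreducible (@torus2 F).
Proof.
split; [exact: zclosed_torus|by exists (1, 1); split; exact: oner_neq0|].
move=> Z1 Z2 /zclosedP[T1 H1] /zclosedP[T2 H2] sub.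
apply: contrapT => /not_orP[/existsNP[z /not_implyP[tz nz]] /existsNP[w /not_implyP[tw nw]]].
have [f fZ fz] := H1 z tz nz; have [g gZ gw] := H2 w tw nw.
have f0 : f != 0 by apply: contraNneq fz => ->; rewrite /ev !horner0.
have g0 : g != 0 by apply: contraNneq gw => ->; rewrite /ev !horner0.
have [v tv] := torus_nonzero (mulf_neq0 f0 g0); rewrite evM => /eqP.
by case; case: (sub v tv) => [/fZ|/gZ] ->; rewrite ?mul0r ?mulr0.
Qed.

(** The chain is the point [(1, 1)], the curve [m = 1], the torus. It shows that the torus is not
    one-dimensional. *)
Lemma torus_chain2 : irreducible_chain (@torus2 F) 2.
Proof.
have X1E : ('X - 1 : P) = 'X - 1%:P%:P by [].
have X10 : ('X - 1%:P%:P : P) != 0 by rewrite polyXsubC_eq0.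
have mu1 : degree_sum ('X - 1%:P%:P : P) = 1%N.
  by rewrite /degree_sum size_XsubC sizeYE rmorphB /= swapXY_X swapXY_polyC map_polyC /= 
     -polyCB size_polyC polyXsubC_eq0.
have qirr : irreducible2 ('X - 1%:P%:P : P).
  split=> //; first by rewrite mu1.
  move=> a b E; move: mu1; rewrite E degree_sumM.
  - by case: (degree_sum a) => [|[|k]]; [left|right; lia|lia].
  - by apply: contraNneq X10 => a0; rewrite E a0 mul0r.
  - by apply: contraNneq X10 => a0; rewrite E a0 mulr0.
have t1 (y : F) : y != 0 -> torus_zeros ('X - 1%:P%:P) (1, y).
  move=> y0; split; first by split => //=; exact: oner_neq0.
  by rewrite /ev /= !hornerE subrr.
have qinf : infinite_set (torus_zeros ('X - 1%:P%:P : P)).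
  move=> fin.
  have /avoid_finite[y /not_orP[/eqP y0 yn]] :
    finite_set ([set 0] `|` snd @` torus_zeros ('X - 1%:P%:P : P)).
    by rewrite finite_setU; split; [exact: finite_set1|exact: finite_image].
  by apply: yn; exists (1, y) => //; apply: t1.
exists (fun i => match i with 0%N => [set (1, 1)] | 1%N => torus_zeros ('X - 1%:P%:P)
   | _ => @torus2 F end); split=> i.
  case: i => [|[|i]] _; split => //.
  - by apply: irreducible1; split; exact: oner_neq0.
  - by move=> _ ->; split; exact: oner_neq0.
  - exact: curve_irreducible.
  - by move=> z [].
  - exact: torus_irreducible.
case: i => [|[|//]] _; split.
- by move=> _ ->; apply/t1/oner_neq0.
- by move=> H; apply: qinf; apply: sub_finite_set H _; exact: finite_set1.
- by move=> z [].
- have /avoid_finite[x /not_orP[/eqP x0 /eqP x1]] : finite_set ([set (0 : F)] `|` [set 1]).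
    by rewrite finite_setU; split; exact: finite_set1.
  move=> /(_ (x, 1)); case; first by split => //=; exact: oner_neq0.
  by move=> _; rewrite /ev /= !hornerE => /eqP; rewrite subr_eq0 (negbTE x1).
Qed.

(** The closure is the whole torus, which is irreducible and of dimension greater than one, so it is
    its own only component. *)
Lemma one_dim_part_dense E h : E `<=` @torus2 F -> h != 0 ->
  (forall z, torus2 z -> ev h z != 0 -> E z) ->
  one_dim_part (zariski_closure E) = set0.
Proof.
move=> ET h0 hE.
have ZE : zariski_closure E = @torus2 F.
  apply/seteqP; split=> [z []//|z tz]; split=> // f fE.
  apply: contrapT => /eqP fz.
  have f0 : f != 0 by apply: contraNneq fz => ->; rewrite !horner0.
  have [v tv] := torus_nonzero (mulf_neq0 f0 h0).
  by rewrite evM mulf_eq0 negb_or => /andP[/eqP fv hv]; apply/fv/fE/hE.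
rewrite ZE -subset0 => z [C [[[Cc C0 Ci] CT Cmax] [_ nch]] _].
have CE := Cmax _ torus_irreducible CT (fun _ => id).
by apply: nch; rewrite -CE; exact: torus_chain2.
Qed.

(** The closure lies between the zeros of [A] and the same set with the finite set [B] of
    exceptional points added. A component inside [B] has dimension zero, and each point on [A] lies
    on an irreducible factor of [A], which is a component of dimension one. *)
Lemma one_dim_part_curve E A : E `<=` @torus2 F -> A != 0 -> sqfree A ->
  finite_set [set z | torus2 z /\ ~ (E z <-> ev A z = 0)] ->
  one_dim_part (zariski_closure E) = torus_zeros A.
Proof.
move=> ET A0 sqA; set B := [set z | _] => fB.
(* Even the zeros of [A] missing from [E] are limits: a polynomial vanishing on [E] vanishes at
   almost all zeros of [A], hence lies in the Laurent ideal of [A]. *)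
have AZ : torus_zeros A `<=` zariski_closure E.
  move=> z [tz Az]; split=> // f fE.
  have [|i [j [s sE]]] := @sqfree_laurent_ideal _ A f B A0 sqA fB.
    move=> w [tw Aw] nB; apply: fE; apply: contrapT => nE; apply: nB; split => //.
    by case=> _ /(_ Aw).
  have /eqP := congr1 (fun p => ev p z) sE; rewrite !evM Az mulr0 !mulf_eq0.
  have exn n (p : P) : ev (p ^+ n) z = ev p z ^+ n.
    by elim: n => [|n IH]; rewrite ?exprS ?evM ?IH // !expr0 /ev !hornerC.
  rewrite exn evX polyC_exp exn evY !expf_eq0; case: tz => /negbTE -> /negbTE ->.
  by rewrite !andbF => /eqP.
have BT : B `<=` @torus2 F by move=> z [].
have ZA : zariski_closure E `<=` torus_zeros A `|` B.
  apply: zclosure_min; last first.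
    by apply: zclosedU; [exact: zclosed_zeros|exact: zclosed_finite].
  move=> z Ez; case: (pselect (ev A z = 0)) => Az; [left|right].
    by split => //; exact: ET.
  by split; [exact: ET|case=> /(_ Ez)].
apply/seteqP; split=> z.
  case=> C [[[Cc C0 Ci] CZ _] [ch _]] Cz.
  have [|||CA|CB] := Ci (torus_zeros A) B; [exact: zclosed_zeros|exact: zclosed_finite| | |].
  - exact: subset_trans CZ ZA.
  - exact: CA.
  - by case: (finite_no_chain (sub_finite_set CB fB)).
case=> tz Az.
have [q [A1 [qirr AE qz]]] : exists q A1, [/\ irreducible2 q, A = q * A1 & ev q z = 0].
  have [n] := ubnP (degree_sum A); elim: n (A) A0 Az => // n IH f f0 fz lt.
  have [mf|mf] := posnP (degree_sum f).
    have [u u0 fE] := degree_sum_eq0 f0 mf.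
    by move: fz; rewrite fE evC => u00; rewrite u00 eqxx in u0.
  have [q [h [qirr fE]]] := irreducible2_factor f0 mf.
  have [q0 mq _] := qirr.
  have h0 : h != 0 by apply: contraNneq f0 => e; rewrite fE e mulr0.
  move/eqP: (fz); rewrite {1}fE evM mulf_eq0 => /orP[/eqP qz|/eqP hz].
    by exists q, h.
  have [|q' [h' [irreducible2' hE qz]]] := IH h h0 hz.
    by move: lt; rewrite fE degree_sumM //; lia.
  by exists q', (q * h'); split => //; rewrite fE hE mulrCA.
have qinf : infinite_set (torus_zeros q).
  have [//|[u u0 qE]] := irreducible2_infinite_or_monomial qirr.
  by case: tz => z1 z2; move: qz; case: qE => ->; rewrite evM evC ?evX ?evY => /eqP;
    rewrite mulf_eq0 (negbTE u0) ?(negbTE z1) ?(negbTE z2).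
exists (torus_zeros q) => //; split; last exact: curve_dim1.
split; first exact: curve_irreducible.
  by move=> w [tw qw]; apply: AZ; split=> //; rewrite AE evM qw mul0r.
move=> D irrD qD DZ; have [Dc D0 Di] := irrD.
(* Maximality of the curve [q]. An irreducible [D] containing it and not contained in it would lie
   in the zeros of the cofactor [A1] and finitely many points; then [q] would divide [A1], and [A]
   would contain the square of [q]. *)
have [|||Dq|DW] := Di (torus_zeros q) (torus_zeros A1 `|` B); [exact: zclosed_zeros| | | |].
- by apply: zclosedU; [exact: zclosed_zeros|exact: zclosed_finite].
- move=> w /DZ/ZA[[tw]|]; last by right; right.
  rewrite AE evM => /eqP; rewrite mulf_eq0 => /orP[]/eqP; first by left.
  by right; left.
- by apply/seteqP; split.
- exfalso; have qA1 : torus_zeros q `<=` torus_zeros A1.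
    apply: (curve_sub_closed qirr qinf (zclosed_zeros _) fB).
    exact: subset_trans qD DW.
  have [|k A1E] := dvd_of_vanish (f := A1) qirr qinf (@finite_set0 _).
    by move=> w /qA1[].
  have := sqA q k _ z tz; rewrite qz eqxx => H.
  by have := H ltac:(by rewrite AE A1E mulrCA expr2 mulrC).
Qed.

End Zariski.

(** * Homotopies of paths *)

Section Paths.
Variables (R : realType) (X : topologicalType).
Local Notation I := (@unit_itv R).
Local Notation I2 := (@unit_square R).

Definition ispath (a b : X) (f : R -> X) : Prop :=
  [/\ {within I, continuous f}, f 0 = a & f 1 = b].

Definition phom (f g : R -> X) : Prop :=
  exists H : R * R -> X,
    [/\ {within I2, continuous H},
        forall t, I t -> H (0, t) = f t /\ H (1, t) = g t &
        forall s, I s -> H (s, 0) = f 0 /\ H (s, 1) = f 1].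

Lemma phom_reparam (f : R -> X) (phi psi : R -> R) (g h : R -> X) :
  {within I, continuous f} ->
  continuous phi -> continuous psi ->
  (forall t, I t -> I (phi t)) -> (forall t, I t -> I (psi t)) ->
  phi 0 = psi 0 -> phi 1 = psi 1 ->
  (forall t, I t -> g t = f (phi t)) -> (forall t, I t -> h t = f (psi t)) ->
  phom g h.
Proof.
move=> cf cphi cpsi Iphi Ipsi e0 e1 gE hE.
pose F (z : R * R) := phi z.2 + z.1 * (psi z.2 - phi z.2).
have IF z : I2 z -> I (F z).
  case: z => s t [/= /andP[s0 s1] It]; have := Iphi _ It; have := Ipsi _ It.
  by rewrite /F /unit_itv /= => /andP[? ?] /andP[? ?]; apply/andP; split; nra.
have c1 : continuous (fun z : R * R => phi z.2).
  by move=> z; apply: continuous_comp; [exact: cont_snd | exact: cphi].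
have c2 : continuous (fun z : R * R => psi z.2).
  by move=> z; apply: continuous_comp; [exact: cont_snd | exact: cpsi].
have cF : continuous F.
  move=> z; apply: (@cvgD _ R^o); first exact: c1.
  apply: cvgM; first exact: cont_fst.
  by apply: (@cvgB _ R^o); [exact: c2 | exact: c1].
exists (f \o F); split.
- by apply: within_comp cf IF; apply: continuous_subspaceT.
- move=> t It /=; rewrite gE // hE //; split; congr f; rewrite /F /=; lra.
- move=> s Is /=; rewrite /F /= e0 e1 !subrr !mulr0 !addr0 !gE ?e0 ?e1 //.
    exact: unit_itv1.
  exact: unit_itv0.
Qed.

Lemma phom_ends f g : phom f g -> g 0 = f 0 /\ g 1 = f 1.
Proof.
case=> H [_ H01 Hx].
have [_ <-] := H01 0 (unit_itv0 _); have [_ <-] := H01 1 (unit_itv1 _).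
by have [] := Hx 1 (unit_itv1 _).
Qed.

Lemma phom_refl f : {within I, continuous f} -> phom f f.
Proof. by move=> cf; apply: (phom_reparam (phi := id) (psi := id) cf) => //; exact: cont_id. Qed.

Lemma phom_sym f g : phom f g -> phom g f.
Proof.
move=> fg; have [e0 e1] := phom_ends fg; case: fg => H [cH H01 Hx].
pose F (z : R * R) := (1 - z.1, z.2).
have I1 s : I s -> I (1 - s).
  by rewrite /unit_itv /= => /andP[? ?]; apply/andP; split; lra.
have SF z : I2 z -> I2 (F z).
  by case: z => s t [/= Is It]; split => //=; apply: I1.
have cF : continuous F.
  apply: cont_pair (@cont_snd R) => z.
  by apply: (@cvgB _ R^o); [exact: cvg_cst | exact: cont_fst].
exists (H \o F); split.
- by apply: within_comp cH SF; apply: continuous_subspaceT.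
- by move=> t It; rewrite /F /= subr0 subrr; case: (H01 t It).
- by move=> s Is; rewrite /F /= e0 e1; apply: Hx; apply: I1.
Qed.

(** One pasting lemma for both compositions of homotopies: [p] is the first coordinate for
    transitivity and the second for concatenation. *)
Lemma phom_glue (H K L : R * R -> X) (p : R * R -> R) (P Q : R * R -> R * R) :
  {within I2, continuous H} -> {within I2, continuous K} ->
  continuous p -> continuous P -> continuous Q ->
  (forall z, I2 z -> p z <= 2^-1 -> I2 (P z)) ->
  (forall z, I2 z -> 2^-1 <= p z -> I2 (Q z)) ->
  (forall z, I2 z -> p z = 2^-1 -> H (P z) = K (Q z)) ->
  (forall z, L z = if p z <= 2^-1 then H (P z) else K (Q z)) ->
  {within I2, continuous L}.
Proof.
move=> cH cK cp cP cQ SP SQ E LE.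
have csq := @closed_unit_square R.
apply: (@within_paste _ _ (I2 `&` [set z | p z <= 2^-1])
   (I2 `&` [set z | 2^-1 <= p z]) _ (H \o P) (K \o Q)).
- apply: closedI => //; apply: closed_le_fun => // ?; exact: cvg_cst.
- apply: closedI => //; apply: closed_le_fun => // ?; exact: cvg_cst.
- rewrite -setIUr; apply/seteqP; split => z; last by case.
  move=> Sz; split => //=; case: (lerP (p z) 2^-1) => h1; first by left.
  by right; apply: ltW.
- apply: within_comp cH _; first exact: continuous_subspaceT.
  by move=> z [? ?]; exact: SP.
- apply: within_comp cK _; first exact: continuous_subspaceT.
  by move=> z [? ?]; exact: SQ.
- by move=> z [_ /= h1]; rewrite LE h1.
- move=> z [Iz /= h1]; rewrite LE; case: ifP => // h2.
  by rewrite E //; apply/eqP; rewrite eq_le h1 h2.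
Qed.

Lemma phom_trans f g h : phom f g -> phom g h -> phom f h.
Proof.
move=> fg; have [e0 e1] := phom_ends fg; case: fg => H [cH H01 Hx] [K [cK K01 Kx]].
pose P (z : R * R) := (2 * z.1 + 0, z.2).
pose Q (z : R * R) := (2 * z.1 + -1, z.2).
have SP z : I2 z -> z.1 <= 2^-1 -> I2 (P z).
  rewrite /P /unit_square /unit_itv; case: z => s t /= [/andP[? ?] It] ?.
  by split => //=; apply/andP; split; lra.
have SQ z : I2 z -> 2^-1 <= z.1 -> I2 (Q z).
  rewrite /Q /unit_square /unit_itv; case: z => s t /= [/andP[? ?] It] ?.
  by split => //=; apply/andP; split; lra.
exists (fun z => if z.1 <= 2^-1 then H (P z) else K (Q z)); split.
- apply: (phom_glue cH cK (@cont_fst R) _ _ SP SQ) => //.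
  + by apply: cont_pair (@cont_snd R); apply: cont_affine; exact: cont_fst.
  + by apply: cont_pair (@cont_snd R); apply: cont_affine; exact: cont_fst.
  + move=> -[s t] [_ /= It] /= ->; rewrite /P /Q /= divff ?pnatr_eq0 // addr0 subrr.
    by case: (K01 t It) => -> _; case: (H01 t It) => _ ->.
- move=> t It /=; rewrite /P /Q /= invr_ge0 ler0n mulr0 addr0 mulr1.
  have -> : (1 <= 2^-1 :> R) = false by apply/negbTE; rewrite -ltNge; lra.
  have -> : 2 + -1 = 1 :> R by lra.
  by split; [case: (H01 t It) | case: (K01 t It)].
- move=> s Is /=; case: ifP => h1.
    suff /Hx : I (2 * s + 0) by [].
    by have [] := SP (s, 0) (conj Is (unit_itv0 _)) h1.
  suff /Kx : I (2 * s + -1) by rewrite e0 e1.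
  have h2 : 2^-1 <= s by rewrite ltW // ltNge h1.
  by have [] := SQ (s, 0) (conj Is (unit_itv0 _)) h2.
Qed.

Lemma concat_fun0 (f g : R -> X) : concat_fun f g 0 = f 0.
Proof. by rewrite /concat_fun invr_ge0 ler0n mulr0 addr0. Qed.

Lemma concat_fun1 (f g : R -> X) : concat_fun f g 1 = g 1.
Proof.
rewrite /concat_fun.
have -> : (1 <= 2^-1 :> R) = false by apply/negbTE; rewrite -ltNge; lra.
by congr g; lra.
Qed.

Lemma phom_concat f f' g g' : phom f f' -> phom g g' -> f 1 = g 0 ->
  phom (concat_fun f g) (concat_fun f' g').
Proof.
case=> H [cH H01 Hx] [K [cK K01 Kx]] fg.
pose P (z : R * R) := (z.1, 2 * z.2 + 0).
pose Q (z : R * R) := (z.1, 2 * z.2 + -1).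
have SP z : I2 z -> z.2 <= 2^-1 -> I2 (P z).
  rewrite /P /unit_square /unit_itv; case: z => s t /= [Is /andP[? ?]] ?.
  by split => //=; apply/andP; split; lra.
have SQ z : I2 z -> 2^-1 <= z.2 -> I2 (Q z).
  rewrite /Q /unit_square /unit_itv; case: z => s t /= [Is /andP[? ?]] ?.
  by split => //=; apply/andP; split; lra.
exists (fun z => if z.2 <= 2^-1 then H (P z) else K (Q z)); split.
- apply: (phom_glue cH cK (@cont_snd R) _ _ SP SQ) => //.
  + by apply: (cont_pair (@cont_fst R)); apply: cont_affine; exact: cont_snd.
  + by apply: (cont_pair (@cont_fst R)); apply: cont_affine; exact: cont_snd.
  + move=> -[s t] [/= Is _] /= ->; rewrite /P /Q /= divff ?pnatr_eq0 // addr0 subrr.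
    by case: (Kx s Is) => -> _; case: (Hx s Is) => _ ->.
- move=> t It; rewrite /concat_fun /P /Q /=; case: ifP => h1.
    suff /H01 [-> ->] : I (2 * t + 0) by [].
    by have [] := SP (0, t) (conj (unit_itv0 _) It) h1.
  suff /K01 [-> ->] : I (2 * t + -1) by [].
  have h2 : 2^-1 <= t by rewrite ltW // ltNge h1.
  by have [] := SQ (0, t) (conj (unit_itv0 _) It) h2.
- move=> s Is; rewrite concat_fun0 concat_fun1 /P /Q /= invr_ge0 ler0n mulr0 addr0 mulr1.
  have -> : (1 <= 2^-1 :> R) = false by apply/negbTE; rewrite -ltNge; lra.
  have -> : 2 + -1 = 1 :> R by lra.
  split; first by case: (Hx s Is).
  have [_ <-] := Kx 0 (unit_itv0 _); have [_ ->] := Kx s Is.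
  by have [] := Kx 0 (unit_itv0 _).
Qed.

Lemma concat_path a b c f g : ispath a b f -> ispath b c g ->
  ispath a c (concat_fun f g).
Proof.
case=> cf f0 f1 [cg g0 g1]; split; rewrite ?concat_fun0 ?concat_fun1 //.
have cI := @closed_unit_itv R.
apply: (@within_paste _ _ (I `&` [set z | z <= 2^-1]) (I `&` [set z | 2^-1 <= z]) _
   (f \o (fun t => 2 * t + 0)) (g \o (fun t => 2 * t + -1))).
- by apply: closedI; [exact: closed_unit_itv | exact: closed_le].
- by apply: closedI; [exact: closed_unit_itv | exact: closed_ge].
- rewrite -setIUr; apply/seteqP; split => z; last by case.
  move=> Sz; split => //=; case: (lerP z 2^-1) => h1; first by left.
  by right; apply: ltW.
- apply: (within_comp _ cf).
    by apply: continuous_subspaceT; apply: cont_affine; exact: cont_id.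
  rewrite /unit_itv => t /= [/andP[? ?] ?]; apply/andP; split; lra.
- apply: (within_comp _ cg).
    by apply: continuous_subspaceT; apply: cont_affine; exact: cont_id.
  rewrite /unit_itv => t /= [/andP[? ?] ?]; apply/andP; split; lra.
- by move=> t [_ /= h1]; rewrite /concat_fun h1.
- move=> t [It /= h1]; rewrite /concat_fun; case: ifP => // h2.
  have -> : t = 2^-1 by apply/eqP; rewrite eq_le h1 h2.
  by rewrite divff ?pnatr_eq0 // addr0 subrr f1 g0.
Qed.

Definition path_rev (f : R -> X) (t : R) : X := f (-1 * t + 1).

Lemma path_rev_path a b f : ispath a b f -> ispath b a (path_rev f).
Proof.
case=> cf f0 f1; split; last 2 first.
- by rewrite /path_rev mulr0 add0r.
- by rewrite /path_rev mulr1 addNr.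
apply: (@within_comp _ _ _ I I (fun t => -1 * t + 1) f) => //.
- by apply: continuous_subspaceT; apply: cont_affine; exact: cont_id.
- by move=> t; rewrite /unit_itv /= => /andP[? ?]; apply/andP; split; lra.
Qed.

Lemma cst_path a : ispath a a (fun=> a).
Proof. by split=> //; apply: continuous_subspaceT => t; exact: cvg_cst. Qed.

Lemma phom_concatA a b c d f g h : ispath a b f -> ispath b c g -> ispath c d h ->
  phom (concat_fun f (concat_fun g h)) (concat_fun (concat_fun f g) h).
Proof.
move=> pf pg ph.
(* The reparametrisation with slopes 2, 1, 1/2 and breaks at 1/4 and 1/2 is concave, so it is a
   minimum of affine maps and its continuity needs no pasting. *)
pose phi (t : R) := Num.min (2 * t + 0) (Num.min (1 * t + 4^-1) (2^-1 * t + 2^-1)).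
have [cfgh _ _] := concat_path pf (concat_path pg ph).
apply: (phom_reparam (phi := id) (psi := phi) cfgh) => //.
- exact: cont_id.
- by apply: cont_min; [|apply: cont_min]; apply: cont_affine; exact: cont_id.
- rewrite /unit_itv /phi /= => t /andP[? ?]; rewrite !le_min !ge_min.
  apply/andP; split; [apply/and3P; split; lra|].
  by apply/orP; right; apply/orP; right; lra.
- rewrite /phi; case: (lerP (1 * 0 + 4^-1) (2^-1 * 0 + 2^-1)) => ?;
  case: lerP => ?; lra.
- rewrite /phi; case: (lerP (1 * 1 + 4^-1) (2^-1 * 1 + 2^-1)) => ?;
  case: lerP => ?; lra.
move=> t; rewrite /unit_itv /= => /andP[t0 t1].
have E : [\/ (t <= 4^-1) /\ phi t = 2 * t,
   (4^-1 < t <= 2^-1) /\ phi t = t + 4^-1 |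
   (2^-1 < t) /\ phi t = 2^-1 * t + 2^-1].
  rewrite /phi; case: (lerP t 4^-1) => h4.
    apply: Or31; split => //.
    by case: (lerP (1 * t + 4^-1) (2^-1 * t + 2^-1)) => ?; case: lerP => ?; lra.
  case: (lerP t 2^-1) => h2.
    apply: Or32; split => //.
    by case: (lerP (1 * t + 4^-1) (2^-1 * t + 2^-1)) => ?; case: lerP => ?; lra.
  apply: Or33; split => //.
  by case: (lerP (1 * t + 4^-1) (2^-1 * t + 2^-1)) => ?; case: lerP => ?; lra.
rewrite /concat_fun; case: E => -[ht ->].
- have -> : t <= 2^-1 by lra.
  have -> : 2 * t + 0 <= 2^-1 by lra.
  have -> : 2 * t <= 2^-1 by lra.
  by congr (f _); lra.
- have /andP[h1 h2] := ht; rewrite h2.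
  have -> : (2 * t + 0 <= 2^-1) = false by apply/negbTE; rewrite -ltNge; lra.
  have -> : (t + 4^-1 <= 2^-1) = false by apply/negbTE; rewrite -ltNge; lra.
  have -> : 2 * (t + 4^-1) + -1 <= 2^-1 by lra.
  by congr (g _); lra.
- have -> : (t <= 2^-1) = false by apply/negbTE; rewrite -ltNge; lra.
  have -> : (2^-1 * t + 2^-1 <= 2^-1) = false by apply/negbTE; rewrite -ltNge; lra.
  have -> : (2 * (2^-1 * t + 2^-1) + -1 <= 2^-1) = false
    by apply/negbTE; rewrite -ltNge; lra.
  by congr (h _); lra.
Qed.

Lemma phom_cst_concat a b f : ispath a b f -> phom (concat_fun (fun=> a) f) f.
Proof.
case=> cf f0 f1; pose phi (t : R) := Num.max (0 * t + 0) (2 * t + -1).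
apply: (phom_reparam (phi := phi) (psi := id) cf) => //.
- by apply: cont_max; apply: cont_affine; exact: cont_id.
- exact: cont_id.
- rewrite /unit_itv /phi /= => t /andP[? ?]; rewrite le_max ge_max.
  by apply/andP; split; [apply/orP; left; lra | apply/andP; split; lra].
- by rewrite /phi; case: lerP => ?; lra.
- by rewrite /phi; case: lerP => ?; lra.
move=> t; rewrite /unit_itv /= => /andP[t0 t1]; rewrite /concat_fun /phi.
case: (lerP t 2^-1) => h; case: lerP => h' //=; rewrite -?f0; congr f; lra.
Qed.

Lemma phom_revr a b f : ispath a b f -> phom (concat_fun f (path_rev f)) (fun=> a).
Proof.
case=> cf f0 f1; pose phi (t : R) := Num.min (2 * t + 0) (- 2 * t + 2).
apply: (phom_reparam (phi := phi) (psi := fun=> 0) cf) => //.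
- by apply: cont_min; apply: cont_affine; exact: cont_id.
- by move=> t; exact: cvg_cst.
- rewrite /unit_itv /phi /= => t /andP[? ?]; rewrite le_min ge_min.
  apply/andP; split; first by apply/andP; split; lra.
  by apply/orP; case: (lerP t 2^-1) => ?; [left | right]; lra.
- by move=> t _; exact: unit_itv0.
- by rewrite /phi; case: lerP => ?; lra.
- by rewrite /phi; case: lerP => ?; lra.
- move=> t; rewrite /unit_itv /= => /andP[t0 t1]; rewrite /concat_fun /phi /path_rev.
  by case: (lerP t 2^-1) => h; case: lerP => h'; congr (f _); lra.
Qed.

Lemma path_revK f : path_rev (path_rev f) = f.
Proof. by apply/funext => t; rewrite /path_rev; congr f; lra. Qed.

Lemma phom_revl a b f : ispath a b f -> phom (concat_fun (path_rev f) f) (fun=> b).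
Proof. by move/path_rev_path/phom_revr; rewrite path_revK. Qed.

Definition subpath (f : R -> X) (s t : R) (u : R) : X := f ((t - s) * u + s).

Lemma itv_affine (s t u : R) : I s -> I t -> I u -> I ((t - s) * u + s).
Proof. by rewrite /unit_itv /= => /andP[? ?] /andP[? ?] /andP[? ?]; apply/andP; split; nra. Qed.

Lemma subpath_path a b f s t : ispath a b f -> I s -> I t ->
  ispath (f s) (f t) (subpath f s t).
Proof.
case=> cf _ _ Is It; split; last 2 first.
- by rewrite /subpath mulr0 add0r.
- by rewrite /subpath mulr1 subrK.
apply: (@within_comp _ _ _ I I (fun u => (t - s) * u + s) f) => //.
- by apply: continuous_subspaceT; apply: cont_affine; exact: cont_id.
- by move=> u; exact: itv_affine.
Qed.

Lemma phom_subpath a b f r s t : ispath a b f -> I r -> I s -> I t ->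
  phom (concat_fun (subpath f r s) (subpath f s t)) (subpath f r t).
Proof.
case=> cf _ _ Ir Is It.
pose psi u := (t - r) * u + r.
(* The parameter runs from [r] to [s] in the first half and from [s] to [t] in the second, written
   as a sum of two clamped maps so that continuity is immediate; this also covers parameters in
   decreasing order. *)
pose phi u := ((s - r) * Num.min (2 * u + 0) (0 * u + 1) + r)
              + ((t - s) * Num.max (0 * u + 0) (2 * u + -1) + 0).
have phiE u : I u -> phi u = if u <= 2^-1 then (s - r) * (2 * u + 0) + r
     else (t - s) * (2 * u + -1) + s.
  rewrite /unit_itv /= => /andP[u0 u1]; rewrite /phi.
  by case: (lerP u 2^-1) => h; case: lerP => h1; case: lerP => h2; try lra;
   (have -> : 2 * u = 1 by lra); lra.
have half u : I u -> u <= 2^-1 -> I (2 * u + 0).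
  by rewrite /unit_itv /= => /andP[? ?] ?; apply/andP; split; lra.
have half2 u : I u -> 2^-1 < u -> I (2 * u + -1).
  by rewrite /unit_itv /= => /andP[? ?] ?; apply/andP; split; lra.
apply: (phom_reparam (phi := phi) (psi := psi) cf).
- have c1 : continuous (fun u : R => (s - r) * Num.min (2 * u + 0) (0 * u + 1) + r).
    by apply: cont_affine; apply: cont_min; apply: cont_affine; exact: cont_id.
  have c2 : continuous (fun u : R => (t - s) * Num.max (0 * u + 0) (2 * u + -1) + 0).
    by apply: cont_affine; apply: cont_max; apply: cont_affine; exact: cont_id.
  by move=> u; apply: (@cvgD _ R^o); [exact: c1|exact: c2].
- by apply: cont_affine; exact: cont_id.
- move=> u Iu; rewrite phiE //; case: lerP => h; apply: itv_affine => //.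
    exact: half.
  exact: half2.
- by move=> u Iu; exact: itv_affine.
- by rewrite phiE ?/psi; [case: lerP => h; lra|exact: unit_itv0].
- by rewrite phiE ?/psi; [case: lerP => h; lra|exact: unit_itv1].
- move=> u Iu; rewrite phiE // /concat_fun /subpath.
  by case: ifP => _.
- by [].
Qed.

End Paths.

(** * Covers of compact manifolds *)

Section GoodCover.
Variables (R : realType) (X : topologicalType).
Local Notation I := (@unit_itv R).
Local Notation I2 := (@unit_square R).

Definition path_in (V : set X) (a b : X) (f : R -> X) : Prop :=
  ispath a b f /\ forall t, I t -> V (f t).

Definition path_connected (V : set X) : Prop :=
  forall a b, V a -> V b -> exists f, path_in V a b f.

(* The homotopies run in X, not in V. *)
Definition rel_simply_connected (V : set X) : Prop :=
  forall a b f g, path_in V a b f -> path_in V a b g -> phom f g.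

Lemma ball_convex n (c a b : 'rV[R]_n.+1) (e s : R) : 0 <= s <= 1 ->
  `|c - a| < e -> `|c - b| < e -> `|c - (a + s *: (b - a))| < e.
Proof.
move=> /andP[s0 s1] ca cb.
have -> : c - (a + s *: (b - a)) = (1 - s) *: (c - a) + s *: (c - b).
  rewrite !scalerBl !scalerBr !scale1r; apply/matrixP => i j; rewrite !mxE; lra.
apply: le_lt_trans (ler_normD _ _) _; rewrite !normrZ !ger0_norm ?subr_ge0 //.
have [->|s_neq] := eqVneq s 0; first by rewrite subr0 mul1r mul0r addr0.
have sp : 0 < s by rewrite lt_neqAle eq_sym s_neq.
have h1 : (1 - s) * `|c - a| <= (1 - s) * e by rewrite ler_wpM2l ?subr_ge0 // ltW.
have h2 : s * `|c - b| < s * e by rewrite ltr_pM2l.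
lra.
Qed.

Lemma half_space_convex n (a b : 'rV[R]_n) (s : R) : 0 <= s <= 1 ->
  @half_space R n a -> @half_space R n b -> @half_space R n (a + s *: (b - a)).
Proof.
move=> /andP[s0 s1] Ha Hb i i0; rewrite !mxE.
have := Ha i i0; have := Hb i i0; nra.
Qed.

Lemma segment_homotopy_cont n (a b : R -> 'rV[R]_n.+1) :
  {within I, continuous a} -> {within I, continuous b} ->
  {within I2, continuous (fun z : R * R => a z.2 + z.1 *: (b z.2 - a z.2))}.
Proof.
move=> ca cb.
have csnd : {within I2, continuous (snd : R * R -> R)}.
  by apply: continuous_subspaceT; exact: cont_snd.
have c2 (f : R -> 'rV[R]_n.+1) : {within I, continuous f} ->
    {within I2, continuous (fun z : R * R => f z.2)}.
  by move=> cf; apply: (within_comp csnd cf) => z [].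
apply/subspace_continuousP => z Iz.
have /subspace_continuousP/(_ z Iz) ha := c2 a ca.
have /subspace_continuousP/(_ z Iz) hb := c2 b cb.
have hs : (fst : R * R -> R) @ within I2 (nbhs z) --> z.1.
  have /subspace_continuousP := continuous_subspaceT (A := I2) (@cont_fst R).
  exact.
by apply: cvgD => //; apply: cvgZ => //; apply: cvgB.
Qed.

(** The neighbourhood is the preimage of a small ball under a chart. A ball meets the half space in
    a convex set, so straight segments and straight-line homotopies can be pulled back by the
    inverse chart, at boundary points as well. *)
Lemma locally_half_euclidean_basis n y (N : set X) :
  locally_half_euclidean R n.+1 [set: X] -> nbhs y N ->
  exists V : set X, [/\ open V, V y, V `<=` N, path_connected V &
    rel_simply_connected V].
Proof.
move=> lhe nN; have [U [f [Uy [oU [V [g [oV [cf cg fV gU]]]]]]]] := lhe y Logic.I.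
have UI x : U x -> ([set: X] `&` U) x by [].
have [fy0 gfy] := fV y (UI y Uy); have [hfy Vfy] := fy0.
have : within (@half_space R n.+1 `&` V) (nbhs (f y)) (g @^-1` N).
  have /subspace_continuousP/(_ _ fy0) h := cg.
  by apply: h; move: nN; rewrite -{1}gfy.
have nV : nbhs (f y) V by exact: open_nbhs_nbhs.
rewrite /within /= => nW.
have [e /= e0 eB] := (nbhs_normP _ _).1 (filterI nV nW).
pose B := [set v : 'rV[R]_n.+1 | `|f y - v| < e].
have BV v : B v -> V v by move=> /eB[].
have BN v : B v -> @half_space R n.+1 v -> N (g v).
  by move=> Bv hv; have [Vv] := eB v Bv; apply.
pose W := U `&` f @^-1` B.
have hW x : W x -> [/\ @half_space R n.+1 (f x), V (f x), B (f x) & g (f x) = x].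
  by case=> Ux Bx; have [[? ?] ?] := fV x (UI x Ux); split.
have gW v : B v -> @half_space R n.+1 v -> W (g v) /\ f (g v) = v.
  move=> Bv hv; have [[_ Ug] fg] := gU v (conj hv (BV v Bv)).
  by split=> //; split=> //=; rewrite /preimage /= fg.
have oB : open B by have -> : B = ball (f y) e; [rewrite -ball_normE|exact: ball_open].
have Wcont : {within W, continuous f}.
  by apply: continuous_subspaceW cf => x [].
exists W; split.
- rewrite openE => x [Ux Bx]; rewrite /interior.
  have /subspace_continuousP/(_ x (UI x Ux)) cfx := cf.
  have := cfx B (open_nbhs_nbhs (conj oB Bx)).
  rewrite /= /within /=; have := open_nbhs_nbhs (conj oU Ux).
  by apply: filterS2 => z Uz /(_ (UI z Uz)) Bz.
- by split => //=; rewrite /preimage /B /= subrr normr0.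
- by move=> x /hW[hx _ Bx <-]; exact: BN.
- move=> a b Wa Wb; have [ha Va Ba ga] := hW a Wa; have [hb Vb Bb gb] := hW b Wb.
  pose L (t : R) := f a + t *: (f b - f a).
  have LB t : I t -> B (L t) /\ @half_space R n.+1 (L t).
    by move=> It; split; [exact: ball_convex|exact: half_space_convex].
  exists (g \o L); split; last by move=> t /LB[? ?] /=; have [] := gW (L t).
  split; rewrite /L /= ?scale0r ?addr0 ?scale1r ?[f a + _]addrC ?subrK //.
  apply: (@within_comp _ _ _ I (@half_space R n.+1 `&` V) L g) => //.
    apply: continuous_subspaceT => t; apply: cvgD; first exact: cvg_cst.
    by apply: cvgZ; [exact: cvg_id|exact: cvg_cst].
  by move=> t /LB[? ?]; split => //; exact: BV.
- move=> a b p q [[cp p0 p1] Wp] [[cq q0 q1] Wq].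
  pose K (z : R * R) := f (p z.2) + z.1 *: (f (q z.2) - f (p z.2)).
  have KB z : I2 z -> B (K z) /\ @half_space R n.+1 (K z).
    case: z => s t [/= Is It]; have [hp _ Bp _] := hW _ (Wp t It).
    have [hq _ Bq _] := hW _ (Wq t It).
    by split; [exact: ball_convex|exact: half_space_convex].
  exists (g \o K); split.
  + apply: (@within_comp _ _ _ I2 (@half_space R n.+1 `&` V) K g) => //.
      apply: (@segment_homotopy_cont _ (f \o p) (f \o q)).
        exact: within_comp cp Wcont Wp.
      exact: within_comp cq Wcont Wq.
    by move=> z /KB[? ?]; split => //; exact: BV.
  + move=> t It; rewrite /K /= scale0r addr0 scale1r addrC subrK.
    by have [_ _ _ ->] := hW _ (Wp t It); have [_ _ _ ->] := hW _ (Wq t It).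
  + move=> s Is; rewrite /K /= p0 p1 q0 q1 !subrr !scaler0 !addr0.
    have [_ _ _ e0'] := hW _ (Wp 0 (unit_itv0 _)).
    have [_ _ _ e1'] := hW _ (Wp 1 (unit_itv1 _)).
    by move: e0' e1'; rewrite p0 p1 => -> ->.
Qed.

(* Star refinement: shrink a finite cover W to closures of O; the neighbourhood
   of z cut out by the W containing z and the complements of the closures
   missing z lies in W_i as soon as z lies in the closure of O_i. *)
Lemma good_cover n (x0 : X) : hausdorff_space X -> compact [set: X] ->
  locally_half_euclidean R n.+1 [set: X] ->
  exists (J : finType) (V : J -> set X),
    [/\ forall j, open (V j), forall j, path_connected (V j),
        forall y, exists j, V j y &
        forall j k, V j `&` V k !=set0 ->
          exists W, [/\ V j `<=` W, V k `<=` W & rel_simply_connected W]].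
Proof.
move=> hX cX lhe.
pose Xp : ptopologicalType := HB.pack (X : Type) X (isPointed.Build X x0).
have fincover (O : X -> set X) : (forall y, open (O y)) -> (forall y, O y y) ->
    exists D : {fset X}, forall y, exists2 z, z \in D & O z y.
  move=> oO Oy.
  have cXp : @compact Xp [set: X] by exact: cX.
  rewrite compact_cover in cXp.
  have [||D _ cov] := cXp X setT O.
  - by move=> i _; exact: oO.
  - by move=> y _; exists y.
  - by exists D => y; have [z zD Ozy] := cov y Logic.I; exists z.
have /choice[W HW] : forall y, exists W, [/\ open W, W y & rel_simply_connected W].
  move=> y; have [V [oV Vy _ _ sV]] := locally_half_euclidean_basis lhe (filterT : nbhs y setT).
  by exists V.
have /choice[Q HQ] : forall y, exists Q, [/\ open Q, Q y & closure Q `<=` W y].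
  move=> y; have [oW Wy _] := HW y.
  have [A nA AW] := compact_regular hX cX filterT (open_nbhs_nbhs (conj oW Wy)).
  exists A°; split; [exact: open_interior|exact: nA|].
  by apply: subset_trans AW; apply: closure_subset; exact: interior_subset.
have [D covD] := fincover Q (fun y => let: And3 a _ _ := HQ y in a)
                             (fun y => let: And3 _ b _ := HQ y in b).
pose N z := [set t | forall i, i \in D -> (W i z -> W i t) /\
               (~ closure (Q i) z -> ~ closure (Q i) t)].
have nN z : nbhs z (N z).
  have H (i : X) : nbhs z [set t | (W i z -> W i t) /\
               (~ closure (Q i) z -> ~ closure (Q i) t)].
    apply: filterI.
      have [Wz|nW] := pselect (W i z); last by apply: filterS filterT.
      have [oW _ _] := HW i; apply: filterS (open_nbhs_nbhs (conj oW Wz)).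
      by move=> t.
    have [Oz|nO] := pselect (closure (Q i) z); first by apply: filterS filterT.
    have oC : open (~` closure (Q i)) by apply: closed_openC; exact: closed_closure.
    apply: filterS (open_nbhs_nbhs (conj oC nO)).
    by move=> t.
  have := @filter_bigI X X D (fun i => [set t | (W i z -> W i t) /\
               (~ closure (Q i) z -> ~ closure (Q i) t)]) (nbhs z) (nbhs_filter z) (fun i _ => H i).
  by apply: filterS => t Ht i iD; apply: Ht.
have /choice[V HV] : forall y, exists V, [/\ open V, V y, V `<=` N y, path_connected V &
    rel_simply_connected V].
  by move=> y; exact: (locally_half_euclidean_basis lhe (nN y)).
have [D' covD'] := fincover V (fun y => let: And5 a _ _ _ _ := HV y in a)
                             (fun y => let: And5 _ b _ _ _ := HV y in b).
exists D', (fun j => V (val j)); split=> [j|j|y|j k [t [Vj Vk]]].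
- by have [] := HV (val j).
- by have [] := HV (val j).
- by have [z zD' Vzy] := covD' y; exists [` zD']%fset.
- have [i iD Oit] := covD t.
  have sub (l : D') : V (val l) t -> V (val l) `<=` W i.
    have [_ _ VN _ _] := HV (val l) => Vt.
    (* If the centre of [V (val l)] were outside the closure of [Q i], so would be all of its
       neighbourhood [N]; but [t] lies in both [V (val l)] and [Q i]. *)
    have cl : W i (val l).
      have [_ _ OW] := HQ i; apply: OW; apply: contrapT => ncl.
      have [_ /(_ ncl)] := VN t Vt i iD; apply; exact: subset_closure.
    by move=> s /VN /(_ i iD) [/(_ cl)].
  exists (W i); split; [exact: sub|exact: sub|].
  by have [] := HW i.
Qed.

(** Connectedness of the interval takes the place of a subdivision by a Lebesgue number when a path
    is cut into small pieces. *)
Lemma locally_constant_unit_itv (Q : R -> Prop) :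
  (forall t, I t -> \forall s \near t, I s -> (Q s <-> Q t)) -> Q 0 ->
  forall t, I t -> Q t.
Proof.
move=> lc Q0; pose B := I `&` [set t | Q t].
suff BI : B = I by move=> t It; have : B t by [rewrite BI]; case.
have Iseg : I = `[0, 1]%classic.
  by apply/seteqP; split => t; rewrite /unit_itv /= in_itv.
have := @segment_connected R 0 1; rewrite -Iseg; apply.
- by exists 0; split => //; exact: unit_itv0.
- exists ([set s | I s -> Q s]°); first exact: open_interior.
  apply/seteqP; split=> t [It Ht]; split => //.
    by apply: filterS (lc t It) => s /[apply] ->.
  exact: (interior_subset Ht).
- exists (~` ([set s | I s -> ~ Q s]°)).
    by apply: open_closedC; exact: open_interior.
  apply/seteqP; split=> t [It Ht]; split => //.
    by move=> /interior_subset /(_ It).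
  apply: contrapT => nQ; apply: Ht.
  by apply: filterS (lc t It) => s /[apply] ->.
Qed.

End GoodCover.

(** * Finite generation of the fundamental group *)

Definition word_prod (G : groupType) (w : seq G) : G :=
  foldr (fun a b => (a * b)%g) 1%g w.

Lemma word_prod_cat (G : groupType) (v w : seq G) :
  word_prod (v ++ w) = (word_prod v * word_prod w)%g.
Proof. by elim: v => [|a v IH] /=; rewrite ?mul1g // IH mulgA. Qed.

(** Products without inverses. This makes every element the value of a plain word, so that matrices
    for the generators need no inverse matrices. *)
Definition generated (G : groupType) (gs : seq G) (g : G) : Prop :=
  exists2 w : seq G, {subset w <= gs} & g = word_prod w.

Lemma generatedM (G : groupType) (gs : seq G) g h :
  generated gs g -> generated gs h -> generated gs (g * h)%g.
Proof.
move=> [v vs ->] [w ws ->]; exists (v ++ w); last by rewrite word_prod_cat.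
by move=> a; rewrite mem_cat => /orP[/vs|/ws].
Qed.

Lemma generated_mem (G : groupType) (gs : seq G) g : g \in gs -> generated gs g.
Proof.
move=> gin; exists [:: g]; last by rewrite /word_prod /= mulg1.
by move=> a; rewrite inE => /eqP->.
Qed.

Section FinitelyGenerated.
Variables (R : realType) (X : topologicalType) (x : X) (Tx : [set: X] x).
Local Open Scope quotient_scope.
Local Notation I := (@unit_itv R).
Local Notation G := (pi1 R Tx).

Definition path_loop (f : R -> X) (pf : ispath x x f) : loop R [set: X] x :=
  let: And3 cf f0 f1 := pf in @Loop R X [set: X] x f cf (fun _ _ => Logic.I) f0 f1.

Lemma path_loopE (f : R -> X) (pf : ispath x x f) : path_loop pf = f :> (R -> X).
Proof. by case: pf. Qed.

Lemma homotopic_phom (f g : loop R [set: X] x) : phom f g -> homotopic f g.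
Proof.
case=> H [cH H01 Hx]; exists H; split=> // s Is.
by have := Hx s Is; rewrite loop0 loop1.
Qed.

(** Total on all functions, with default 1, so that classes can be computed without carrying proofs
    that a function is a loop. *)
Definition loop_class (f : R -> X) : G :=
  if pselect (ispath x x f) is left pf then \pi_G (path_loop pf) else 1%g.

Lemma loop_classE (f : R -> X) (pf : ispath x x f) : loop_class f = \pi_G (path_loop pf).
Proof.
rewrite /loop_class; case: pselect => // pf'; apply: pi1_eq; apply: homotopic_phom.
by rewrite !path_loopE; apply: phom_refl; case: pf.
Qed.

Lemma loop_class_phom f g : ispath x x f -> ispath x x g -> phom f g -> loop_class f = loop_class g.
Proof.
move=> pf pg fg; rewrite (loop_classE pf) (loop_classE pg); apply: pi1_eq.
by apply: homotopic_phom; rewrite !path_loopE.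
Qed.

Lemma loop_path (l : loop R [set: X] x) : ispath x x l.
Proof. by split; [exact: loop_cont|exact: loop0|exact: loop1]. Qed.

Lemma loop_class_loop (l : loop R [set: X] x) : loop_class l = \pi_G l.
Proof.
rewrite (loop_classE (loop_path l)); apply: pi1_eq; apply: homotopic_phom.
by rewrite path_loopE; apply: phom_refl; exact: loop_cont.
Qed.

Lemma loop_class_concat f g : ispath x x f -> ispath x x g ->
  loop_class (concat_fun f g) = (loop_class f * loop_class g)%g.
Proof.
move=> pf pg; rewrite (loop_classE (concat_path pf pg)) (loop_classE pf) (loop_classE pg).
rewrite [RHS](pi1_mulE Tx); apply: pi1_eq; apply: homotopic_phom.
rewrite path_loopE /= !path_loopE; apply: phom_refl.
by have [] := concat_path pf pg.
Qed.

Lemma phom_concatl a b c (f f' g : R -> X) : ispath a b f -> ispath b c g -> phom f f' ->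
  phom (concat_fun f g) (concat_fun f' g).
Proof.
move=> [cf f0 f1] [cg g0 g1] ff'; apply: phom_concat => //; last by rewrite f1.
exact: phom_refl.
Qed.

Lemma phom_concatr a b c (f g g' : R -> X) : ispath a b f -> ispath b c g -> phom g g' ->
  phom (concat_fun f g) (concat_fun f g').
Proof.
move=> [cf f0 f1] [cg g0 g1] gg'; apply: phom_concat => //; last by rewrite f1.
exact: phom_refl.
Qed.

Section ConnectingPaths.
Variable q : X -> R -> X.
Hypothesis qP : forall y, ispath x y (q y).

Definition based (f : R -> X) : R -> X :=
  concat_fun (q (f 0)) (concat_fun f (path_rev (q (f 1)))).

Lemma based_path a b f : ispath a b f -> ispath x x (based f).
Proof.
move=> pf; have [_ f0 f1] := pf; rewrite /based f0 f1.
exact: concat_path (qP a) (concat_path pf (path_rev_path (qP b))).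
Qed.

Definition path_class f := loop_class (based f).

Lemma path_class_phom a b f g : ispath a b f -> ispath a b g -> phom f g -> path_class f = path_class g.
Proof.
move=> pf pg fg; apply: loop_class_phom; [exact: based_path pf|exact: based_path pg|].
have [_ f0 f1] := pf; have [_ g0 g1] := pg; rewrite /based f0 f1 g0 g1.
have pb := path_rev_path (qP b).
apply: (phom_concatr (qP a) (concat_path pf pb) _).
exact: phom_concatl pf pb fg.
Qed.

(** The connecting path to [b] is traversed backwards and then forwards, and cancels; the rest is
    reassociation. *)
Lemma path_class_concat a b c f g : ispath a b f -> ispath b c g ->
  path_class (concat_fun f g) = (path_class f * path_class g)%g.
Proof.
move=> pf pg; have pfg := concat_path pf pg.
rewrite /path_class -loop_class_concat; [|exact: based_path pf|exact: based_path pg].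
apply: loop_class_phom; first exact: based_path pfg.
  by apply: concat_path; [exact: based_path pf|exact: based_path pg].
have [_ f0 f1] := pf; have [_ g0 g1] := pg.
rewrite /based concat_fun0 concat_fun1 f0 f1 g0 g1.
set A := q a; set B := q b; set C := path_rev (q c).
have pA : ispath x a A := qP a; have pB : ispath x b B := qP b.
have pC : ispath c x C := path_rev_path (qP c).
have pB' := path_rev_path pB; have pgC := concat_path pg pC.
have pBgC := concat_path pB pgC; have pfB' := concat_path pf pB'.
apply: (phom_trans _ (phom_concatA pA pfB' pBgC)).
apply: (phom_concatr pA (concat_path pfg pC) _).
apply: (phom_trans _ (phom_concatA pf pB' pBgC)).
apply: (phom_trans (phom_sym (phom_concatA pf pg pC)) _).
apply: (phom_concatr pf pgC _).
apply: (phom_trans _ (phom_sym (phom_concatA pB' pB pgC))).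
apply: (phom_trans (phom_sym (phom_cst_concat pgC)) _).
apply: (phom_concatl (@cst_path R X b) pgC _).
exact/phom_sym/phom_revl/pB.
Qed.

Lemma path_class_eq1 a b f : ispath a b f -> phom (concat_fun (q a) f) (q b) -> path_class f = 1%g.
Proof.
move=> pf h; suff E : phom (based f) (fun=> x).
  rewrite /path_class (loop_class_phom (based_path pf) (@cst_path R X x) E).
  have pc := @cst_path R X x.
  (* The class of the constant loop is idempotent, hence 1. *)
  apply: (@mulgI _ (loop_class (fun=> x))).
  rewrite mulg1 -loop_class_concat //; apply: loop_class_phom => //; first exact: (concat_path pc pc).
  exact: phom_cst_concat pc.
have [_ f0 f1] := pf; rewrite /based f0 f1.
have pb' := path_rev_path (qP b).
apply: (phom_trans (phom_concatA (qP a) pf pb') _).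
apply: (phom_trans _ (phom_revr (qP b))).
exact: phom_concatl (concat_path (qP a) pf) pb' h.
Qed.

End ConnectingPaths.

Lemma path_in_path V a b (f : R -> X) : path_in V a b f -> ispath a b f.
Proof. by case. Qed.

Lemma path_in_sub V W a b (f : R -> X) : V `<=` W -> path_in V a b f -> path_in W a b f.
Proof. by move=> VW [pf fV]; split => // t /fV /VW. Qed.

Lemma path_in_concat V a b c (f g : R -> X) :
  path_in V a b f -> path_in V b c g -> path_in V a c (concat_fun f g).
Proof.
move=> [pf fV] [pg gV]; split; first exact: concat_path pf pg.
move=> t; rewrite /concat_fun /unit_itv /= => /andP[? ?].
case: (lerP t 2^-1) => h1; [apply: fV|apply: gV]; rewrite /unit_itv /=;
  by apply/andP; split; lra.
Qed.

Variables (J : finType) (V : J -> set X).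
Hypotheses (oV : forall j, open (V j)) (pV : forall j, path_connected R (V j)).
Hypotheses (cV : forall y, exists j, V j y).
Hypothesis sV : forall j k, V j `&` V k !=set0 ->
  exists W, [/\ V j `<=` W, V k `<=` W & rel_simply_connected R W].
Hypothesis Xconn : connected [set: X].

(** Membership in the set of reachable points does not change inside one [V j], so this set is open
    and closed. *)
Lemma reachable y : exists f, @ispath R X x y f.
Proof.
pose B := [set y | exists f, @ispath R X x y f].
suff BT : B = [set: X] by have : B y by rewrite BT.
have near j a b : V j a -> V j b -> B a -> B b.
  move=> Va Vb [f pf]; have [g [pg _]] := pV Va Vb.
  by exists (concat_fun f g); exact: concat_path pf pg.
have oB : open B.
  rewrite openE => a Ba; have [j Vja] := cV a.
  by apply: filterS (open_nbhs_nbhs (conj (oV j) Vja)) => b Vb; exact: near Vja Vb Ba.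
have cB : closed B.
  rewrite -[B]setCK; apply: open_closedC.
  rewrite openE => a nBa; have [j Vja] := cV a.
  apply: filterS (open_nbhs_nbhs (conj (oV j) Vja)) => b Vb Bb; apply: nBa.
  exact: near Vb Vja Bb.
apply: Xconn; last by exists B; rewrite ?setTI.
- by exists x, (fun=> x); exact: cst_path.
- by exists B; rewrite ?setTI.
Qed.

Lemma pi1_finitely_generated_of_cover : exists gs : seq G, forall g, generated gs g.
Proof.
have /choice[idx idxP] := cV.
have /choice[p pP] := reachable.
have /choice[c cP] : forall j : J, exists c : X, (exists y, V j y) -> V j c.
  move=> j; have [[y Vy]|n] := pselect (exists y, V j y); first by exists y.
  by exists x => /n.
have /choice[r rP] : forall y : X, exists r : R -> X, path_in (V (idx y)) (c (idx y)) y r.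
  by move=> y; apply: pV => //; apply: cP; exists y.
(* The connecting path first runs to a centre that depends only on the set chosen for [y], and then
   stays inside that set. So points with the same chosen set have connecting paths that differ only
   in their last leg. *)
pose q y := concat_fun (p (c (idx y))) (r y).
have qP y : ispath x y (q y) := concat_path (pP _) (path_in_path (rP y)).
(* The class of a path in V k only depends on k and on the sets chosen for its
   endpoints, because V k and each of them lie in a relatively simply connected
   set: finitely many classes generate. *)
have triv k a b u : idx a = idx b -> path_in (V k) a b u -> path_class q u = 1%g.
  move=> ab [pu uV]; have [_ u0 u1] := pu.
  apply: (path_class_eq1 qP pu).
  have pra := path_in_path (rP a).
  apply: (phom_trans (phom_sym (phom_concatA (pP _) pra pu)) _).
  rewrite /q -ab; apply: (phom_concatr (pP _) (concat_path pra pu) _).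
  have [|W [iW kW sW]] := sV (j := idx a) (k := k).
    by exists a; split; [exact: idxP|rewrite -u0; exact/uV/unit_itv0].
  apply: (sW (c (idx a)) b); first apply: path_in_concat.
  - exact: path_in_sub iW (rP a).
  - by apply: (path_in_sub kW _).
  - by have := path_in_sub iW (rP a); move: (rP b); rewrite -ab => /(path_in_sub iW).
have small k a b a' b' u u' : path_in (V k) a b u -> path_in (V k) a' b' u' ->
    idx a = idx a' -> idx b = idx b' -> path_class q u = path_class q u'.
  move=> pu pu' aa' bb'; have [pu0 uV] := pu; have [pu0' uV'] := pu'.
  have Va : V k a by have [_ <- _] := pu0; exact/uV/unit_itv0.
  have Vb : V k b by have [_ _ <-] := pu0; exact/uV/unit_itv1.
  have Va' : V k a' by have [_ <- _] := pu0'; exact/uV'/unit_itv0.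
  have Vb' : V k b' by have [_ _ <-] := pu0'; exact/uV'/unit_itv1.
  have [v pv] := pV Va Va'; have [w pw] := pV Vb Vb'.
  have [W [kW _ sW]] := sV (ex_intro _ a (conj Va Va) : V k `&` V k !=set0).
  (* The square with sides [u], [w], [v], [u'] lies in [V k] and is therefore filled in [X]. By
     [triv] the sides [v] and [w] have trivial class, so [u] and [u'] have the same class. *)
  have E := sW _ _ _ _ (path_in_sub kW (path_in_concat pu pw))
                       (path_in_sub kW (path_in_concat pv pu')).
  have := path_class_phom qP (path_in_path (path_in_concat pu pw))
                     (path_in_path (path_in_concat pv pu')) E.
  rewrite (path_class_concat qP pu0 (path_in_path pw)) (path_class_concat qP (path_in_path pv) pu0').
  by rewrite (triv _ _ _ _ aa' pv) (triv _ _ _ _ bb' pw) mulg1 mul1g.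
have /choice[gen genP] : forall t : J * J * J, exists g : G, forall a b u,
    idx a = t.1.2 -> idx b = t.2 -> path_in (V t.1.1) a b u -> path_class q u = g.
  move=> [[k i] j] /=.
  have [[a [b [u [ai bj pu]]]]|n] :=
      pselect (exists a b (u : R -> X), [/\ idx a = i, idx b = j & path_in (V k) a b u]).
    exists (path_class q u) => a' b' u' ai' bj' pu'; apply: (small _ _ _ _ _ _ _ pu' pu).
      by rewrite ai'.
    by rewrite bj'.
  by exists 1%g => a b u ai bj pu; case: n; exists a, b, u.
pose gs := [seq gen t | t <- enum {: J * J * J}].
have in_gs k a b u : path_in (V k) a b u -> generated gs (path_class q u).
  move=> pu; apply: generated_mem; apply/mapP.
  exists (k, idx a, idx b); first by rewrite mem_enum.
  exact: (genP (k, idx a, idx b)).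
have all_paths a b f : ispath a b f -> generated gs (path_class q f).
  move=> pf; have [cf f0 f1] := pf.
  have sub0 : subpath f 0 1 = f.
    by apply/funext => u; rewrite /subpath subr0 mul1r addr0.
  suff H : forall t, I t -> generated gs (path_class q (subpath f 0 t)).
    by rewrite -sub0; apply: H; exact: unit_itv1.
  have I0 := @unit_itv0 R.
  (* Near [t] the path stays in one [V k], so passing from the initial segment up to [t] to that up
     to [s], or back, multiplies the class by that of a path in [V k]. Both directions are needed,
     as [generated] does not allow inverses. *)
  apply: locally_constant_unit_itv => [t It|]; last first.
    have [k Vk] := cV a; apply: (in_gs k a a).
    rewrite -f0 in Vk *; split; first exact: (subpath_path pf I0 I0).
    by move=> u _; rewrite /subpath subrr mul0r add0r.
  have [k Vk] := cV (f t).
  have /subspace_continuousP/(_ t It)/(_ (V k) (open_nbhs_nbhs (conj (oV k) Vk))) := cf.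
  rewrite /= /within /= => /nbhs_ballP[e /= e0 eB].
  apply/nbhs_ballP; exists e => //= s se Is.
  have inV u v w : (u = s /\ v = t) \/ (u = t /\ v = s) -> I w -> V k (subpath f u v w).
    move=> uv Iw; have Iuv : I u /\ I v by case: uv => [[-> ->]|[-> ->]].
    apply: eB; last exact: itv_affine Iuv.1 Iuv.2 Iw.
    move: se Iw; rewrite /ball /= /unit_itv /= => se /andP[w0 w1].
    move: se; rewrite !ltr_norml => /andP[h1 h2].
    by case: uv => [[-> ->]|[-> ->]]; apply/andP; split; nra.
  have step u v : (u = s /\ v = t) \/ (u = t /\ v = s) ->
      generated gs (path_class q (subpath f 0 u)) -> generated gs (path_class q (subpath f 0 v)).
    move=> uv; have [Iu Iv] : I u /\ I v by case: uv => [[-> ->]|[-> ->]].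
    have p0u := subpath_path pf I0 Iu; have puv := subpath_path pf Iu Iv.
    rewrite -(path_class_phom qP (concat_path p0u puv) (subpath_path pf I0 Iv)
                  (phom_subpath pf I0 Iu Iv)).
    rewrite (path_class_concat qP p0u puv) => g0; apply: generatedM => //.
    apply: (in_gs k (f u) (f v)); split => // w Iw; exact: inV.
  by split; apply: step; [left|right].
(* The connecting path [q x] need not be constant, so for a loop [path_class q] is the class
   conjugated by that of [q x]. The two extra generators undo this. *)
exists (loop_class (q x) :: (loop_class (q x))^-1%g :: gs) => g.
have [l gE] := pi1_surj g; rewrite gE -loop_class_loop.
have pl := loop_path l; have [_ l0 l1] := pl.
have E : path_class q l = (loop_class (q x) * loop_class l * (loop_class (q x))^-1)%g.
  have pr := path_rev_path (qP x).
  rewrite /path_class /based l0 l1 (loop_class_concat (qP x) (concat_path pl pr)) (loop_class_concat pl pr).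
  rewrite mulgA; congr (_ * _)%g; apply: (@mulgI _ (loop_class (q x))).
  rewrite mulgV -(loop_class_concat (qP x) pr).
  have pc := @cst_path R X x.
  rewrite (loop_class_phom (concat_path (qP x) pr) pc (phom_revr (qP x))).
  apply: (@mulgI _ (loop_class (fun=> x))).
  rewrite mulg1 -loop_class_concat //; apply: loop_class_phom => //; first exact: (concat_path pc pc).
  exact: phom_cst_concat pc.
have -> : loop_class l = ((loop_class (q x))^-1 * (path_class q l * loop_class (q x)))%g.
  by rewrite E -!mulgA mulVg mulg1 mulKg.
apply: generatedM; first by apply: generated_mem; rewrite !inE eqxx orbT.
apply: generatedM; last by apply: generated_mem; rewrite !inE eqxx.
have [w ws ->] := all_paths x x l pl; exists w => // a /ws ags.
by rewrite !inE ags !orbT.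
Qed.

End FinitelyGenerated.

Lemma pi1_finitely_generated (R : realType) (X : topologicalType) n (x : X)
  (Tx : [set: X] x) : is_manifold R X n.+1 -> compact [set: X] ->
  connected [set: X] -> exists gs : seq (pi1 R Tx), forall g, generated gs g.
Proof.
move=> [hX _ lX] cX conX.
have [J [V [oV pV cV sV]]] := good_cover x hX cX lX.
exact: (pi1_finitely_generated_of_cover Tx oV pV cV sV conX).
Qed.

(** * The basis theorem and the eigenvalue map *)

Section Noetherian.

Inductive span (A : comNzRingType) (S : set A) : set A :=
  | span0 : span S 0
  | span_cons c a p : S a -> span S p -> span S (c * a + p).

Lemma span_mem (A : comNzRingType) (S : set A) a : S a -> span S a.
Proof. by move=> Sa; rewrite -[a]mul1r -[1 * a]addr0; apply: span_cons => //; exact: span0. Qed.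

Lemma spanD (A : comNzRingType) (S : set A) p q : span S p -> span S q -> span S (p + q).
Proof.
elim=> [|c a p' Sa _ IH] Sq; first by rewrite add0r.
by rewrite -addrA; apply: span_cons => //; exact: IH.
Qed.

Lemma spanM (A : comNzRingType) (S : set A) c p : span S p -> span S (c * p).
Proof.
elim=> [|d a p' Sa _ IH]; first by rewrite mulr0; exact: span0.
by rewrite mulrDr mulrA; exact: span_cons.
Qed.

Lemma span_min (A : comNzRingType) (S T : set A) : S `<=` span T -> span S `<=` span T.
Proof.
move=> ST p; elim=> [|c a p' Sa _ IH]; first exact: span0.
by apply: spanD => //; apply: spanM; exact: ST.
Qed.

Lemma span_sub (A : comNzRingType) (S T : set A) : S `<=` T -> span S `<=` span T.
Proof. by move=> ST; apply: span_min => a /ST; exact: span_mem. Qed.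

(** The sequence form of the chain condition: some term lies in the ideal of the earlier ones. It is
    what the proof of the basis theorem applies to a sequence of leading coefficients. *)
Definition noetherian (A : comNzRingType) : Prop :=
  forall a : nat -> A, exists n, span [set` mkseq a n] (a n).

Lemma mkseqP (T : eqType) (g : nat -> T) n a :
  reflect (exists2 i, (i < n)%N & a = g i) (a \in mkseq g n).
Proof.
apply: (iffP mapP) => [[i]|[i lt ->]]; last by exists i => //; rewrite mem_iota.
by rewrite mem_iota add0n => /= lt ->; exists i.
Qed.

Lemma span_mkseq_mono (A : comNzRingType) (g : nat -> A) m n : (m <= n)%N ->
  span [set` mkseq g m] `<=` span [set` mkseq g n].
Proof.
move=> mn; apply: span_sub => b /mkseqP[i lt ->]; apply/mkseqP; exists i => //.
exact: leq_trans lt mn.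
Qed.

Lemma span_finite (A : comNzRingType) (a : nat -> A) p : span (range a) p ->
  exists n, span [set` mkseq a n] p.
Proof.
elim=> [|c _ q [i _ <-] _ [n Hn]]; first by exists 0%N; exact: span0.
exists (maxn i.+1 n); apply: spanD.
  apply/spanM/span_mem/mkseqP; exists i => //; exact: leq_maxl.
by apply: span_mkseq_mono Hn; exact: leq_maxr.
Qed.

(** Dependent choice in which each term may depend on all earlier ones. *)
Lemma history_choice (T : eqType) (K : T -> Prop) (Q : seq T -> T -> Prop) :
  (forall s, (forall t, t \in s -> K t) -> exists t, K t /\ Q s t) ->
  exists g : nat -> T, forall n, K (g n) /\ Q (mkseq g n) (g n).
Proof.
move=> H.
have [t0 _] : exists t, K t /\ Q [::] t by apply: H.
have /choice[next nextP] : forall s, exists t, (forall t, t \in s -> K t) -> K t /\ Q s t.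
  move=> s; case: (pselect (forall t, t \in s -> K t)) => [/H[t Ht]|n]; first by exists t.
  by exists t0.
pose hist n := iter n (fun s => rcons s (next s)) [::].
exists (fun n => next (hist n)) => n.
have hE m : mkseq (fun n => next (hist n)) m = hist m.
  by elim: m => // m IH; rewrite mkseqS IH.
have hK m : forall t, t \in hist m -> K t.
  elim: m => [|m IH] t //=; rewrite mem_rcons inE => /predU1P[->|/IH//].
  by have [] := nextP _ IH.
by rewrite hE; exact: (nextP _ (hK n)).
Qed.

Lemma noetherian_set (A : comNzRingType) : noetherian A -> forall S : set A,
  exists2 s : seq A, {in s, forall a, S a} & S `<=` span [set` s].
Proof.
move=> nA S; apply: contrapT => H.
have [|g gP] := @history_choice A S (fun s t => ~ span [set` s] t).
  move=> s sS; apply: contrapT => H2; apply: H; exists s => // a Sa.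
  by apply: contrapT => na; apply: H2; exists a.
by have [n Hn] := nA g; have [_] := gP n.
Qed.

Lemma noetherian_int : noetherian int.
Proof.
(* The successor excludes zero: the least [k] yields a nonzero element of least absolute value, a
   generator of the ideal. It already lies in the span of finitely many terms. *)
move=> a; pose Q k := `[< exists2 d, span (range a) d & absz d = k.+1 >].
case: (pselect (exists k, Q k)) => [ex|nex]; last first.
  exists 0%N; suff -> : a 0%N = 0 by exact: span0.
  apply: contrapT => /eqP a0; apply: nex; exists (absz (a 0%N)).-1.
  apply/asboolP; exists (a 0%N); first by apply: span_mem; exists 0%N.
  by rewrite prednK // absz_gt0.
have [k /asboolP[d Id dk] kmin] := ex_minnP ex.
have d0 : d != 0 by rewrite -absz_gt0 dk.
have [n Hn] := span_finite Id; exists n.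
have [q [r [E lt]]] : exists q r, a n = q * d + r /\ (absz r < absz d)%N.
  exists (a n %/ d)%Z, (a n %% d)%Z; split; first exact: divz_eq.
  by rewrite -ltz_nat !abszE ger0_norm ?modz_ge0 // ltz_mod.
have Ir : span (range a) r.
  have -> : r = (- q) * d + a n by rewrite E mulNr addKr.
  by apply: spanD; [exact: spanM|apply: span_mem; exists n].
have r0 : r = 0.
  apply: contrapT => /eqP rn; have : (k <= (absz r).-1)%N.
    apply: kmin; apply/asboolP; exists r => //; rewrite prednK // absz_gt0 //.
  by move: lt; rewrite dk; have : (0 < absz r)%N by [rewrite absz_gt0]; lia.
by rewrite E r0 addr0; exact: spanM.
Qed.

(** Hilbert's argument: in a counterexample, elements of the ideal outside the span of the earlier
    choices are picked greedily with least size. Some leading coefficient is a combination of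
    earlier ones, and subtracting the corresponding combination of polynomials contradicts
    minimality. *)
Lemma noetherian_poly (A : comNzRingType) : noetherian A -> noetherian {poly A}.
Proof.
move=> nA f; apply: contrapT => /forallNP H; pose K := span (range f).
have [|g gP] := @history_choice {poly A} K (fun s t => ~ span [set` s] t /\
    forall p, K p -> ~ span [set` s] p -> (size t <= size p)%N).
  move=> s sK.
  have [m Hm] : exists m, [set` s] `<=` span [set` mkseq f m].
    elim: s sK => [|p s IH] sK; first by exists 0%N.
    have [|m Hm] := IH; first by move=> t ts; apply: sK; rewrite inE ts orbT.
    have [m' Hm'] := span_finite (sK p (mem_head _ _)).
    exists (maxn m m') => q /=; rewrite inE => /predU1P[->|/Hm].
      by apply: span_mkseq_mono Hm'; exact: leq_maxr.
    by apply: span_mkseq_mono; exact: leq_maxl.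
  pose Q k := `[< exists p, [/\ K p, ~ span [set` s] p & size p = k] >].
  have ex : exists k, Q k.
    exists (size (f m)); apply/asboolP; exists (f m); split=> //.
      by apply: span_mem; exists m.
    by move/(span_min Hm); exact: H.
  have [k /asboolP[p [Kp np <-]] pmin] := ex_minnP ex.
  exists p; do 2!split => //; move=> q Kq nq; apply: pmin; apply/asboolP.
  by exists q.
have smono i n : (i <= n)%N -> (size (g i) <= size (g n))%N.
  move=> le; have [_ [_ gmin]] := gP i; have [Kn [nn _]] := gP n.
  apply: gmin => // h; apply: nn; exact: span_mkseq_mono h.
have [n Hn] := nA (fun n => lead_coef (g n)).
have [Kn [nn nmin]] := gP n.
have g0 : g n != 0 by apply/eqP => g0; apply: nn; rewrite g0; exact: span0.
pose N := size (g n).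
have N0 : (0 < N)%N by rewrite size_poly_gt0.
(* The earlier [g i] are no longer than [g n], since sizes increase weakly along the greedy
   sequence, and so can be shifted up to the top degree of [g n]. *)
have [p [Sp szp pN]] : exists p, [/\ span [set` mkseq g n] p, (size p <= N)%N &
    p`_N.-1 = lead_coef (g n)].
  elim: Hn => [|c _ v /mkseqP[i lt ->] _ [p [Sp szp pN]]].
    by exists 0; rewrite coef0 size_poly0; split => //; exact: span0.
  have [/eqP gi0|gi0] := boolP (g i == 0).
    by exists p; rewrite gi0 lead_coef0 mulr0 add0r.
  have si : (0 < size (g i))%N by rewrite size_poly_gt0.
  have le := smono _ _ (ltnW lt); rewrite -/N in le.
  exists (c%:P * 'X^(N - size (g i)) * g i + p); split.
  - apply: spanD => //; apply: spanM; by apply/span_mem/mkseqP; exists i.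
  - rewrite (leq_trans (size_polyD _ _)) // geq_max szp andbT.
    rewrite -mulrA mul_polyC (leq_trans (size_scale_leq _ _)) //.
    by rewrite (leq_trans (size_polyMleq _ _)) // size_polyXn addSn subnK.
  - rewrite coefD pN -mulrA coefCM -commr_polyXn coefMXn ifF; last by lia.
    have -> : (N.-1 - (N - size (g i)) = (size (g i)).-1)%N by lia.
    by rewrite -lead_coefE.
have : (N <= size (g n - p)%R)%N.
  apply: nmin.
    rewrite -mulN1r; apply: spanD => //; apply: spanM.
    by apply: span_min Sp => b /mkseqP[i _ ->]; have [] := gP i.
  move=> h; apply: nn; rewrite -[g n](subrK p); exact: spanD.
apply/negP; rewrite -ltnNge -(ltn_predK N0) ltnS; apply/leq_sizeP => j le.
rewrite coefB; have [->|ne] := eqVneq j N.-1.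
  by rewrite pN lead_coefE subrr.
have Nj : (N <= j)%N by rewrite -(ltn_predK N0) ltn_neqAle eq_sym ne.
by rewrite !nth_default ?subrr //; exact: leq_trans szp Nj.
Qed.

End Noetherian.

(** [B] is the polynomial ring over the integers in [n] variables, of which only the basis theorem
    and the existence of evaluation maps are retained. *)
Lemma noetherian_variables n : exists (B : comNzRingType) (x : 'I_n -> B),
  noetherian B /\ forall (F : comNzRingType) (e : 'I_n -> F),
    exists phi : {rmorphism B -> F}, forall i, phi (x i) = e i.
Proof.
elim: n => [|n [B [x [nB uB]]]].
  exists int, (fun=> 0); split; first exact: noetherian_int.
  by move=> F e; exists (intr : {rmorphism int -> F}) => -[].
exists {poly B}, (fun i => if unlift ord0 i is Some k then (x k)%:P else 'X).
split=> [|F e]; first exact: noetherian_poly.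
have [phi Hphi] := uB F (fun k => e (lift ord0 k)).
exists (horner_eval (e ord0) \o map_poly phi : {rmorphism {poly B} -> F}) => i.
case: unliftP => [k ->|->] /=.
  by rewrite map_polyC /= /horner_eval hornerC.
by rewrite map_polyX /horner_eval hornerX.
Qed.

(** The ideal membership is established over the integers and then mapped to each field, so the same
    finite subset of [S] works in all characteristics. *)
Lemma finite_equations (J : finType) (S : set (term J)) :
  exists s : seq (term J), List.Forall S s /\
    forall (F : closedFieldType) (e : J -> F),
      all (fun t => teval e t == 0) s -> forall t, S t -> teval e t = 0.
Proof.
have [B [y [nB uB]]] := noetherian_variables #|J|.
pose x j := y (enum_rank j).
have [s sS sub] := noetherian_set nB ([set teval x t | t in S]).
have [ts [tS tE]] : exists ts, List.Forall S ts /\ map (teval x) ts = s.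
  elim: s sS {sub} => [|b s IH] sS; first by exists [::]; split => //; constructor.
  have [|ts [tS tE]] := IH; first by move=> a as_; apply: sS; rewrite inE as_ orbT.
  have [t St tb] := sS b (mem_head _ _).
  by exists (t :: ts); split; [constructor|rewrite /= tE tb].
exists ts; split=> // F e ts0 t St.
have [phi Hphi] := uB F (e \o enum_val).
have phiE u : phi (teval x u) = teval e u.
  rewrite teval_rmorph; congr teval; apply/funext => j.
  by rewrite /= Hphi /= enum_rankK.
have s0 a : a \in s -> phi a = 0.
  rewrite -tE; elim: (ts) ts0 => //= u us IH /andP[/eqP u0 /IH us0].
  by rewrite inE => /predU1P[->|/us0//]; rewrite phiE.
have : span [set` s] (teval x t) by apply: sub; exists t.
rewrite -phiE; elim => [|c a p as_ _ IH]; first by rewrite rmorph0.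
by rewrite rmorphD rmorphM IH (s0 a as_) mulr0 addr0.
Qed.

Lemma def_equations (J : finType) (S : set (term J)) :
  definable (fun F (e : J -> F) => forall t, S t -> teval e t = 0).
Proof.
have [s [sS H]] := finite_equations S.
have d : definable (fun F (e : J -> F) => all (fun t => teval e t == 0) s).
  elim: s {sS H} => [|t s IH]; first by apply: def_ext (def_const _ True) _.
  have pt : polyfun (fun F (e : J -> F) => teval e t) by exists t.
  apply: def_ext (def_and (def_eq0 pt) IH) _ => F e /=.
  by split=> [/andP[/eqP]|[/eqP -> ->]].
apply: def_ext d _ => F e; split=> [St|]; last exact: H.
by elim: sS => //= t s' Stt _ ->; rewrite St ?eqxx.
Qed.

(** * Representations as solutions of equations over the integers *)

Section EigenvalueMap.
Variables (G : groupType) (gs : seq G).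
Hypothesis gsP : forall g, generated gs g.
Variables (mu la : G).
Local Notation k := (size gs).
Local Notation J := ('I_k * ('I_2 * 'I_2))%type.

Let gen (i : 'I_k) : G := tnth (in_tuple gs) i.
Let value (w : seq 'I_k) : G := word_prod (map gen w).

Lemma value_surj g : exists w, value w = g.
Proof.
have [v vs ->] := gsP g; elim: v vs => [|a v IH] vs; first by exists [::].
have [|w wE] := IH; first by move=> b bv; apply: vs; rewrite inE bv orbT.
have /seq_tnthP[i ai] : a \in gs by apply: vs; exact: mem_head.
by exists (i :: w); rewrite /value /= -/(value w) wE ai.
Qed.

(** The variables [inr (i, (a, b))] are the entries of the matrix of the [i]-th generator;
    [inl true] and [inl false] are reserved for the eigenvalues [m] and [l]. *)
Fixpoint word_term (w : seq 'I_k) (a b : 'I_2) : term (bool + J) :=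
  if w is i :: w then Add (Mul (Var (inr (i, (a, 0)))) (word_term w 0 b))
                          (Mul (Var (inr (i, (a, 1)))) (word_term w 1 b))
  else Cst (a == b)%:R.

Definition gen_mx (F : comNzRingType) (f : J -> F) (i : 'I_k) : 'M[F]_2 :=
  \matrix_(a, b) f (i, (a, b)).

Definition word_mx (F : comNzRingType) (f : J -> F) (w : seq 'I_k) : 'M[F]_2 :=
  foldr (fun i A => gen_mx f i *m A) 1%:M w.

Lemma word_termE (F : comNzRingType) (e : bool -> F) (f : J -> F) w a b :
  teval (sumf e f) (word_term w a b) = word_mx f w a b.
Proof.
elim: w a b => [|i w IH] a b /=; first by rewrite mxE; case: eqP.
have l01 : lift ord0 ord0 = 1 :> 'I_2 by apply: val_inj.
by rewrite mxE big_ord_recl big_ord1 l01 !IH !mxE.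
Qed.

Lemma word_mx_cat (F : comNzRingType) (f : J -> F) v w :
  word_mx f (v ++ w) = word_mx f v *m word_mx f w.
Proof. by elim: v => [|i v IH] /=; rewrite ?mul1mx // IH mulmxA. Qed.

Definition sub_term (s t : term (bool + J)) := Add s (Mul (Cst (-1)) t).

(** The second alternative imposes all relations of the group at once, one for each pair of words
    with the same value, so no presentation has to be known. The words [wm] and [wl] stand for [mu]
    and [la]. *)
Definition rep_equations (wm wl : seq 'I_k) : set (term (bool + J)) :=
  [set t | (exists i, t = sub_term (sub_term
        (Mul (word_term [:: i] 0 0) (word_term [:: i] 1 1))
        (Mul (word_term [:: i] 0 1) (word_term [:: i] 1 0))) (Cst 1)) \/
     (exists v w a b, value v = value w /\
        t = sub_term (word_term v a b) (word_term w a b)) \/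
     (t = word_term wm 1 0 \/ t = word_term wl 1 0) \/
     (t = sub_term (word_term wm 0 0) (Var (inl true)) \/
      t = sub_term (word_term wl 0 0) (Var (inl false)))].

Lemma sub_termE (F : comNzRingType) (u : bool + J -> F) s t :
  teval u (sub_term s t) = 0 <-> teval u s = teval u t.
Proof. by rewrite /= mulrN1z mulN1r; split=> [/subr0_eq|->]; rewrite ?subrr. Qed.

Lemma word_mx1 (F : comNzRingType) (f : J -> F) i : word_mx f [:: i] = gen_mx f i.
Proof. by rewrite /= mulmx1. Qed.

Lemma det2 (F : comNzRingType) (A : 'M[F]_2) :
  \det A = A 0 0 * A 1 1 - A 0 1 * A 1 0.
Proof.
have l01 : lift ord0 ord0 = 1 :> 'I_2 by apply: val_inj.
have l10 : lift 1 ord0 = 0 :> 'I_2 by apply: val_inj.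
rewrite (expand_det_row _ 0) big_ord_recl big_ord1 l01 /cofactor !det_mx11 !mxE.
by rewrite -[lift 0 0]/(lift ord0 ord0) l01 l10 expr0 mul1r expr1 mulN1r mulrN.
Qed.

Lemma rep_one (F : closedFieldType) (rho : G -> 'M[F]_2) : sl2_rep rho -> rho 1%g = 1%:M.
Proof.
case=> rdet rM; have u : rho 1%g \in unitmx by rewrite unitmxE rdet unitr1.
by rewrite -[LHS]mul1mx -{1}(mulVmx u) -mulmxA -rM mulg1 mulVmx.
Qed.

Lemma eigenvalues_definable : definable (fun F (e : bool -> F) =>
  (Defs.eigenvalue_map mu la @` R_U (F := F) mu la) (e true, e false)).
Proof.
have [wm wmE] := value_surj mu; have [wl wlE] := value_surj la.
pose D (F : closedFieldType) (e : bool -> F) (f : J -> F) :=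
  forall t, rep_equations wm wl t -> teval (sumf e f) t = 0.
have dD : definable (fun F e => exists f, D F e f).
  apply: (def_ex (D := D)); apply: def_ext (def_equations (rep_equations wm wl)) _.
  move=> F u; rewrite /D; suff -> : sumf (u \o inl) (u \o inr) = u by [].
  by apply/funext => -[].
apply: def_ext dD _ => F e; split=> [[rho [[rdet rM] um ul] [em el]]|[f fD]].
  pose f (p : J) : F := rho (gen p.1) p.2.1 p.2.2.
  have genE i : gen_mx f i = rho (gen i) by apply/matrixP => a b; rewrite mxE.
  have wordE w : word_mx f w = rho (value w).
    elim: w => [|i w IH] /=; first by rewrite [RHS](rep_one (conj rdet rM)).
    by rewrite IH genE -rM.
  exists f => t [[i ->]|[[v [w [a [b [E ->]]]]]|[[->|->]|[->|->]]]].
  - apply/sub_termE.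
    rewrite (_ : teval _ (sub_term _ _) = \det (word_mx f [:: i])).
      by rewrite word_mx1 genE rdet.
    by rewrite det2 -!(word_termE e) /= mulrN1z mulN1r.
  - by apply/sub_termE; rewrite !word_termE !wordE E.
  - by rewrite word_termE wordE wmE.
  - by rewrite word_termE wordE wlE.
  - by apply/sub_termE; rewrite word_termE wordE wmE.
  - by apply/sub_termE; rewrite word_termE wordE wlE.
have relE v w : value v = value w -> word_mx f v = word_mx f w.
  move=> E; apply/matrixP => a b; rewrite -!(word_termE e).
  by apply/sub_termE/fD; right; left; exists v, w, a, b.
have detE i : \det (gen_mx f i) = 1.
  rewrite -word_mx1 det2 -!(word_termE e).
  have /sub_termE /= := fD _ (or_introl (ex_intro _ i erefl)).
  by rewrite mulrN1z mulN1r.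
(* Any choice of a word for each element defines the representation, since [relE] makes the matrix
   independent of the word. *)
have /choice[wd wdE] := value_surj.
pose rho g := word_mx f (wd g).
have rhoE w g : value w = g -> rho g = word_mx f w.
  by move=> E; apply: relE; rewrite wdE.
exists rho; last first.
  rewrite /Defs.eigenvalue_map (rhoE wm _ wmE) (rhoE wl _ wlE) -!(word_termE e).
  have -> : teval (sumf e f) (word_term wm 0 0) = teval (sumf e f) (Var (inl true)).
    by apply/sub_termE/fD; do 3!right; left.
  have -> : teval (sumf e f) (word_term wl 0 0) = teval (sumf e f) (Var (inl false)).
    by apply/sub_termE/fD; do 3!right; right.
  by [].
split; first split.
- move=> g; rewrite /rho; elim: (wd g) => [|i w IH] /=; first by rewrite det1.
  by rewrite det_mulmx detE IH mulr1.
- move=> g h; rewrite -word_mx_cat; apply: rhoE.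
  by rewrite /value map_cat word_prod_cat -!/(value _) !wdE.
- rewrite /upper_triangular (rhoE wm _ wmE) -(word_termE e).
  by apply: fD; do 2!right; left; left.
- rewrite /upper_triangular (rhoE wl _ wlE) -(word_termE e).
  by apply: fD; do 2!right; left; right.
Qed.

End EigenvalueMap.

(** * Newton polygons and translations *)

Section Translation.
Variable R : realType.
Local Notation R2 := (R^o * R^o)%type.
Implicit Types (t a b z : R2) (S T : set R2).

Definition translate t S : set R2 := [set z | S (z - t)].

Lemma translate_hull_sub t S : convex_hull (translate t S) `<=` translate t (convex_hull S).
Proof.
move=> z H C [Cc SC] /=.
suff : translate t C z by [].
apply: H; split; last by move=> w /SC.
move=> x y l /set_mem Cx /set_mem Cy; apply/mem_set; rewrite /translate /=.
have /set_mem := Cc (x - t : R2) (y - t : R2) l (mem_set Cx) (mem_set Cy).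
suff -> : conv l (x - t : convex_lmodType R2) (y - t : R2) = conv l x y - t :> R2 by [].
rewrite /conv /=.
rewrite !scalerBr addrACA -opprD -scalerDl /unstable.onem.
by rewrite [X in X *: t](_ : _ = 1) ?scale1r // addrC subrK.
Qed.

Lemma translate_hull t S : convex_hull (translate t S) = translate t (convex_hull S).
Proof.
apply/seteqP; split; first exact: translate_hull_sub.
move=> z; rewrite /translate /= => H.
have SE : S = translate (- t) (translate t S).
  by apply/funext => w; rewrite /translate /= opprK addrK.
rewrite {1}SE in H; have := translate_hull_sub H.
by rewrite /translate /= opprK subrK.
Qed.

Lemma translate_edge t P a b : is_edge P a b -> is_edge (translate t P) (a + t) (b + t).
Proof.
case=> ab [u E]; split; first by rewrite (inj_eq (addIr t)).
have segE w : segment (a + t) (b + t) w <-> segment a b (w - t).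
  have d : b + t - (a + t) = b - a by rewrite opprD addrACA subrr addr0.
  split=> -[s s01 wE]; exists s => //.
    by rewrite wE d [a + t + _]addrAC addrK.
  by rewrite d [a + t + _]addrAC -wE subrK.
exists u; apply/funext => z; apply/propext; rewrite segE E /translate /=.
split=> -[Pz H]; split=> // w Pw.
  by have := H _ Pw; case: (w) (z) (t) => [? ?] [? ?] [? ?] /=; lra.
have := H (w + t); rewrite addrK => /(_ Pw).
by case: (w) (z) (t) => [? ?] [? ?] [? ?] /=; lra.
Qed.

Definition exponents (F : fieldType) (f : {poly {poly F}}) : set R2 :=
  [set z | exists i j : nat, f`_i`_j != 0 /\ z = (i%:R : R^o, j%:R : R^o)].

(** The two fields are unrelated: detection sees the exponents only, and edge directions are
    invariant under translation. *)
Lemma strongly_detected_translate (F F' : fieldType) (f : {poly {poly F}})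
    (g : {poly {poly F'}}) t r s :
  exponents g = translate t (exponents f) ->
  strongly_detected R f r s -> strongly_detected R g r s.
Proof.
move=> E [a [b [ab [c abc]]]]; exists (a + t), (b + t); split.
  rewrite /newton_polygon -/(exponents g) E translate_hull.
  exact: translate_edge ab.
by exists c; rewrite -abc opprD addrACA subrr addr0.
Qed.

Lemma exponents_monomial (F : fieldType) (f : {poly {poly F}}) (c : F) i j : c != 0 ->
  exponents (c%:P%:P * ('X^i * ('X^j)%:P) * f) = translate (i%:R, j%:R) (exponents f).
Proof.
move=> c0.
have coE k l : (c%:P%:P * ('X^i * ('X^j)%:P) * f)`_k`_l =
    if (k < i)%N || (l < j)%N then 0 else c * f`_(k - i)`_(l - j).
  have -> : c%:P%:P * ('X^i * ('X^j)%:P) * f = (c%:P * 'X^j)%:P * f * 'X^i.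
    by rewrite polyCM; ring.
  rewrite coefMXn; case: ltnP => //= ki; first by rewrite coef0.
  by rewrite coefCM -mulrA coefCM coefXnM; case: ltnP; rewrite ?mulr0.
apply/seteqP; split=> z.
  move=> [k [l []]]; rewrite coE.
  case: (ltnP k i) => [|ki]; rewrite /= ?eqxx //.
  case: (ltnP l j) => [|lj]; rewrite /= ?eqxx // => nz ->; exists (k - i)%N, (l - j)%N; split.
    by apply: contraNneq nz => ->; rewrite mulr0.
  by rewrite !natrB.
move=> [k [l [nz E]]]; exists (k + i)%N, (l + j)%N; split.
  by rewrite coE !ltnNge !leq_addl /= !addnK mulf_neq0.
rewrite -[LHS](subrK (i%:R, j%:R)) E; congr (_, _); by rewrite natrD.
Qed.

End Translation.

(** * Transfer of curves between characteristics *)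

Section BoundedDegree.
Variables (F : closedFieldType) (d : nat).
Local Notation P := {poly {poly F}}.
Local Notation C := ('I_d * 'I_d)%type.

(** A polynomial of degree less than [d] in each variable as a finite family of coefficients, which
    is what a first-order sentence can quantify over. *)
Definition bpoly (c : C -> F) : P :=
  \sum_(i < d) (\sum_(j < d) c (i, j) *: 'X^j) *: 'X^i.

Lemma coef_sum_ord (A : nzRingType) (a : 'I_d -> A) n :
  (\sum_(i < d) a i *: 'X^i)`_n = if insub n is Some i then a i else 0.
Proof.
rewrite coef_sum; case: insubP => [i _ <-|].
  rewrite (bigD1 i) //= coefZ coefXn eqxx mulr1 big1 ?addr0 // => j ji.
  by rewrite coefZ coefXn eq_sym val_eqE (negbTE ji) mulr0.
rewrite -leqNgt => dn; rewrite big1 // => j _.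
by rewrite coefZ coefXn gtn_eqF ?mulr0 // (leq_trans _ dn).
Qed.

Lemma coef_bpoly c (i j : 'I_d) : (bpoly c)`_i`_j = c (i, j).
Proof. by rewrite !(coef_sum_ord, valK). Qed.

Lemma coef_bpoly_neq0 c m n : (bpoly c)`_m`_n != 0 <->
  exists p : C, c p != 0 /\ (m = p.1 :> nat /\ n = p.2 :> nat).
Proof.
split=> [|[[i j] [cp [-> ->]]]]; last by rewrite coef_bpoly.
rewrite coef_sum_ord; case: insubP => [i _ iE|]; last by rewrite coef0 eqxx.
rewrite coef_sum_ord; case: insubP => [j _ jE|]; last by rewrite eqxx.
by exists (i, j).
Qed.

Lemma bpolyE (f : P) : (size f <= d)%N -> (sizeY f <= d)%N ->
  f = bpoly (fun p => f`_p.1`_p.2).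
Proof.
move=> sx sy; apply/polyP => m; rewrite coef_sum_ord.
case: insubP => [i _ <-|]; last first.
  by rewrite -leqNgt => dm; rewrite nth_default // (leq_trans sx).
apply/polyP => n; rewrite coef_sum_ord.
case: insubP => [j _ <-//|]; rewrite -leqNgt => dn.
by rewrite nth_default // (leq_trans (max_size_coefXY _ _)) // (leq_trans sy).
Qed.

Lemma size_bpoly c : (size (bpoly c) <= d)%N /\ (sizeY (bpoly c) <= d)%N.
Proof.
split.
  apply/leq_sizeP => m dm; rewrite coef_sum_ord; case: insubP => // i lt.
  by rewrite ltnNge dm in lt.
rewrite /sizeY; apply/bigmax_leqP => i _; rewrite coef_sum_ord.
case: insubP => [k _ _|_]; last by rewrite size_poly0.
apply/leq_sizeP => m dm; rewrite coef_sum_ord; case: insubP => // j lt.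
by rewrite ltnNge dm in lt.
Qed.

Definition evc (c : C -> F) (z : bool -> F) : F :=
  \sum_(i < d) \sum_(j < d) c (i, j) * (z true ^+ i * z false ^+ j).

Lemma ev_bpoly c z : ev (bpoly c) z = evc c (pt z).
Proof.
rewrite /ev /bpoly !horner_sum; apply: eq_bigr => i _.
rewrite hornerZ hornerXn hornerM -polyC_exp hornerC horner_sum mulr_suml.
by apply: eq_bigr => j _; rewrite hornerZ hornerXn -mulrA [_ ^+ j * _]mulrC.
Qed.

End BoundedDegree.

Lemma pf_evc I d (hc : 'I_d * 'I_d -> I) (hz : bool -> I) :
  polyfun (fun F (u : I -> F) => evc (u \o hc) (u \o hz)).
Proof.
apply: pf_sum => i; apply: pf_sum => j; apply: pf_mul; first exact: pf_var.
by apply: pf_mul; apply: pf_exp; exact: pf_var.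
Qed.

Definition in_torus (F : closedFieldType) (z : bool -> F) : Prop :=
  z true <> 0 /\ z false <> 0.

Lemma def_in_torus I (hz : bool -> I) :
  definable (fun F (u : I -> F) => in_torus (u \o hz)).
Proof. by apply: def_and; apply: def_not; apply: def_eq0; exact: pf_var. Qed.

Section Sentences.
Variable E : forall F : closedFieldType, (bool -> F) -> Prop.
Hypothesis dE : definable E.

Definition dense_sentence d (F : closedFieldType) : Prop :=
  exists c : 'I_d * 'I_d -> F,
    (exists z : bool -> F, evc c z <> 0) /\
    forall z : bool -> F, in_torus z -> evc c z <> 0 -> E z.

(* Up to the points w, E is the zero locus of a squarefree polynomial with
   exponent set sigma; bounding the degrees of a and b by d makes the last
   clause first-order. *)
Definition curve_sentence d k (sigma : {set 'I_d * 'I_d}) (F : closedFieldType) : Prop :=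
  exists c : 'I_d * 'I_d -> F,
    (forall p, (c p = 0) <-> ~ (p \in sigma)) /\
    (exists w : 'I_k * bool -> F, forall z : bool -> F, in_torus z ->
      (forall i, ~ (w (i, true) = z true /\ w (i, false) = z false)) ->
      (E z <-> evc c z = 0)) /\
    (forall a b : 'I_d * 'I_d -> F,
      (forall z : bool -> F, evc a z ^+ 2 * evc b z = evc c z) ->
      forall z : bool -> F, in_torus z -> evc a z <> 0).

(** Here and in [def_curve] each quantifier appends a summand to the type of variables; the chains
    of [inl] and [inr] record how many quantifiers ago a family or a point was bound. *)
Lemma def_dense d : definable (fun F (_ : void -> F) => dense_sentence d F).
Proof.
apply: (def_ex (D := fun F (e : void -> F) (c : 'I_d * 'I_d -> F) =>
    (exists z : bool -> F, evc c z <> 0) /\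
    forall z : bool -> F, in_torus z -> evc c z <> 0 -> E z)).
apply: def_and.
  apply: (def_ex (D := fun F (u : void + 'I_d * 'I_d -> F) (z : bool -> F) =>
     evc (u \o inr) z <> 0)).
  by apply: def_not; apply: def_eq0; exact: (pf_evc (inl \o inr) inr).
apply: (def_forall (D := fun F (u : void + 'I_d * 'I_d -> F) (z : bool -> F) =>
     in_torus z -> evc (u \o inr) z <> 0 -> E z)).
apply: def_imp; first exact: (def_in_torus inr).
apply: def_imp.
  by apply: def_not; apply: def_eq0; exact: (pf_evc (inl \o inr) inr).
exact: (def_reindex inr dE).
Qed.

Lemma def_curve d k sigma : definable (fun F (_ : void -> F) => @curve_sentence d k sigma F).
Proof.
pose C := ('I_d * 'I_d)%type.
apply: (def_ex (D := fun F (e : void -> F) (c : C -> F) =>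
    (forall p, (c p = 0) <-> ~ (p \in sigma)) /\
    (exists w : 'I_k * bool -> F, forall z : bool -> F, in_torus z ->
      (forall i, ~ (w (i, true) = z true /\ w (i, false) = z false)) ->
      (E z <-> evc c z = 0)) /\
    (forall a b : C -> F,
      (forall z : bool -> F, evc a z ^+ 2 * evc b z = evc c z) ->
      forall z : bool -> F, in_torus z -> evc a z <> 0))).
apply: def_and; [|apply: def_and].
- apply: def_all => p; apply: def_iff; last exact: def_const.
  by apply: def_eq0; exact: pf_var.
- apply: (def_ex (D := fun F (u : void + C -> F) (w : 'I_k * bool -> F) =>
    forall z : bool -> F, in_torus z ->
      (forall i, ~ (w (i, true) = z true /\ w (i, false) = z false)) ->
      (E z <-> evc (u \o inr) z = 0))).
  apply: (def_forall (D := fun F (u : (void + C) + 'I_k * bool -> F) (z : bool -> F) =>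
     in_torus z ->
      (forall i, ~ (u (inr (i, true)) = z true /\ u (inr (i, false)) = z false)) ->
      (E z <-> evc (u \o inl \o inr) z = 0))).
  apply: def_imp; first exact: (def_in_torus inr).
  apply: def_imp.
    by apply: def_all => i; apply: def_not; apply: def_and; apply: def_eq; exact: pf_var.
  apply: def_iff; first exact: (def_reindex inr dE).
  by apply: def_eq0; exact: (pf_evc (inl \o inl \o inr) inr).
- apply: (def_forall (D := fun F (u : void + C -> F) (a : C -> F) => forall b : C -> F,
      (forall z : bool -> F, evc a z ^+ 2 * evc b z = evc (u \o inr) z) ->
      forall z : bool -> F, in_torus z -> evc a z <> 0)).
  apply: (def_forall (D := fun F (u : (void + C) + C -> F) (b : C -> F) =>
      (forall z : bool -> F, evc (u \o inr) z ^+ 2 * evc b z = evc (u \o inl \o inr) z) ->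
      forall z : bool -> F, in_torus z -> evc (u \o inr) z <> 0)).
  apply: def_imp.
    apply: (def_forall (D := fun F (u : ((void + C) + C) + C -> F) (z : bool -> F) =>
      evc (u \o inl \o inr) z ^+ 2 * evc (u \o inr) z = evc (u \o inl \o inl \o inr) z)).
    apply: def_eq; last exact: (pf_evc (inl \o inl \o inl \o inr) inr).
    apply: pf_mul; last exact: (pf_evc (inl \o inr) inr).
    by apply: pf_exp; exact: (pf_evc (inl \o inl \o inr) inr).
  apply: (def_forall (D := fun F (u : ((void + C) + C) + C -> F) (z : bool -> F) =>
    in_torus z -> evc (u \o inl \o inr) z <> 0)).
  apply: def_imp; first exact: (def_in_torus inr).
  by apply: def_not; apply: def_eq0; exact: (pf_evc (inl \o inl \o inr) inr).
Qed.

Lemma ptE (F : closedFieldType) (z : bool -> F) : pt (z true, z false) = z.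
Proof. by apply/funext => -[]. Qed.

Lemma in_torusE (F : closedFieldType) (z : F * F) : in_torus (pt z) <-> torus2 z.
Proof. by split=> -[/eqP ? /eqP ?]. Qed.

Definition locus (F : closedFieldType) : set (F * F) := [set z | E (pt z)].
Arguments locus : clear implicits.

Lemma dense_or_curve (F : closedFieldType) :
  (exists d, dense_sentence d F) \/
  (exists d k (sigma : {set 'I_d * 'I_d}), sigma != finset.set0 /\ curve_sentence k sigma F).
Proof.
have [[h h0 hE]|[h h0 fin]] := tame_dense_or_curve (tame_definable F dE).
  left; pose d := maxn (size h) (sizeY h).
  have hb := @bpolyE F d h (leq_maxl _ _) (leq_maxr _ _).
  exists d, (fun p : 'I_d * 'I_d => h`_p.1`_p.2); split.
    have [z tz hz] := torus_nonzero h0; exists (pt z).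
    by rewrite -ev_bpoly -hb; exact/eqP.
  move=> z tz; rewrite -(ptE z) -ev_bpoly -hb => /eqP hz.
  by apply: hE => //; case: tz => /eqP ? /eqP ?.
right; have [A [A0 sA AE]] := sqfree_part h0.
have [s sE] := (finite_seqP _).1 fin.
pose d := maxn (size A) (sizeY A).
have Ab := @bpolyE F d A (leq_maxl _ _) (leq_maxr _ _).
pose c (p : 'I_d * 'I_d) := A`_p.1`_p.2.
exists d, (size s), [set p | c p != 0]%SET; split.
  apply: contraNneq A0 => S0; rewrite Ab; apply/eqP/polyP => m; apply/polyP => n.
  rewrite !coef0; apply: contrapT => /eqP/coef_bpoly_neq0[p [cp _]].
  by have : p \in [set p | c p != 0]%SET; [rewrite inE|rewrite S0 inE].
exists c; split; [|split].
- by move=> p; rewrite inE; split=> [->|/negP]; rewrite ?eqxx // negbK => /eqP.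
- exists (fun p => let: (i, b) := p in pt (tnth (in_tuple s) i) b) => z tz nz.
  rewrite -(ptE z) -ev_bpoly -Ab; set v := (z true, z false).
  have tv : torus2 v by case: tz => /eqP ? /eqP ?.
  have nv : ~ (v \in s).
    by move=> /seq_tnthP[i vE]; apply: (nz i); rewrite -vE.
  have Ah : ev A v = 0 <-> ev h v = 0.
    by have [H1 H2] := AE v; split=> e0; [case: (H1 (conj tv e0))|case: (H2 (conj tv e0))].
  rewrite Ah; apply: contrapT => nE; apply: nv.
  by have : [set` s] v by rewrite -sE.
- move=> a b ab z tz; rewrite -(ptE z) -ev_bpoly; apply/eqP.
  apply: (sA _ (bpoly b)); last by case: tz => /eqP ? /eqP ?.
  (* The sentence only gives an equality of values. It is an equality of polynomials because a
     nonzero polynomial has a nonzero value on the torus. *)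
  apply/eqP; rewrite -subr_eq0; apply: contrapT => /negP/torus_nonzero[v _ /eqP]; apply.
  have := ab (pt v); rewrite -!ev_bpoly -Ab => H.
  have evB (f g : {poly {poly F}}) w : ev (f - g) w = ev f w - ev g w.
    by rewrite /ev !hornerE.
  by rewrite evB expr2 !evM -expr2 H subrr.
Qed.

(** The empty set is written as the zero locus of 1, so that the dense case fits the same conclusion
    as the curve case. *)
Lemma dense_one_dim_part d (F : closedFieldType) : locus F `<=` @torus2 F ->
  dense_sentence d F -> one_dim_part (zariski_closure (locus F)) = torus_zeros 1.
Proof.
move=> ET [c [[z cz] cE]].
rewrite (one_dim_part_dense (h := bpoly c) ET).
- by apply/esym; rewrite -subset0 => w [_]; rewrite /ev !hornerC => /eqP; rewrite oner_eq0.
- apply/eqP => c0; apply: cz; rewrite -(ptE z) -ev_bpoly c0.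
  by rewrite /ev !horner0.
- by move=> w /in_torusE tw; rewrite ev_bpoly => /eqP; exact: cE.
Qed.

Lemma curve_one_dim_part d k (sigma : {set 'I_d * 'I_d}) (F : closedFieldType) :
  locus F `<=` @torus2 F -> sigma != finset.set0 -> curve_sentence k sigma F ->
  exists A : {poly {poly F}}, [/\ A != 0, sqfree A,
    one_dim_part (zariski_closure (locus F)) = torus_zeros A &
    forall m n, A`_m`_n != 0 <->
      exists p, p \in sigma /\ (m = p.1 :> nat /\ n = p.2 :> nat)].
Proof.
move=> ET s0 [c [cs [[w wE] csq]]].
have csE p : c p != 0 <-> p \in sigma.
  split=> [/eqP cp|ps]; first by apply: contrapT => /(cs p).
  by apply/eqP => /(cs p).
have coefE m n : (bpoly c)`_m`_n != 0 <->
    exists p, p \in sigma /\ (m = p.1 :> nat /\ n = p.2 :> nat).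
  by rewrite coef_bpoly_neq0; split=> -[p [/csE ? ?]]; exists p.
have A0 : bpoly c != 0.
  have /set0Pn[p ps] := s0; apply/eqP => e0.
  have : (bpoly c)`_p.1`_p.2 != 0 by apply/coefE; exists p.
  by rewrite e0 !coef0 eqxx.
have sqA : sqfree (bpoly c).
  move=> a b cE z tz; have [sx sy] := size_bpoly c.
  have a0 : a != 0 by apply: contraNneq A0 => e; rewrite cE e expr0n mul0r.
  have b0 : b != 0 by apply: contraNneq A0 => e; rewrite cE e mulr0.
  (* Factors do not exceed the product in either degree, so every factorisation of [bpoly c] falls
     under the bound [d] of the sentence. *)
  have szb (T : idomainType) (f g : {poly T}) : f != 0 -> g != 0 ->
     (size f <= size (f ^+ 2 * g)%R)%N /\ (size g <= size (f ^+ 2 * g)%R)%N.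
    move=> f0 g0; rewrite !size_mul ?expf_neq0 // ?mulf_neq0 //.
    move: f0 g0; rewrite -!size_poly_gt0; move: (size f) (size g) => x y; lia.
  have [ax bx] := szb _ _ _ a0 b0.
  have [ay by_] : (sizeY a <= d)%N /\ (sizeY b <= d)%N.
    move: sy; rewrite cE !sizeYE rmorphM rmorphXn /=.
    have := szb _ (swapXY a) (swapXY b); rewrite !swapXY_eq0 => /(_ a0 b0)[h1 h2] h3.
    by split; [exact: leq_trans h1 h3|exact: leq_trans h2 h3].
  rewrite -cE in ax bx.
  have aE := bpolyE (leq_trans ax sx) ay; have bE := bpolyE (leq_trans bx sx) by_.
  rewrite aE ev_bpoly; apply/eqP.
  apply: (csq _ (fun p : 'I_d * 'I_d => b`_p.1`_p.2)); last exact/in_torusE.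
  move=> v; rewrite -(ptE v) -!ev_bpoly -aE -bE.
  by rewrite cE expr2 !evM -expr2.
exists (bpoly c); split => //; apply: one_dim_part_curve => //.
apply: (@sub_finite_set _ _ [set` [seq (w (i, true), w (i, false)) | i <- enum 'I_k]]).
  move=> z [tz nE] /=; apply: contrapT => zn; apply: nE.
  rewrite ev_bpoly; apply: wE; first exact/in_torusE.
  move=> i [wt wf]; apply: zn; apply/mapP; exists i; first by rewrite mem_enum.
  by rewrite wt wf; case: (z).
exact: finite_seq.
Qed.

(** The algebraic numbers decide which of the two sentences holds, with which parameters; transfer
    carries it to every field in which [N] is nonzero. [Sigma] is the common exponent set. *)
Lemma uniform_polynomial :
  (forall F, locus F `<=` @torus2 F) ->
  exists N (Sigma : nat -> nat -> Prop), (0 < N)%N /\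
    forall F : closedFieldType, N%:R != 0 :> F ->
    exists A : {poly {poly F}}, [/\ A != 0, sqfree A,
      one_dim_part (zariski_closure (locus F)) = torus_zeros A &
      forall m n, A`_m`_n != 0 <-> Sigma m n].
Proof.
move=> ET; have C0 N : (0 < N)%N -> N%:R != 0 :> algC by rewrite pnatr_eq0 -lt0n.
have nov (F : closedFieldType) (v : void) : F by [].
case: (dense_or_curve algC) => [[d dC]|[d [k [sigma [s0 cC]]]]].
  have [N N0 HN] := sentence_transfer (def_dense d).
  exists N, (fun m n => m = 0%N /\ n = 0%N); split=> // F NF.
  exists 1; split; first exact: oner_neq0.
  - move=> a b E1 z _; apply/eqP => az.
    have : ev (1 : {poly {poly F}}) z = 0 by rewrite E1 expr2 !evM az !mul0r.
    by rewrite /ev !hornerC => /eqP; rewrite oner_eq0.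
  - apply: (dense_one_dim_part (d := d) (ET F)).
    exact: (HN _ _ (nov algC) (nov F) (C0 N N0) NF dC).
  - move=> m n; rewrite coefC; case: m => [|m] /=; last by rewrite coef0 eqxx; split=> // -[].
    rewrite coefC; case: n => [|n] /=; first by rewrite oner_eq0.
    by rewrite eqxx; split=> // -[].
have [N N0 HN] := sentence_transfer (def_curve k sigma).
exists N, (fun m n => exists p, p \in sigma /\ (m = p.1 :> nat /\ n = p.2 :> nat)).
split=> // F NF; apply: (curve_one_dim_part (k := k) (ET F) s0).
exact: (HN _ _ (nov algC) (nov F) (C0 N N0) NF cC).
Qed.

End Sentences.

(** * Uniqueness of the A-polynomial up to units of the Laurent ring *)

Section Uniqueness.
Variable F : closedFieldType.
Local Notation P := {poly {poly F}}.
Implicit Types (s t f A : P).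

(** Both variables are prime: one that divides the product divides [s] or [t] and is cancelled
    there, until only constants remain. *)
Lemma monomial_factor (u : F) a b s t : u != 0 ->
  s * t = u%:P%:P * ('X^a * ('X^b)%:P) ->
  exists (v : F) i j, v != 0 /\ s = v%:P%:P * ('X^i * ('X^j)%:P).
Proof.
move=> u0; have evX0 (p : P) : p`_0 = 0 -> exists q, p = 'X * q.
  move=> p0; exists (\poly_(i < size p) p`_i.+1).
  apply/polyP => i; rewrite coefXM coef_poly; case: i => [|i] //=.
  by case: ltnP => // h; rewrite nth_default // ltnW.
have [n] := ubnP (a + b); elim: n a b s t => // n IH a b s t lt E.
case: a E lt => [|a] E lt; last first.
  have /eqP : (s * t)`_0 = 0.
    by rewrite E coefCM exprS -mulrA coefXM mulr0.
  rewrite coefM big_ord_recl big_ord0 addr0 /= mulf_eq0 => /orP[]/eqP/evX0[q qE].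
    have [||v [i [j [v0 qv]]]] := IH a b q t; first by lia.
      apply: (@mulfI _ 'X); first by rewrite polyX_eq0.
      by rewrite [LHS]mulrA -qE E exprS; ring.
    by exists v, i.+1, j; split=> //; rewrite qE qv exprS; ring.
  apply: (IH a b s q); first by lia.
  apply: (@mulfI _ 'X); first by rewrite polyX_eq0.
  by rewrite [LHS]mulrCA -qE E exprS; ring.
case: b E lt => [|b] E lt; last first.
  have at0 : at_l 0 (('X^(b.+1))%:P : P) = 0.
    by rewrite /at_l map_polyC /= /horner_eval hornerXn expr0n.
  have /eqP : at_l 0 (s * t) = 0 by rewrite E !at_lM at0 !mulr0.
  rewrite at_lM mulf_eq0 => /orP[]/eqP/at_l_eq0[q]; rewrite subr0 => qE.
    have [||v [i [j [v0 qv]]]] := IH 0%N b q t; first by lia.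
      apply: (@mulfI _ ('X%:P : P)); first by rewrite polyC_eq0 polyX_eq0.
      by rewrite [LHS]mulrA -qE E exprS polyCM; ring.
    by exists v, i, j.+1; split=> //; rewrite qE qv exprS polyCM; ring.
  apply: (IH 0%N b s q); first by lia.
  apply: (@mulfI _ ('X%:P : P)); first by rewrite polyC_eq0 polyX_eq0.
  by rewrite [LHS]mulrCA -qE E exprS polyCM; ring.
have c0 : u%:P%:P != 0 :> P by rewrite !polyC_eq0.
rewrite !expr0 !mulr1 in E.
have s0 : s != 0 by apply: contraNneq c0 => e; rewrite -E e mul0r.
have t0 : t != 0 by apply: contraNneq c0 => e; rewrite -E e mulr0.
have ms : degree_sum s = 0%N.
  have := degree_sum_const u; rewrite -E degree_sumM //; lia.
have [v v0 sE] := degree_sum_eq0 s0 ms.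
by exists v, 0%N, 0%N; rewrite !expr0 !mulr1.
Qed.

(** In the Laurent ring [A] and [B] generate the same ideal, that of the polynomials vanishing on
    the one-dimensional part: [B] by its definition and the Nullstellensatz for [g], [A] because it
    is squarefree. The two cofactors then multiply to a monomial, so each of them is one up to a
    constant. *)
Lemma A_polynomial_unique (G : groupType) (m l : G) (A B : P) :
  is_A_polynomial m l B -> A != 0 -> sqfree A ->
  one_dim_part (eigenvalue_variety m l) = torus_zeros A ->
  exists (i j a b : nat) (u : F), u != 0 /\
    'X^i * ('X^j)%:P * B = u%:P%:P * ('X^a * ('X^b)%:P) * A.
Proof.
move=> [g [gV gB]] A0 sqA AV.
have gA z : torus_zeros g z <-> torus_zeros A z.
  by rewrite -AV gV.
have g0 : g != 0.
  apply/eqP => g0; have [z tz /eqP Az] := torus_nonzero A0; apply: Az.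
  have gz : ev g z = 0 by rewrite g0 /ev !horner0.
  by have [_ ->] := (gA z).1 (conj tz gz).
have mono_ev i j z : torus2 z -> ev ('X^i * ('X^j)%:P : P) z != 0.
  move=> [z1 z2]; rewrite /ev hornerM hornerXn hornerC hornerM -polyC_exp hornerC hornerXn.
  by rewrite mulf_neq0 // expf_neq0.
have evXn (f : P) n z : ev (f ^+ n) z = ev f z ^+ n.
  by rewrite /ev !horner_exp.
have vanB f : (forall z, torus_zeros A z -> ev f z = 0) <-> laurent_ideal B f.
  split=> [fA|/gB[n [i [j [q E]]]] z /gA[tz gz]].
    have [|n Hn] := principal_nullstellensatz (f := f) g0.
      by move=> z /gA; exact: fA.
    by apply/gB; exists n.
  have /eqP := congr1 (fun p => ev p z) E; rewrite !evM gz mulr0 -evM mulf_eq0.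
  by rewrite (negbTE (mono_ev _ _ _ tz)) /= evXn expf_eq0 => /andP[_ /eqP].
have [i [j [s sE]]] : laurent_ideal B A by apply/vanB => z [].
have vB : forall z, torus_zeros A z -> ev B z = 0.
  by apply/vanB; exists 0%N, 0%N, 1; rewrite !expr0 polyC1 !mul1r.
have [i' [j' [t tE]]] : laurent_ideal A B.
  by apply: (sqfree_laurent_ideal A0 sqA (@finite_set0 _)) => z Az _; exact: vB.
have [v [a [b [v0 tv]]]] : exists (v : F) a b, v != 0 /\ t = v%:P%:P * ('X^a * ('X^b)%:P).
  apply: (@monomial_factor 1 (i + i') (j + j') t s (oner_neq0 _)).
  apply: (mulIf A0); rewrite mulrAC -tE.
  transitivity ('X^i' * ('X^j')%:P * (s * B)); first by ring.
  by rewrite -sE !exprD polyCM polyC1; ring.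
by exists i', j', a, b, v; split=> //; rewrite tE tv.
Qed.

End Uniqueness.

(** * Detected slopes *)

Lemma eigenvalues_torus (F : closedFieldType) (G : groupType) (m l : G) :
  Defs.eigenvalue_map m l @` R_U (F := F) m l `<=` @torus2 F.
Proof.
move=> _ [rho [[rdet _] um ul] <-].
have nz g : upper_triangular (rho g) -> rho g 0 0 != 0.
  move=> ug; have := rdet g; rewrite det2 [rho g 1 0]ug mulr0 subr0 => E.
  by apply: contra_eq_neq E => ->; rewrite mul0r eq_sym oner_eq0.
by split; exact: nz.
Qed.

(** One implication is enough, as the conditions on the two fields are symmetric. Both A-polynomials
    have the exponents of the uniform polynomial up to translation. *)
Lemma strongly_detected_uniform (R : realType) (G : groupType) (gs : seq G) (m l : G) :
  (forall g, generated gs g) -> exists2 N : nat, (0 < N)%N &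
  forall (F F' : closedFieldType) (A : {poly {poly F}}) (A' : {poly {poly F'}}),
    N%:R != 0 :> F -> N%:R != 0 :> F' ->
    is_A_polynomial m l A -> is_A_polynomial m l A' ->
    forall r s, strongly_detected R A r s -> strongly_detected R A' r s.
Proof.
move=> gsP; have dE := eigenvalues_definable gsP m l.
have locusE (F : closedFieldType) : locus (F := F) (fun F (e : bool -> F) =>
    (Defs.eigenvalue_map m l @` R_U (F := F) m l) (e true, e false)) =
    Defs.eigenvalue_map m l @` R_U (F := F) m l.
  by apply/funext => -[].
have [|N [Sigma [N0 HN]]] := uniform_polynomial dE.
  by move=> F; rewrite locusE; exact: eigenvalues_torus.
exists N => // F F' A A' NF NF' AA AA' r s.
have [B [B0 sqB BV BS]] := HN F NF; have [B' [B'0 sqB' BV' BS']] := HN F' NF'.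
rewrite locusE in BV; rewrite locusE in BV'.
have [i [j [a [b [u [u0 E]]]]]] := A_polynomial_unique AA B0 sqB BV.
have [i' [j' [a' [b' [u' [u'0 E']]]]]] := A_polynomial_unique AA' B'0 sqB' BV'.
have shift (K : closedFieldType) (f g : {poly {poly K}}) (v : K) k n p q : v != 0 ->
    'X^k * ('X^n)%:P * f = v%:P%:P * ('X^p * ('X^q)%:P) * g ->
    translate (k%:R, n%:R) (@exponents R _ f) = translate (p%:R, q%:R) (@exponents R _ g).
  move=> v0 fg; rewrite -(exponents_monomial R g _ _ v0) -fg.
  by rewrite -(exponents_monomial R f _ _ (oner_neq0 K)) polyC1 mul1r.
have EA := shift _ _ _ _ _ _ _ _ u0 E; have EA' := shift _ _ _ _ _ _ _ _ u'0 E'.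
have EB : @exponents R _ B = @exponents R _ B'.
  apply/seteqP; split=> z [x [y [nz ->]]]; exists x, y; split=> //.
    exact/BS'/BS.
  exact/BS/BS'.
have tt (t t' : R^o * R^o) S : translate t (translate t' S) = translate (t + t') S.
  by apply/funext => z; rewrite /translate /= opprD addrA.
have inv (t : R^o * R^o) S S' : translate t S = S' -> S = translate (- t) S'.
  move=> <-; rewrite tt addNr; apply/funext => z.
  by rewrite /translate /= subr0.
apply: strongly_detected_translate.
by rewrite (inv _ _ _ EA') -EB (inv _ _ _ (esym EA)) !tt.
Qed.

Theorem theorem42 (R : realType) (M : topologicalType)
    (Mmfd : is_manifold R M 3) (Mcpt : compact [set: M])
    (Mconn : connected [set: M]) (Mor : orientable R M 3)
    (Mirr : irreducible_3manifold R M)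
    (Mtorus : homeomorphic (mfd_boundary R 3 [set: M])
       (unit_sphere R 2 `*` unit_sphere R 2))
    (x : M) (Tx : mfd_boundary R 3 [set: M] x) (mu la : pi1 R Tx)
    (basis : is_Z2_basis mu la) :
  let incl : pi1 R Tx -> @pi1 R M [set: M] x I := pi1_incl I (@subsetT _ _) in
  finite_set [set p : nat | prime p /\
    ~ (forall (F0 Fp : closedFieldType)
         (A0 : {poly {poly F0}}) (Ap : {poly {poly Fp}}),
       [pchar F0] =i pred0 -> p \in [pchar Fp] ->
       is_A_polynomial (incl mu) (incl la) A0 ->
       is_A_polynomial (incl mu) (incl la) Ap ->
       forall (S : set M) (r s : int),
         essential_surface R S -> boundary_slope mu la S r s ->
         (strongly_detected R A0 r s <-> strongly_detected R Ap r s))].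
Proof.
move=> incl.
have [gs gsP] := pi1_finitely_generated (I : [set: M] x) Mmfd Mcpt Mconn.
have [N N0 HN] := strongly_detected_uniform R (incl mu) (incl la) gsP.
(* Every exceptional prime is at most [N]: a larger one does not divide [N], so [N] is nonzero in
   characteristic [p], as it is in characteristic 0. *)
apply: (@sub_finite_set _ _ `I_N.+1); last exact: finite_II.
move=> p [pp H] /=; rewrite ltnS leqNgt; apply/negP => Np; apply: H.
move=> F0 Fp A0 Ap ch0 chp AA0 AAp S r s _ _.
have NF0 : N%:R != 0 :> F0 by rewrite (GRing.pcharf0P _).1 // -lt0n.
have NFp : N%:R != 0 :> Fp.
  rewrite -(dvdn_pcharf chp); apply/negP => /(dvdn_leq N0).
  by rewrite leqNgt Np.
split; exact: HN.
Qed.
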